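(* Let $R_1,R_2$ be commutative rings with $1$, let $M$ be an $(R_1,R_2)$-bimodule, and let $R=\begin{pmatrix}R_1&M\\0&R_2\end{pmatrix}$. Let $$\ell:=\min\{n\in\mathbb N\mid na=0\text{ for all }a\in R_1\cup R_2\},\qquad m:=\min\{n\in\mathbb N\mid na=0\text{ for all }a\in M\},$$ where $\ell:=0$ (respectively $m:=0$) if the corresponding set is empty. Then for every $n\in\mathbb N$ there exists a chain of $\mathbb ZS_n$-submodules in $\frac{P_n(\mathbb Z)}{P_n(\mathbb Z)\cap\operatorname{Id}(R,\mathbb Z)}$ whose set of factors consists of one copy of $\mathbb Z_\ell$ and, for each $(\lambda_1,\lambda_2,\lambda_3)\vdash n$ with $\lambda_2\geqslant1$ and $\lambda_3\in\{0,1\}$, $(\lambda_1-\lambda_2+1)$ copies of $S(\lambda_1,\lambda_2,\lambda_3)/mS(\lambda_1,\lambda_2,\lambda_3)$.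
   Context: $\mathbb N=\{1,2,\dots\}$; $\mathbb Z_\ell=\mathbb Z/\ell\mathbb Z$, $\mathbb Z_0:=\mathbb Z$, regarded as a $\mathbb ZS_n$-module with trivial $S_n$-action. Bimodules are unital. $\mathbb Z\langle X\rangle$ is the free associative ring without $1$ on $X=\{x_1,x_2,\dots\}$. $\operatorname{Id}(R,\mathbb Z)\subseteq\mathbb Z\langle X\rangle$ is the set of $f$ with $f(a_1,\dots,a_n)=0$ for all $a_i\in R$. $P_n(\mathbb Z)$ is the additive subgroup of $\mathbb Z\langle X\rangle$ generated by $x_{\sigma(1)}\cdots x_{\sigma(n)}$, $\sigma\in S_n$; $S_n$ acts by permuting the variables. Partitions are written in weakly decreasing order, and $\lambda_3=0$ means that the third row is absent. For a Young tableau $T_\lambda$ of shape $\lambda\vdash n$ with row stabilizer $R_{T_\lambda}$ and column stabilizer $C_{T_\lambda}$, let $a_{T_\lambda}=\sum_{\pi\in R_{T_\lambda}}\pi$, $b_{T_\lambda}=\sum_{\sigma\in C_{T_\lambda}}(\operatorname{sign}\sigma)\sigma$; the integral Specht module is $S(\lambda):=(\mathbb ZS_n)b_{T_\lambda}a_{T_\lambda}$, which up to isomorphism does not depend on $T_\lambda$. *)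

(* Defs.v *)
From HB Require Import structures.
From mathcomp Require Import all_boot all_order all_fingroup all_algebra.
From mathcomp Require Import generic_quotient boolp finmap monalg.

Set Implicit Arguments.
Unset Strict Implicit.
Unset Printing Implicit Defensive.

Import GRing.Theory.
Local Open Scope ring_scope.
Local Open Scope quotient_scope.

Definition min_or_zero (P : nat -> Prop) : nat :=
  match pselect (exists k, (0 < k)%N && `[< P k >]) with
  | left exP => ex_minn exP
  | right _ => 0
  end.

Section Submodules.
Variables (R : pzRingType) (V : lmodType R).

Definition submod_type (N : submodClosed V) := {x : V | x \in N}.

HB.instance Definition _ (N : submodClosed V) := SubChoice.on (submod_type N).
HB.instance Definition _ (N : submodClosed V) :=
  [SubChoice_isSubLmodule of submod_type N by <:].

(* [submodClosed] does not record closure under opposite, which the library's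
   quotient of a Z-module requires. *)
Definition submod_pred (N : submodClosed V) : {pred V} := N.

Lemma submod_pred_zmod (N : submodClosed V) : zmod_closed (submod_pred N).
Proof.
by split=> [|x y xN yN]; rewrite /submod_pred ?rpred0 // -scaleN1r rpredD ?rpredZ.
Qed.

HB.instance Definition _ (N : submodClosed V) :=
  GRing.isZmodClosed.Build V (submod_pred N) (submod_pred_zmod N).

Section Quotmod.
Variable N : submodClosed V.

Definition quotmod := Quotient.quot (submod_pred N).

HB.instance Definition _ := GRing.Zmodule.on quotmod.

Definition quot_scale (c : R) (x : quotmod) : quotmod :=
  \pi_(Quotient.quot (submod_pred N)) (c *: repr x).

Local Notation pi := (\pi_(Quotient.quot (submod_pred N))).

Lemma quotpiD x y : pi (x + y) = (pi x : quotmod) + pi y.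
Proof. exact: Quotient.pi_add. Qed.

Lemma quotpiZ c x : quot_scale c (pi x) = pi (c *: x).
Proof.
apply/eqP; rewrite /quot_scale -Quotient.idealrBE -scalerBr.
have : repr (pi x) - x \in submod_pred N by rewrite Quotient.idealrBE reprK.
exact: rpredZ.
Qed.

Lemma quotpi_surj (x : quotmod) : {v : V | x = pi v}.
Proof. by exists (repr x); rewrite reprK. Qed.

Lemma quot_scaleA a b (x : quotmod) :
  quot_scale a (quot_scale b x) = quot_scale (a * b) x.
Proof. by have [v ->] := quotpi_surj x; rewrite !quotpiZ scalerA. Qed.

Lemma quot_scale1 : left_id 1 quot_scale.
Proof. by move=> x; have [v ->] := quotpi_surj x; rewrite quotpiZ scale1r. Qed.

Lemma quot_scaleDr : right_distributive quot_scale +%R.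
Proof.
move=> c x y; have [[u ->] [v ->]] := (quotpi_surj x, quotpi_surj y).
by rewrite -quotpiD !quotpiZ scalerDr quotpiD.
Qed.

Lemma quot_scaleDl x : {morph quot_scale^~ x : a b / a + b}.
Proof.
move=> a b; have [v ->] := quotpi_surj x.
by rewrite !quotpiZ scalerDl quotpiD.
Qed.

HB.instance Definition _ := GRing.Zmodule_isLmodule.Build R quotmod
  quot_scaleA quot_scale1 quot_scaleDr quot_scaleDl.
End Quotmod.
End Submodules.

(* L / (L :&: N), which is L / N in the intended case N `<=` L. *)
Section Factor.
Variables (R : pzRingType) (V : lmodType R) (L N : submodClosed V).

Definition trace_pred : {pred submod_type L} := [pred x | val x \in N].

Lemma trace_pred_submod : submod_closed trace_pred.
Proof.
split=> [|c x y]; rewrite !inE /= ?rpred0 // => xN yN.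
by rewrite /= rpredD ?rpredZ.
Qed.

HB.instance Definition _ :=
  GRing.isSubmodClosed.Build R (submod_type L) trace_pred trace_pred_submod.

Definition factor : lmodType R := quotmod trace_pred.
End Factor.

Section Multiples.
Variables (R : pzRingType) (V : lmodType R) (k : nat).

Definition multiples_pred : {pred V} := [pred x | `[< exists y, x = y *+ k >]].

Lemma multiples_pred_submod : submod_closed multiples_pred.
Proof.
split; first by apply/asboolP; exists 0; rewrite mul0rn.
move=> c x y /asboolP[u ->] /asboolP[v ->].
by apply/asboolP; exists (c *: u + v); rewrite mulrnDl scalerMnr.
Qed.

HB.instance Definition _ :=
  GRing.isSubmodClosed.Build R V multiples_pred multiples_pred_submod.

Definition mod_multiples : lmodType R := quotmod multiples_pred.
End Multiples.

Definition isomorphic (R : pzRingType) (U V : lmodType R) :=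
  exists f : {linear U -> V}, bijective f.

Definition has_chain (R : pzRingType) (V : lmodType R) (fs : seq (lmodType R)) :=
  exists N : nat -> submodClosed V,
    [/\ N 0%N =i pred1 0,
        N (size fs) =i predT &
        forall i, (i < size fs)%N ->
          {subset N i <= N i.+1}
          /\ isomorphic (factor (N i.+1) (N i)) (nth V fs i)].

Section LeftIdeal.
Variables (R : pzRingType) (x : R).

Definition left_ideal_pred : {pred R^o} := [pred y | `[< exists c, y = c * x >]].

Lemma left_ideal_pred_submod : submod_closed left_ideal_pred.
Proof.
split; first by apply/asboolP; exists 0; rewrite mul0r.
move=> c y z /asboolP[u ->] /asboolP[v ->].
by apply/asboolP; exists (c * u + v); rewrite mulrDl -mulrA.
Qed.

HB.instance Definition _ :=
  GRing.isSubmodClosed.Build R R^o left_ideal_pred left_ideal_pred_submod.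

Definition left_ideal : lmodType R := submod_type left_ideal_pred.
End LeftIdeal.

(* The integral group ring of S_n, for the product (s t)(i) = s (t i) of
   permutations, which fingroup writes [t * s]; so that the algebraic product
   u^-1 s is [s * u^-1] below. *)
Definition ZS (n : nat) : Type := {ffun 'S_n -> int}.

Section GroupRing.
Variable n : nat.

HB.instance Definition _ := GRing.Zmodule.on (ZS n).

Definition zs_perm (s : 'S_n) : ZS n := [ffun t => (t == s)%:R].

Definition zs_one : ZS n := zs_perm 1%g.
Definition zs_mul (f g : ZS n) : ZS n :=
  [ffun s => \sum_u f u * g (s * u^-1)%g].

Lemma zs_mulA : associative zs_mul.
Proof.
move=> f g h; apply/ffunP=> s; rewrite !ffunE.
under eq_bigr do rewrite ffunE big_distrr /=.
under [RHS]eq_bigr do rewrite ffunE big_distrl /=.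
rewrite [RHS]exchange_big /=; apply: eq_bigr => u _.
rewrite [RHS](reindex_inj (mulIg u)) /=; apply: eq_bigr => v _.
by rewrite mulgK invMg mulgA mulrA.
Qed.

Lemma zs_mul1 : left_id zs_one zs_mul.
Proof.
move=> f; apply/ffunP=> s; rewrite ffunE (bigD1 1%g) //= big1 => [|u u1].
  by rewrite ffunE eqxx mul1r invg1 mulg1 addr0.
by rewrite ffunE (negbTE u1) mul0r.
Qed.

Lemma zs_mulr1 : right_id zs_one zs_mul.
Proof.
move=> f; apply/ffunP=> s; rewrite ffunE (bigD1 s) //= big1 => [|u us].
  by rewrite ffunE mulgV eqxx mulr1 addr0.
by rewrite ffunE -eq_mulgV1 eq_sym (negbTE us) mulr0.
Qed.

Lemma zs_mulDl : left_distributive zs_mul +%R.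
Proof.
move=> f g h; apply/ffunP=> s; rewrite !ffunE -big_split.
by apply: eq_bigr => u _; rewrite ffunE mulrDl.
Qed.

Lemma zs_mulDr : right_distributive zs_mul +%R.
Proof.
move=> f g h; apply/ffunP=> s; rewrite !ffunE -big_split.
by apply: eq_bigr => u _; rewrite ffunE mulrDr.
Qed.

HB.instance Definition _ := GRing.Zmodule_isPzRing.Build (ZS n)
  zs_mulA zs_mul1 zs_mulr1 zs_mulDl zs_mulDr.
End GroupRing.

Section PermModule.
Variables (n : nat) (V : zmodType) (act : 'S_n -> {additive V -> V}).
Hypothesis act1 : forall x, act 1%g x = x.
Hypothesis actM : forall s t x, act (t * s)%g x = act s (act t x).

Definition zs_scale (c : ZS n) (x : V) : V := \sum_s act s x *~ c s.

Lemma zs_scaleA a b x : zs_scale a (zs_scale b x) = zs_scale (a * b) x.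
Proof.
rewrite /zs_scale; under [RHS]eq_bigr do rewrite ffunE mulrz_sumr.
rewrite exchange_big; apply: eq_bigr => u _ /=.
rewrite [RHS](reindex_inj (mulIg u)) raddf_sum mulrz_suml /=.
by apply: eq_bigr => v _; rewrite mulgK raddfMz actM mulrC mulrzA.
Qed.

Lemma zs_scale1 : left_id 1 zs_scale.
Proof.
move=> x; rewrite /zs_scale (bigD1 1%g) //= big1 => [|s s1].
  by rewrite ffunE eqxx act1 addr0.
by rewrite ffunE (negbTE s1).
Qed.

Lemma zs_scaleDr : right_distributive zs_scale +%R.
Proof.
move=> c x y; rewrite /zs_scale -big_split.
by apply: eq_bigr => s _; rewrite raddfD /= mulrzDl.
Qed.

Lemma zs_scaleDl x : {morph zs_scale^~ x : a b / a + b}.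
Proof.
move=> a b; rewrite /zs_scale -big_split.
by apply: eq_bigr => s _; rewrite ffunE mulrzDr.
Qed.

End PermModule.

(* The parameter n only serves to select the structure of ZS_n-module. *)
Definition triv_int (n : nat) : Type := int.

Section TrivialModule.
Variable n : nat.
Local Notation Zn := (triv_int n).

HB.instance Definition _ := GRing.Zmodule.on Zn.

Definition triv_act (s : 'S_n) : {additive Zn -> Zn} := idfun.

Lemma triv_act1 x : triv_act 1%g x = x. Proof. by []. Qed.
Lemma triv_actM s t x : triv_act (t * s)%g x = triv_act s (triv_act t x).
Proof. by []. Qed.

HB.instance Definition _ := GRing.Zmodule_isLmodule.Build (ZS n) Zn
  (zs_scaleA triv_actM) (zs_scale1 triv_act1) (zs_scaleDr triv_act)
  (zs_scaleDl triv_act).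

(* For l = 0 this is Z / 0Z = Z. *)
Definition Zl (l : nat) : lmodType (ZS n) := mod_multiples Zn l.
End TrivialModule.

Section Specht.
Variable n : nat.

Record intpart := IntPart {
  parts :> seq nat;
  _ : [&& sorted geq parts, all (ltn 0) parts & sumn parts == n]
}.

HB.instance Definition _ := [isSub for parts].
HB.instance Definition _ := [Equality of intpart by <:].

(* lambda_(i+1), with 0 for an absent row. *)
Definition row_len (la : intpart) (i : nat) : nat := nth 0%N la i.

(* A tableau is the sequence of its rows; distinctness of the entries suffices
   since there are n of them in 'I_n. *)
Record tableau (la : intpart) := Tableau {
  rows :> seq (seq 'I_n);
  _ : shape rows = la;
  _ : uniq (flatten rows)
}.

Section OfTableau.
Variables (la : intpart) (T : tableau la).

Definition row_of (i : 'I_n) : nat := find (fun r => i \in r) T.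
Definition col_of (i : 'I_n) : nat := index i (nth [::] T (row_of i)).

Definition row_stab : {set 'S_n} :=
  [set s : 'S_n | [forall i, row_of (s i) == row_of i]].
Definition col_stab : {set 'S_n} :=
  [set s : 'S_n | [forall i, col_of (s i) == col_of i]].

Definition row_sym : ZS n := \sum_(s in row_stab) zs_perm s.
Definition col_sym : ZS n := \sum_(s in col_stab) zs_perm s *~ (-1) ^+ s.

Definition Specht : lmodType (ZS n) := left_ideal (col_sym * row_sym).
End OfTableau.
End Specht.

HB.mixin Record Lmodule_isBimodule (R1 R2 : pzRingType) M of GRing.Lmodule R1 M := {
  rscale : M -> R2 -> M;
  rscaleA : forall x b c, rscale (rscale x b) c = rscale x (b * c);
  rscale1 : forall x, rscale x 1 = x;
  rscaleDl : forall b, {morph rscale^~ b : x y / x + y};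
  rscaleDr : forall x, {morph rscale x : b c / b + c};
  rscaleZ : forall a x b, rscale (a *: x) b = a *: rscale x b
}.

#[short(type="bimodType")]
HB.structure Definition Bimodule (R1 R2 : pzRingType) :=
  {M of GRing.Lmodule R1 M & Lmodule_isBimodule R1 R2 M}.

Section Triangular.
Variables (R1 R2 : pzRingType) (M : bimodType R1 R2).

(* (a, x, b) stands for the matrix with rows (a, x) and (0, b). *)
Definition utri : Type := (R1 * M * R2)%type.

HB.instance Definition _ := GRing.Zmodule.on utri.

Definition utri_one : utri := (1, 0, 1).
Definition utri_mul (s t : utri) : utri :=
  let: (a, x, b) := s in let: (a', x', b') := t in
  (a * a', a *: x' + rscale x b', b * b').

Lemma rscale0l (b : R2) : rscale (0 : M) b = 0.
Proof. by apply: (addrI (rscale 0 b)); rewrite -rscaleDl !addr0. Qed.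

Lemma rscale0r (x : M) : rscale x (0 : R2) = 0.
Proof. by apply: (addrI (rscale x 0)); rewrite -rscaleDr !addr0. Qed.

Lemma utri_mulA : associative utri_mul.
Proof.
move=> [[a x] b] [[a' x'] b'] [[a'' x''] b'']; rewrite /utri_mul !mulrA.
by rewrite scalerDr scalerA rscaleDl rscaleA rscaleZ addrA.
Qed.

Lemma utri_mul1 : left_id utri_one utri_mul.
Proof. by move=> [[a x] b]; rewrite /utri_mul /= !mul1r scale1r rscale0l addr0. Qed.

Lemma utri_mulr1 : right_id utri_one utri_mul.
Proof. by move=> [[a x] b]; rewrite /utri_mul /= !mulr1 scaler0 rscale1 add0r. Qed.

Lemma utri_mulDl : left_distributive utri_mul +%R.
Proof.
move=> [[a x] b] [[a' x'] b'] [[a'' x''] b'']; rewrite /utri_mul.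
rewrite -![(_, _, _) + _]/(_, _, _) /= !mulrDl scalerDl rscaleDl.
by congr (_, _, _); rewrite addrACA.
Qed.

Lemma utri_mulDr : right_distributive utri_mul +%R.
Proof.
move=> [[a x] b] [[a' x'] b'] [[a'' x''] b'']; rewrite /utri_mul.
rewrite -![(_, _, _) + _]/(_, _, _) /= !mulrDr scalerDr rscaleDr.
by congr (_, _, _); rewrite addrACA.
Qed.

HB.instance Definition _ := GRing.Zmodule_isPzRing.Build utri
  utri_mulA utri_mul1 utri_mulr1 utri_mulDl utri_mulDr.
End Triangular.

(* Z<X> with a unit adjoined; [Zfree] below singles out Z<X> itself. The
   variables are numbered from 0. *)
Definition Zfree1 : Type := {malg int[{fmonom nat}]}.

HB.instance Definition _ := GRing.NzRing.on Zfree1.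

Definition Zvar (i : nat) : Zfree1 := << fmu i >>.

Definition Zfree : {pred Zfree1} := [pred f : Zfree1 | mcoeff mone f == 0].

Section Evaluation.
Variables (R : pzRingType) (a : nat -> R).

Definition Zeval (f : Zfree1) : R :=
  \sum_(w <- msupp f) (\prod_(i <- (w : seq nat)) a i) *~ mcoeff w f.

Lemma ZevalEw (d : {fset {fmonom nat}}) f : (msupp f `<=` d)%fset ->
  Zeval f = \sum_(w <- d) (\prod_(i <- (w : seq nat)) a i) *~ mcoeff w f.
Proof.
move=> le; rewrite [LHS](big_fset_incl _ le) //= => w _ /mcoeff_outdom ->.
by rewrite mulr0z.
Qed.

Lemma Zeval_is_zmod_morphism : zmod_morphism Zeval.
Proof.
move=> f g; pose d := (msupp f `|` msupp g)%fset.
rewrite (@ZevalEw d (f - g)) ?msuppB_le //.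
rewrite (@ZevalEw d f) ?fsubsetUl // (@ZevalEw d g) ?fsubsetUr //.
by rewrite -sumrB; apply: eq_bigr => w _; rewrite mcoeffB mulrzBr.
Qed.

HB.instance Definition _ :=
  GRing.isZmodMorphism.Build Zfree1 R Zeval Zeval_is_zmod_morphism.

Lemma Zvar_prodE (w : seq nat) : \prod_(i <- w) Zvar i = << FMonom w >>.
Proof.
elim: w => [|i w IHw]; first by rewrite big_nil -fmoneE.
rewrite big_cons IHw /Zvar [LHS]fgmulUU mulr1; congr << _ *g _ >>.
by rewrite fmuE [LHS]fmmulE.
Qed.

Lemma Zeval_monomial (w : seq nat) :
  Zeval (\prod_(i <- w) Zvar i) = \prod_(i <- w) a i.
Proof.
rewrite Zvar_prodE (@ZevalEw [fset FMonom w]%fset) ?msuppU_le //.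
by rewrite big_seq_fset1 mcoeffUU.
Qed.
End Evaluation.

Definition Id (R : pzRingType) : {pred Zfree1} :=
  [pred f | (f \in Zfree) && `[< forall a : nat -> R, Zeval a f = 0 >]].

Section Multilinear.
Variable n : nat.

Definition multilin_pred : {pred Zfree1} :=
  [pred f | `[< exists c : 'S_n -> int,
                  f = \sum_(s : 'S_n) (\prod_(i < n) Zvar (s i)) *~ c s >]].

Lemma multilin_zmod : zmod_closed multilin_pred.
Proof.
split; first by apply/asboolP; exists (fun=> 0); rewrite big1.
move=> f g /asboolP[c ->] /asboolP[d ->]; apply/asboolP.
exists (fun s => c s - d s); rewrite -sumrB.
by apply: eq_bigr => s _; rewrite mulrzBr.
Qed.

HB.instance Definition _ :=
  GRing.isZmodClosed.Build Zfree1 multilin_pred multilin_zmod.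

Definition multilin : Type := {f : Zfree1 | f \in multilin_pred}.

HB.instance Definition _ := SubChoice.on multilin.
HB.instance Definition _ := [SubChoice_isSubZmodule of multilin by <:].

Definition perm_var (s : 'S_n) (i : nat) : nat :=
  oapp (fun j : 'I_n => val (s j)) i (insub i).

(* s . f(x_0, x_1, ..) = f(x_(s 0), x_(s 1), ..) *)
Definition perm_poly (s : 'S_n) (f : Zfree1) : Zfree1 :=
  Zeval (fun i => Zvar (perm_var s i)) f.

Lemma perm_var_ord s (i : 'I_n) : perm_var s i = s i.
Proof. by rewrite /perm_var valK. Qed.

Lemma perm_varM s t i : perm_var (t * s)%g i = perm_var s (perm_var t i).
Proof.
rewrite {1 3}/perm_var; case: insubP => [j _ _|i_n] /=.
  by rewrite perm_var_ord permM.
by rewrite /perm_var insubN.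
Qed.

Lemma Zeval_perm_poly (R : pzRingType) (a : nat -> R) s f :
  Zeval a (perm_poly s f) = Zeval (fun i => a (perm_var s i)) f.
Proof.
rewrite /perm_poly {2}/Zeval raddf_sum /=; apply: eq_bigr => w _.
by rewrite raddfMz /= -(big_map (perm_var s) xpredT Zvar) Zeval_monomial big_map.
Qed.

Lemma perm_poly_monomial s (t : 'S_n) :
  perm_poly s (\prod_(i < n) Zvar (t i)) = \prod_(i < n) Zvar ((t * s)%g i).
Proof.
have -> : \prod_(i < n) Zvar (t i) =
    \prod_(j <- [seq val (t i) | i <- index_enum 'I_n]) Zvar j.
  by rewrite big_map.
rewrite /perm_poly Zeval_monomial big_map; apply: eq_bigr => i _.
by rewrite perm_var_ord permM.
Qed.

Lemma perm_poly_multilin s f :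
  f \in multilin_pred -> perm_poly s f \in multilin_pred.
Proof.
move=> /asboolP[c ->]; apply/asboolP; exists (fun t => c (t * s^-1)%g).
rewrite /perm_poly raddf_sum /= [RHS](reindex_inj (mulIg s)) /=.
apply: eq_bigr => t _; rewrite raddfMz /= mulgK.
by rewrite -perm_poly_monomial.
Qed.

Definition multilin_act (s : 'S_n) (f : multilin) : multilin :=
  exist _ (perm_poly s (val f)) (perm_poly_multilin s (valP f)).

Lemma multilin_act_is_zmod_morphism s : zmod_morphism (multilin_act s).
Proof. by move=> f g; apply: val_inj; rewrite /= /perm_poly raddfB. Qed.

HB.instance Definition _ s :=
  GRing.isZmodMorphism.Build multilin multilin (multilin_act s)
    (multilin_act_is_zmod_morphism s).

Lemma multilin_act1 f : multilin_act 1%g f = f.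
Proof.
case: f => f fP; apply: val_inj => /=; case/asboolP: fP => c ->.
rewrite /perm_poly raddf_sum /=; apply: eq_bigr => t _.
by rewrite raddfMz /= -/(perm_poly _ _) perm_poly_monomial mulg1.
Qed.

Lemma multilin_actM s t f :
  multilin_act (t * s)%g f = multilin_act s (multilin_act t f).
Proof.
apply: val_inj; rewrite /= [RHS]Zeval_perm_poly.
rewrite /perm_poly /Zeval; apply: eq_bigr => w _.
by under eq_bigr do rewrite perm_varM.
Qed.

HB.instance Definition _ := GRing.Zmodule_isLmodule.Build (ZS n) multilin
  (zs_scaleA multilin_actM) (zs_scale1 multilin_act1) (zs_scaleDr multilin_act)
  (zs_scaleDl multilin_act).

Variable R : pzRingType.

Definition multilin_Id : {pred multilin} := [pred f | val f \in Id R].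

Lemma multilin_Id_submod : submod_closed multilin_Id.
Proof.
have IdB f g : f \in Id R -> g \in Id R -> f - g \in Id R.
  move=> /andP[f1 /asboolP f0] /andP[g1 /asboolP g0]; apply/andP; split.
    by rewrite inE mcoeffB (eqP f1) (eqP g1) subrr.
  by apply/asboolP => a; rewrite raddfB /= f0 g0 subrr.
have Id0 : 0 \in Id R.
  apply/andP; split; first by rewrite inE mcoeff0.
  by apply/asboolP => a; rewrite raddf0.
have IdD f g : f \in Id R -> g \in Id R -> f + g \in Id R.
  by move=> fI gI; rewrite -[g]opprK IdB // -sub0r IdB.
have IdM f (k : nat) : f \in Id R -> f *+ k \in Id R.
  by move=> fI; elim: k => [|k IHk]; rewrite ?mulr0n // mulrS IdD.
have IdZ f k : f \in Id R -> f *~ k \in Id R.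
  move=> fI; case: k => k; first exact: IdM.
  by rewrite NegzE mulrNz -sub0r; apply: IdB => //; apply: IdM.
have Idperm s f : f \in Id R -> perm_poly s f \in Id R.
  move=> /andP[f1 /asboolP f0]; apply/andP; split; last first.
    by apply/asboolP => a; rewrite Zeval_perm_poly.
  rewrite inE raddf_sum big1 //= => w _; rewrite raddfMz /=.
  have [->|w1] := eqVneq w mone; first by rewrite (eqP f1) mulr0z.
  rewrite -(big_map (perm_var s) xpredT Zvar) Zvar_prodE mcoeffU.
  case: eqP => [/(congr1 (@fmonom_val _)) /= | _]; last by rewrite mulr0n mul0rz.
  rewrite fm1; case: w w1 => -[|i w] //.
  by rewrite -fmoneE eqxx.
split=> // c f g fI gI; rewrite inE /= IdD //.
rewrite -[_ \in _]/(val (\sum_s multilin_act s f *~ c s) \in Id R).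
rewrite raddf_sum; apply: (big_ind (fun h => h \in Id R)) => // s _.
by rewrite raddfMz IdZ //= Idperm.
Qed.

HB.instance Definition _ :=
  GRing.isSubmodClosed.Build (ZS n) multilin multilin_Id multilin_Id_submod.

Definition Pn_mod_Id : lmodType (ZS n) := quotmod multilin_Id.
End Multilinear.

Section Factors.
Variables (R1 R2 : comPzRingType) (M : bimodType R1 R2) (n : nat).

Definition ring_exponent : nat :=
  min_or_zero (fun k => (forall a : R1, a *+ k = 0) /\ (forall b : R2, b *+ k = 0)).

Definition bimod_exponent : nat :=
  min_or_zero (fun k => forall x : M, x *+ k = 0).

(* [None] labels the factor Z_l, and [Some la] the factors S(la) / m S(la). *)
Definition chain_factor (T : forall la : intpart n, tableau la)
    (lab : option (intpart n)) : lmodType (ZS n) :=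
  match lab with
  | None => Zl n ring_exponent
  | Some la => mod_multiples (Specht (T la)) bimod_exponent
  end.

Definition multiplicity (lab : option (intpart n)) : nat :=
  match lab with
  | None => 1
  | Some la =>
      if [&& 1 <= row_len la 1, row_len la 2 <= 1 & row_len la 3 == 0]%N
      then (row_len la 0 - row_len la 1 + 1)%N else 0%N
  end.
End Factors.

(* Main.v *)
From HB Require Import structures.
Require Import Defs.
From mathcomp Require Import all_boot all_algebra.
From mathcomp Require Import all_order all_fingroup generic_quotient boolp finmap monalg.
From mathcomp Require Import zify ring.

(** Let c be the coefficient function of a multilinear polynomial f. The diagonal
    entries of a value of f at triangular matrices only depend on the sum [aug c]
    of the coefficients. The corner entry is governed by the integers
    [starting c j A], the coefficient sums of the words in which x_j precedes the
    variables of A: f is an identity if and only if the exponent of the two rings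
    divides [aug c] and the exponent m of M divides all [starting c j A]
    ([multilin_IdP]). The map [aug] yields the factor Z_l at the top.
    The rest is the lattice of all c with [aug c = 0].

    On that lattice, the functions v = [starting c] are the cycles, i.e. the v with
    sum_(j in J) v j (J :\ j) = 0 for all J; every integral cycle arises
    ([starting_surj]). So, modulo the kernel of [starting], the elements of the
    lattice that are identities are its multiples of m ([Id_aug0_lattice]), and a
    chain of pure sublattices with Specht modules S as factors turns into a chain
    of submodules with factors S / mS ([chain_step]).

    The sublattices come from sl_3. Read v j A as the coefficient of the word with
    the letter 3 at j, the letter 1 on A and the letter 2 elsewhere, in a tensor
    power of Z^3 (up to a sign that depends on #|A|). Cycles are the vectors that
    the operator 3 -> 1 kills. They are filtered first by the number l of letters
    1; then by the number t.+1 <= n of letters 1 for which raising by 2 -> 1 first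
    kills the part with l letters 1; and then by the vanishing of the operator
    3 -> 2 on the part raised to t
    letters 1 ([level], [sublevel]). On each factor of this filtration, one gets an
    injective map into the words of weight (t, n - t - 1, 1), by raising to t
    letters 1, or into those of weight (t, n - t), by applying 3 -> 2 as well. The
    values are killed by 2 -> 1 and 3 -> 2. Such vectors are the integral
    combinations of products of determinants ([kernel_two_rows],
    [kernel_three_rows]), which are the polytabloids ([polytabloid2],
    [polytabloid3]), and all polytabloids are values when the second part of the
    weight is at most l ([chain_sublevel], [chain_level_succ]). Otherwise the
    factor is zero: the powers of 2 -> 1 in question are injective on words with
    too many letters 2 ([subset_sum_inj]), and 3 -> 2 on words without letters 2.

    So the shape (a, b) or (a, b, 1) occurs for t = a and all l with b <= l <= a,
    that is a - b + 1 times. *)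

Set Implicit Arguments.
Unset Strict Implicit.
Unset Printing Implicit Defensive.

Import Order.TTheory GRing.Theory Num.Theory.
Local Open Scope ring_scope.

(** * Sums over subsets of a given size *)

Section SubsetSums.
Variable I : finType.
Implicit Types (A B C D X Y : {set I}) (v : {set I} -> int) (x : I).

(** On functions of the set of positions of the letter 1 in a word in the letters
    1 and 2, this is a divided power of the operator that turns a letter 2 into a
    letter 1: the coefficient of a word in the image collects the words with l of
    its letters 1. *)
Definition subset_sum (l : nat) v B : int :=
  \sum_(A : {set I} | (A \subset B) && (#|A| == l)) v A.

Lemma eq_subset_sum l v v' B :
  (forall A, A \subset B -> #|A| = l -> v A = v' A) -> subset_sum l v B = subset_sum l v' B.
Proof. by move=> e; apply: eq_bigr => A /andP[AB /eqP]; apply: e. Qed.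

Lemma subset_sumD l v v' B : subset_sum l (fun A => v A + v' A) B = subset_sum l v B + subset_sum l v' B.
Proof. exact: big_split. Qed.

Lemma subset_sumZ l c v B : subset_sum l (fun A => c * v A) B = c * subset_sum l v B.
Proof. by rewrite /subset_sum big_distrr. Qed.

Lemma subset_sumB l v v' B : subset_sum l (fun A => v A - v' A) B = subset_sum l v B - subset_sum l v' B.
Proof. exact: sumrB. Qed.

Lemma subset_sum_sum (J : Type) (r : seq J) P l (F : J -> {set I} -> int) B :
  subset_sum l (fun A => \sum_(i <- r | P i) F i A) B = \sum_(i <- r | P i) subset_sum l (F i) B.
Proof. exact: exchange_big. Qed.

Lemma subset_sum_eq0 l v B :
  (forall A, A \subset B -> #|A| = l -> v A = 0) -> subset_sum l v B = 0.
Proof. by move=> v0; apply: big1 => A /andP[AB /eqP]; apply: v0. Qed.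

Lemma subset_sum_card l v B : #|B| = l -> subset_sum l v B = v B.
Proof.
move=> Bl; rewrite /subset_sum (big_pred1 B) // => A /=.
by apply/andP/eqP => [[AB /eqP Al]|->]; [apply/eqP; rewrite eqEcard AB Bl Al /= | rewrite Bl].
Qed.

Lemma incl0 v B : subset_sum 0 v B = v set0.
Proof.
rewrite /subset_sum (big_pred1 set0) // => A /=; rewrite cards_eq0.
by apply/andP/eqP => [[_ /eqP]|->] //; rewrite sub0set eqxx.
Qed.

Lemma sum_subsetU1 v x B (P : pred {set I}) : x \notin B ->
  \sum_(A : {set I} | (A \subset x |: B) && P A) v A =
    \sum_(A : {set I} | (A \subset B) && P A) v A
    + \sum_(A : {set I} | (A \subset B) && P (x |: A)) v (x |: A).
Proof.
move=> xB; rewrite (bigID (fun A => x \in A)) /= addrC; congr (_ + _).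
  apply: eq_bigl => A; rewrite andbAC -subsetD1; congr (_ && _).
  by rewrite setU1K.
rewrite (reindex_onto (fun A => x |: A) (fun A => A :\ x)) /=; last first.
  by move=> A /andP[_ xA]; rewrite setD1K.
apply: eq_bigl => A; rewrite setU11 andbT.
case: (boolP (x \in A)) => xA.
  rewrite (_ : A \subset B = false) /=; last by apply: contraNF xB => /subsetP ->.
  by rewrite (setUidPr _) ?sub1set // andbC; case: eqP => //= e; rewrite -e !inE eqxx in xA.
rewrite setU1K // eqxx andbT; congr (_ && _).
by rewrite subUset sub1set setU11 /= -[LHS]andbT -xA -subsetD1 setU1K.
Qed.

Lemma subset_sum_setU1 l v x B : x \notin B ->
  subset_sum l.+1 v (x |: B) = subset_sum l.+1 v B + subset_sum l (fun A => v (x |: A)) B.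
Proof.
move=> xB; rewrite /subset_sum sum_subsetU1 //; congr (_ + _); apply: eq_bigl => A.
case: (boolP (A \subset B)) => //= AB; rewrite cardsU1.
by rewrite (contra (subsetP AB x) xB) add1n eqSS.
Qed.

(** Every subset of B of size l lies below equally many subsets of B of size t. *)
Lemma subset_sum_subset_sum l t v B : (l <= t)%N ->
  subset_sum t (subset_sum l v) B = subset_sum l v B *+ 'C(#|B| - l, t - l).
Proof.
move=> lt; rewrite /subset_sum (exchange_big_dep (fun A : {set I} => (A \subset B) && (#|A| == l))) /=; last first.
  by move=> C A /andP[CB _] /andP[sAC ->]; rewrite (subset_trans sAC CB).
rewrite -sumrMnl; apply: eq_bigr => A /andP[AB /eqP Al].
rewrite sumr_const; congr (_ *+ _).
rewrite -Al -(cardsDS AB) -cards_draws.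
pose E := [set C : {set I} | C \subset B :\: A & #|C| == (t - #|A|)%N].
have inj : {in E &, injective (fun C => C :|: A)}.
  move=> C C'; rewrite !inE => /andP[CBA _] /andP[CBA' _] e.
  have K (X : {set I}) : X \subset B :\: A -> (X :|: A) :\: A = X.
    by rewrite subsetD setDUl setDv setU0 => /andP[_ /setDidPl].
  by rewrite -(K C CBA) -(K C' CBA') e.
rewrite -/E -(card_in_imset inj).
apply: eq_card => C; apply/idP/imsetP.
  move=> /andP[/andP[CB /eqP Ct] /andP[sAC _]]; exists (C :\: A).
    by rewrite inE setSD //= cardsDS // Ct.
  by rewrite setUC -{1}(setIidPr sAC) setID.
case=> X; rewrite !inE => /andP[XBA /eqP Xt] ->.
move: XBA; rewrite subsetD => /andP[XB dXA].
rewrite unfold_in /= subUset XB AB subsetUr cardsU (disjoint_setI0 dXA) cards0 Xt.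
by rewrite subn0 subnK ?Al ?eqxx.
Qed.

Lemma subset_of_card D t : (t <= #|D|)%N -> exists2 B : {set I}, B \subset D & #|B| = t.
Proof.
rewrite -bin_gt0 -cards_draws card_gt0 => /set0Pn[B].
by rewrite inE => /andP[BD /eqP]; exists B.
Qed.

(** Inclusion matrices between l-sets and t-sets have full rank. The proof splits
    v into its restriction to the sets without a point x and the function u on the
    sets with x. When D is too small for the induction hypothesis on the former,
    averaging over the t-subsets without x eliminates it and shows that u vanishes
    first. *)
Lemma subset_sum_inj l t D v : (l <= t)%N -> (t + l <= #|D|)%N ->
    (forall B, B \subset D -> #|B| = t -> subset_sum l v B = 0) ->
  forall A, A \subset D -> #|A| = l -> v A = 0.
Proof.
elim: {D}_.+1 {-2}D (ltnSn #|D|) l t v => // d IHd D Dd l t v lt tlD v0 A AD Al.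
have [lt_eq|lt_neq] := eqVneq l t; first by rewrite -(subset_sum_card v Al) v0 ?Al.
case: l lt tlD v0 Al lt_neq => [_ tlD v0 Al _|l lt tlD v0 Al lt_neq].
  have [B BD Bt] := @subset_of_card D t ltac:(lia).
  by rewrite -[RHS](v0 B BD Bt) incl0 (cards0_eq Al).
have [x xD] : exists x, x \in D by apply/set0Pn; rewrite -card_gt0; lia.
have cD : #|D :\ x| = #|D|.-1 by rewrite (cardsD1 x D) xD.
have cDgt : (0 < #|D|)%N by rewrite card_gt0; apply/set0Pn; exists x.
have subD B : B \subset D :\ x -> [/\ B \subset D, x |: B \subset D & x \notin B].
  rewrite subsetD1 => /andP[BD xB]; split=> //.
  by rewrite subUset sub1set xD.
pose u B := v (x |: B).
have e1 B : B \subset D :\ x -> #|B| = t -> subset_sum l.+1 v B = 0.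
  by case/subD => BD _ _; apply: v0.
have e2 B : B \subset D :\ x -> #|B|.+1 = t -> subset_sum l.+1 v B + subset_sum l u B = 0.
  by case/subD => BD xBD xB Bt; rewrite -subset_sum_setU1 // v0 // cardsU1 xB add1n.
have w0 B : B \subset D :\ x -> #|B| = l.+1 -> v B = 0.
  have [le|gt] := leqP (t + l.+1) #|D :\ x|.
    by apply: IHd lt le e1 B; lia.
  (* Here [t + l.+1 = #|D|]. *)
  have u0 C : C \subset D :\ x -> #|C| = l -> u C = 0.
    apply: (IHd _ _ l t); [lia|lia|lia|] => X XD Xt.
    have : subset_sum t.-1 (fun B => subset_sum l.+1 v B + subset_sum l u B) X = 0.
      apply: subset_sum_eq0 => Y YX Yt; apply: e2; last lia.
      exact: subset_trans YX XD.
    rewrite subset_sumD !subset_sum_subset_sum; [|lia|lia].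
    rewrite e1 // mul0rn add0r => /eqP; rewrite mulrn_eq0 -leqn0 leqNgt bin_gt0.
    by case: leqP => /=; [lia|]; lia.
  apply: (IHd _ _ l.+1 t.-1); [lia|lia|lia|] => X XD Xt.
  rewrite -[LHS]addr0 -[RHS](e2 X XD); last lia.
  congr (_ + _); apply/esym/subset_sum_eq0 => C CX; apply: u0; exact: subset_trans CX XD.
have [xA|xA] := boolP (x \in A); last by apply: w0; rewrite ?subsetD1 ?AD.
rewrite -(setD1K xA) -/(u _); apply: (IHd (D :\ x) _ l t.-1); [lia|lia|lia| |exact: setSD|].
  move=> B BD Bt; rewrite -[RHS](e2 B BD) -1?[LHS]add0r; last lia.
  congr (_ + _); apply/esym/subset_sum_eq0 => C CB; apply: w0; exact: subset_trans CB BD.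
by move: Al; rewrite (cardsD1 x) xA => -[].
Qed.
End SubsetSums.

(** * Products of minors as functions on words *)

Section Brackets.
Variable I : finType.
Implicit Types (A B C D X Y : {set I}) (g : {set I} -> int) (x : I).
Implicit Types (ps : seq (I * I)) (os : seq I).

(** Words with distinct positions in the letters 1 and 2 are recorded by the set A
    of positions of the letter 1. A pair (p, q) stands for the minor
    1_p 2_q - 2_p 1_q, whose coefficient is [p \in A] - [q \in A] in either case. *)
Definition minors ps A : int := \prod_(e <- ps) ((e.1 \in A)%:R - (e.2 \in A)%:R).
Definition entries ps := unzip1 ps ++ unzip2 ps.

(** The coefficient at A of a bideterminant: the product of the minors of ps, with
    the letter 1 on os1 and the letter 2 on os2. *)
Definition bidet ps os1 os2 A : int :=
  minors ps A * (all (mem A) os1)%:R * (~~ has (mem A) os2)%:R.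

Lemma minors_cons e ps A :
  minors (e :: ps) A = ((e.1 \in A)%:R - (e.2 \in A)%:R) * minors ps A.
Proof. exact: big_cons. Qed.

Lemma perm_entries_cons p q ps os :
  perm_eq (entries ((p, q) :: ps) ++ os) (p :: q :: entries ps ++ os).
Proof. by apply/seq.permP => a; rewrite /entries /= !count_cat /= ?count_cat; lia. Qed.

Lemma eq_minors ps A B : {in entries ps, A =i B} -> minors ps A = minors ps B.
Proof.
move=> e; apply: eq_big_seq => -[p q] pqs /=.
by rewrite !e // mem_cat (map_f fst pqs, map_f snd pqs) ?orbT.
Qed.

Lemma eq_bidet ps os1 os2 A B :
  {in entries ps ++ os1 ++ os2, A =i B} -> bidet ps os1 os2 A = bidet ps os1 os2 B.
Proof.
move=> e; rewrite /bidet (@eq_minors _ A B); last first.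
  by move=> x xs; apply: e; rewrite mem_cat xs.
rewrite (@eq_in_all _ (mem A) (mem B)) ?(@eq_in_has _ (mem A) (mem B)) //;
  by move=> x xs; apply: e; rewrite !mem_cat xs ?orbT.
Qed.

Lemma in_setU1_neq x A y : y != x -> (y \in x |: A) = (y \in A).
Proof. by rewrite !inE => /negbTE ->. Qed.

Lemma in_setD1_neq x A y : y != x -> (y \in A :\ x) = (y \in A).
Proof. by rewrite !inE => ->. Qed.

Lemma bidetU1 ps os1 os2 x A : x \notin entries ps ++ os1 ++ os2 ->
  bidet ps os1 os2 (x |: A) = bidet ps os1 os2 A.
Proof.
by move=> xs; apply: eq_bidet => y ys; rewrite in_setU1_neq //; apply: contraNneq xs => <-.
Qed.

Lemma bidetD1 ps os1 os2 x A : x \notin entries ps ++ os1 ++ os2 ->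
  bidet ps os1 os2 (A :\ x) = bidet ps os1 os2 A.
Proof.
by move=> xs; apply: eq_bidet => y ys; rewrite in_setD1_neq //; apply: contraNneq xs => <-.
Qed.

(** A minor does not vanish at A only if A contains exactly one of its positions. *)
Lemma card_minors ps os D A : perm_eq (entries ps ++ os) (enum D) -> A \subset D ->
  minors ps A != 0 -> #|A| = (size ps + count (mem A) os)%N.
Proof.
move=> /seq.permP/(_ (mem A)) e AD nz.
have -> : #|A| = count (mem A) (enum D).
  rewrite -[RHS]size_filter cardE; apply/perm_size/uniq_perm; first exact: enum_uniq.
    exact/filter_uniq/enum_uniq.
  move=> x; rewrite mem_enum mem_filter mem_enum /=.
  by case: (boolP (x \in A)) => // /(subsetP AD).
rewrite -e count_cat; congr (_ + _)%N; rewrite /entries count_cat !count_map.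
elim: ps nz {e} => //= -[p q] ps IHps; rewrite minors_cons mulf_eq0 negb_or /= => /andP[nz /IHps <-].
by move: nz; case: (p \in A); case: (q \in A); rewrite ?subrr //=; lia.
Qed.

Lemma sum_subset_mem g x B : (forall A, g (x |: A) = g A) ->
  \sum_(A : {set I} | A \subset B) (x \in A)%:R * g A
    = (x \in B)%:R * \sum_(A : {set I} | A \subset B :\ x) g A.
Proof.
move=> gx; have [xB|xB] := boolP (x \in B); last first.
  rewrite mul0r big1 // => A AB; case: (boolP (x \in A)) => [/(subsetP AB)|]; last by rewrite mul0r.
  by rewrite (negbTE xB).
rewrite mul1r -{1}(setD1K xB).
have := @sum_subsetU1 _ (fun A => (x \in A)%:R * g A) x (B :\ x) xpredT.
rewrite !(eq_bigl _ _ (fun A => andbT _)) => ->; last by rewrite !inE eqxx.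
rewrite big1 ?add0r => [|A]; last first.
  by rewrite subsetD1 => /andP[_ /negbTE ->]; rewrite mul0r.
by apply: eq_bigr => A _; rewrite setU11 mul1r gx.
Qed.

Lemma sum_subset_double g x B : (forall A, g (x |: A) = g A) -> x \in B ->
  \sum_(A : {set I} | A \subset B) g A = (\sum_(A : {set I} | A \subset B :\ x) g A) *+ 2.
Proof.
move=> gx xB; rewrite -{1}(setD1K xB).
have := @sum_subsetU1 _ g x (B :\ x) xpredT.
rewrite !(eq_bigl _ _ (fun A => andbT _)) => ->; last by rewrite !inE eqxx.
by rewrite mulr2n; congr (_ + _); apply: eq_bigr => A _; rewrite gx.
Qed.

(** Turning letters 2 into letters 1 in all possible ways acts on each factor: it
    preserves the minors and the letters 1, and frees the positions in os2. *)
Lemma sum_bidet ps os1 os2 B : uniq (entries ps ++ os1 ++ os2) ->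
    {subset B <= entries ps ++ os1 ++ os2} ->
  \sum_(A : {set I} | A \subset B) bidet ps os1 os2 A
    = minors ps B * (all (mem B) os1)%:R.
Proof.
elim: ps B => [|[p q] ps IHps] B.
  rewrite /= /minors big_nil mul1r; elim: os1 B => [|x os1 IHos] B.
    rewrite /=; elim: os2 B => [|x os2 IHos] B /=.
      move=> _ B0; rewrite (big_pred1 set0) ?/bidet /minors ?big_nil ?mulr1 // => A.
      have -> : B = set0 by apply/setP => x; rewrite inE; apply/negP => /B0.
      by rewrite subset0.
    move=> /andP[xs us] sB; rewrite -[RHS](IHos (B :\ x)) //; last first.
      move=> y; rewrite !inE => /andP[yx /sB]; rewrite inE (negbTE yx); exact.
    transitivity (\sum_(A : {set I} | A \subset B)
        (bidet [::] [::] os2 A - (x \in A)%:R * bidet [::] [::] os2 A)).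
      apply: eq_bigr => A _; rewrite /bidet /minors !big_nil !mul1r /=.
      by case: (x \in A); rewrite /= ?mul1r ?subrr ?mul0r ?subr0.
    rewrite sumrB sum_subset_mem => [|A]; last exact: bidetU1.
    have [xB|xB] := boolP (x \in B); last first.
      by rewrite mul0r subr0; have /setDidPl -> : [disjoint B & [set x]] by rewrite disjoint_sym disjoints1.
    rewrite (@sum_subset_double _ x B) // => [|A]; last exact: bidetU1.
    by rewrite mulr2n mul1r addrK.
  rewrite /= => /andP[xs us] sB.
  transitivity (\sum_(A : {set I} | A \subset B) (x \in A)%:R * bidet [::] os1 os2 A).
    by apply: eq_bigr => A _; rewrite /bidet /= -mulnb natrM; ring.
  rewrite sum_subset_mem => [|A]; last exact: bidetU1.
  rewrite IHos //; last first.
    by move=> y; rewrite !inE => /andP[yx /sB]; rewrite inE (negbTE yx).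
  rewrite -natrM mulnb; congr ((_ && _)%:R); apply: eq_in_all => y ys /=.
  rewrite in_setD1_neq //; apply: contraNneq xs => <-; by rewrite mem_cat ys.
have e := perm_entries_cons p q ps (os1 ++ os2); rewrite (perm_uniq e) /= inE negb_or.
move=> /andP[/andP[pq ps'] /andP[qs us]] sB.
have {}sB y : y \in B -> [|| y == p, y == q | y \in entries ps ++ os1 ++ os2].
  by move/sB; rewrite (perm_mem e) !inE.
transitivity (\sum_(A : {set I} | A \subset B)
   ((p \in A)%:R * bidet ps os1 os2 A - (q \in A)%:R * bidet ps os1 os2 A)).
  by apply: eq_bigr => A _; rewrite /bidet minors_cons /=; ring.
rewrite sumrB !sum_subset_mem; try by move=> A; apply: bidetU1.
rewrite minors_cons /=; have [pB|pB] := boolP (p \in B); have [qB|qB] := boolP (q \in B).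
- rewrite (@sum_subset_double _ q (B :\ p)) ?inE 1?eq_sym ?pq //; last by move=> A; apply: bidetU1.
  rewrite (@sum_subset_double _ p (B :\ q)) ?inE ?pq //; last by move=> A; apply: bidetU1.
  by rewrite !setDDl setUC subrr !mul0r.
- rewrite /= !mulr1n !mulr0n mul0r !subr0 !mul1r IHps // => [|y]; last first.
    rewrite !inE => /andP[yp /[dup] yB /sB]; rewrite (negbTE yp) /=.
    by case: eqP => // yq; rewrite -yq yB in qB.
  congr (_ * (nat_of_bool _)%:R); first apply: eq_minors => y ys; last apply: eq_in_all => y ys /=.
    rewrite in_setD1_neq //; apply: contraNneq ps' => <-; by rewrite mem_cat ys.
  rewrite in_setD1_neq //; apply: contraNneq ps' => <-; by rewrite !mem_cat ys orbT.
- rewrite /= !mulr1n !mulr0n mul0r !sub0r !mul1r mulN1r mulNr IHps // => [|y]; last first.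
    rewrite !inE => /andP[yp /[dup] yB /sB]; rewrite (negbTE yp) /=.
    by case: eqP => // yq; rewrite -yq yB in pB.
  congr (- (_ * (nat_of_bool _)%:R)); first apply: eq_minors => y ys; last apply: eq_in_all => y ys /=.
    rewrite in_setD1_neq //; apply: contraNneq qs => <-; by rewrite mem_cat ys.
  rewrite in_setD1_neq //; apply: contraNneq qs => <-; by rewrite !mem_cat ys orbT.
- by rewrite subrr !mul0r subrr.
Qed.

Lemma card_bidet ps os1 os2 D A : perm_eq (entries ps ++ os1 ++ os2) (enum D) ->
  A \subset D -> bidet ps os1 os2 A != 0 -> #|A| = (size ps + size os1)%N.
Proof.
move=> e AD; rewrite /bidet !mulf_eq0 !negb_or !pnatr_eq0 !eqb0 !negbK.
rewrite all_count has_count -leqNgt leqn0 => /andP[/andP[nz /eqP a1] /eqP a2].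
by rewrite (card_minors e AD nz) count_cat a1 a2 addn0.
Qed.

Lemma subset_sum_bidet ps os1 os2 D B l : perm_eq (entries ps ++ os1 ++ os2) (enum D) ->
    B \subset D -> l = (size ps + size os1)%N ->
  subset_sum l (bidet ps os1 os2) B = minors ps B * (all (mem B) os1)%:R.
Proof.
move=> e BD ->; rewrite -(@sum_bidet ps os1 os2); last 2 first.
- by rewrite (perm_uniq e) enum_uniq.
- by move=> x /(subsetP BD); rewrite (perm_mem e) mem_enum.
rewrite [RHS](bigID (fun A : {set I} => #|A| == (size ps + size os1)%N)) /=.
rewrite [X in _ = _ + X]big1 ?addr0 // => A /andP[AB]; apply: contraNeq => nz.
by rewrite (card_bidet e (subset_trans AB BD) nz).
Qed.

Lemma subset_sum_bidet_gt ps os1 os2 D B l : perm_eq (entries ps ++ os1 ++ os2) (enum D) ->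
    B \subset D -> l = (size ps + size os1)%N ->
    (size ps + size os1 + size os2 < #|B|)%N ->
  subset_sum l (bidet ps os1 os2) B = 0.
Proof.
move=> e BD lE gt; rewrite (subset_sum_bidet e BD lE).
have [->|nz] := eqVneq (minors ps B) 0; first by rewrite mul0r.
move: gt; rewrite (card_minors e BD nz) -addnA -size_cat ltn_add2l ltnNge.
by rewrite count_size.
Qed.

Lemma subset_sum_bidet_eq ps os1 os2 D B l : perm_eq (entries ps ++ os1 ++ os2) (enum D) ->
    B \subset D -> l = (size ps + size os1)%N ->
    #|B| = (size ps + size os1 + size os2)%N ->
  subset_sum l (bidet ps os1 os2) B = minors ps B * (all (mem B) (os1 ++ os2))%:R.
Proof.
move=> e BD lE Bt; rewrite (subset_sum_bidet e BD lE).
have [->|nz] := eqVneq (minors ps B) 0; first by rewrite !mul0r.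
move/eqP: Bt; rewrite (card_minors e BD nz) -addnA -size_cat eqn_add2l => /eqP/esym/eqP.
rewrite eq_sym -all_count => a; rewrite a.
by move: a; rewrite all_cat => /andP[->].
Qed.
End Brackets.

(** * Kernels of the raising operators *)

Section Kernels.
Variable I : finType.
Implicit Types (A B C D X Y : {set I}) (x p q r j : I).
Implicit Types (ps : seq (I * I)) (os : seq I).

Lemma perm_enumD1 D x s : x \in D -> perm_eq s (enum (D :\ x)) ->
  perm_eq (x :: s) (enum D).
Proof.
move=> xD e; rewrite (perm_trans (y := x :: enum (D :\ x))) ?perm_cons //.
apply: uniq_perm; rewrite ?enum_uniq //= ?mem_enum ?inE ?eqxx ?enum_uniq // => y.
by rewrite inE !mem_enum !inE; case: eqP => // ->.
Qed.

Lemma bidet_cons1 ps x os1 os2 A :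
  bidet ps (x :: os1) os2 A = (x \in A)%:R * bidet ps os1 os2 A.
Proof. by rewrite /bidet /= -mulnb natrM; ring. Qed.

Lemma bidet_cons p q ps os1 os2 A :
  bidet ((p, q) :: ps) os1 os2 A
    = ((p \in A)%:R - (q \in A)%:R) * bidet ps os1 os2 A.
Proof. by rewrite /bidet minors_cons !mulrA. Qed.

(** A tableau with two rows by its columns: those of length two as pairs, the
    others as single entries. *)
Definition filling2 : Type := seq (I * I) * seq I.

Definition fills2 D k (d : filling2) : bool :=
  (size d.1 == k) && perm_eq (entries d.1 ++ d.2) (enum D).

Definition bidet_comb2 (s : seq (int * filling2)) A : int :=
  \sum_(e <- s) e.1 * bidet e.2.1 e.2.2 [::] A.

Lemma fills2_size D k d : fills2 D k d -> (#|D| = k.*2 + size d.2)%N.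
Proof.
move=> /andP[/eqP <- /perm_size].
by rewrite /entries !size_cat !size_map -cardE => <-; rewrite addnn.
Qed.

Lemma fills2_spare D k x ps o os : x \in D -> fills2 (D :\ x) k (ps, o :: os) ->
  fills2 D k.+1 ((o, x) :: ps, os).
Proof.
move=> xD /andP[/= /eqP <- e]; rewrite /fills2 /= eqxx /=.
rewrite (perm_trans _ (perm_enumD1 xD e)) // (perm_trans (perm_entries_cons _ _ _ _)) //.
by apply/seq.permP => a; rewrite /= !count_cat /=; lia.
Qed.

Lemma fills2_head D k x ps os : x \in D -> fills2 (D :\ x) k (ps, os) ->
  fills2 D k (ps, x :: os).
Proof.
move=> xD /andP[/= ? e]; apply/andP; split=> //=.
rewrite (perm_trans _ (perm_enumD1 xD e)) //.
by apply/seq.permP => a; rewrite /= !count_cat /=; lia.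
Qed.

Lemma fills2_notin D k x ps os : fills2 (D :\ x) k (ps, os) -> x \notin entries ps ++ os.
Proof. by move=> /andP[_ /= e]; rewrite (perm_mem e) mem_enum !inE eqxx. Qed.

Lemma subset_sum_bidet_comb2 s D k l B : all (fun e => fills2 D k e.2) s ->
  (#|D| = l + k)%N -> B \subset D -> #|B| = l.+1 -> subset_sum l (bidet_comb2 s) B = 0.
Proof.
move=> /allP sv Dlk BD Bl; rewrite subset_sum_sum big_seq big1 // => -[c d] /sv /= dv.
rewrite subset_sumZ; have := fills2_size dv; case/andP: dv => /eqP dk e Ds.
by rewrite (@subset_sum_bidet_gt _ _ _ _ D) ?cats0 ?mulr0 //=; lia.
Qed.

(** Vectors killed by the operator 2 -> 1 are combinations of bideterminants, by
    induction on D. For x in D, the part of v with the letter 2 at x is killed on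
    D :\ x, hence a combination of bideterminants with at least one isolated letter
    1 each; pairing such a letter with x extends these terms to bideterminants on D
    with the same part. The rest has the letter 1 at x in all its words. *)
Lemma kernel_two_rows D l k (v : {set I} -> int) : (#|D| = l + k)%N ->
    (forall B, B \subset D -> #|B| = l.+1 -> subset_sum l v B = 0) ->
  exists2 s, all (fun e => fills2 D k e.2) s &
    forall A, A \subset D -> #|A| = l -> v A = bidet_comb2 s A.
Proof.
elim: {D}_.+1 {-2}D (ltnSn #|D|) l k v => // d IHd D Dd l k v Dlk v0.
have [lk|kl] := ltnP l k.
  exists [::] => // A AD Al; rewrite /bidet_comb2 big_nil.
  by apply: (subset_sum_inj (t := l.+1) _ _ v0); lia.
case: k Dlk kl => [|k] Dlk kl.
  exists [:: (v D, ([::], enum D))] => [|A AD Al]; first by rewrite /= /fills2 /= perm_refl.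
  have -> : A = D by apply/eqP; rewrite eqEcard AD; lia.
  rewrite /bidet_comb2 big_seq1 /= /bidet /minors big_nil mul1r (_ : all _ _) ?mulr1 //.
  by apply/allP => x; rewrite mem_enum.
have [x xD] : exists x, x \in D by apply/set0Pn; rewrite -card_gt0; lia.
have cD : #|D| = #|D :\ x|.+1 by rewrite (cardsD1 x D) xD.
have [s1 s1v s1E] : exists2 s, all (fun e => fills2 (D :\ x) k e.2) s &
    forall A, A \subset D :\ x -> #|A| = l -> v A = bidet_comb2 s A.
  apply: IHd; [lia|lia|] => B; rewrite subsetD1 => /andP[BD _]; exact: v0.
(* A size count excludes fillings without an isolated entry. *)
pose lift (e : int * filling2) : int * filling2 :=
  if e.2.2 is o :: os then (e.1, ((o, x) :: e.2.1, os)) else e.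
pose t1 := map lift s1.
have t1v : all (fun e => fills2 D k.+1 e.2) t1.
  rewrite all_map; apply/allP => -[c [ps os]] /(allP s1v) /= ev.
  have /= := fills2_size ev; rewrite /lift; case: os ev => [|o os] ev /= sz; first lia.
  exact: fills2_spare ev.
have t1E A : x \notin A -> bidet_comb2 t1 A = bidet_comb2 s1 A.
  move=> xA; rewrite /bidet_comb2 big_map big_seq [RHS]big_seq.
  apply: eq_bigr => -[c [ps os]] /(allP s1v) /= ev.
  rewrite /lift; case: os ev => //= o os _.
  by rewrite bidet_cons bidet_cons1 (negbTE xA) subr0.
pose v' A := v A - bidet_comb2 t1 A.
have v'0 B : B \subset D -> #|B| = l.+1 -> subset_sum l v' B = 0.
  move=> BD Bl; rewrite subset_sumB v0 // (subset_sum_bidet_comb2 t1v) ?subr0 //; lia.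
have v'x A : A \subset D :\ x -> #|A| = l -> v' A = 0.
  by move=> AD Al; rewrite /v' t1E ?s1E ?subrr //; move: AD; rewrite subsetD1 => /andP[].
case: l Dlk kl v0 s1E v'0 v'x => // l Dlk kl v0 s1E v'0 v'x.
have [s2 s2v s2E] : exists2 s, all (fun e => fills2 (D :\ x) k.+1 e.2) s &
    forall A, A \subset D :\ x -> #|A| = l -> v' (x |: A) = bidet_comb2 s A.
  apply: (IHd _ _ l k.+1 (fun A => v' (x |: A))); [lia|lia|] => B BD Bl.
  have /andP[BD' xB] : (B \subset D) && (x \notin B) by rewrite -subsetD1.
  have := v'0 (x |: B); rewrite subset_sum_setU1 // subset_sum_card // v'x // add0r => -> //.
    by rewrite subUset sub1set xD.
  by rewrite cardsU1 xB add1n Bl.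
pose head (e : int * filling2) : int * filling2 := (e.1, (e.2.1, x :: e.2.2)).
exists (t1 ++ map head s2).
  rewrite all_cat t1v all_map; apply/allP => -[c [ps os]] /(allP s2v) /= ev.
  exact: fills2_head ev.
move=> A AD Al; rewrite /bidet_comb2 big_cat -/(bidet_comb2 t1 A) big_map /=.
apply/eqP; rewrite addrC -subr_eq; apply/eqP; rewrite -/(v' A).
have [xA|xA] := boolP (x \in A); last first.
  rewrite v'x // ?subsetD1 ?AD // big1 // => e _.
  by rewrite bidet_cons1 (negbTE xA) mul0r mulr0.
rewrite -{1}(setD1K xA) s2E ?setSD //; last by move: Al; rewrite (cardsD1 x) xA => -[].
rewrite /bidet_comb2 big_seq [RHS]big_seq; apply: eq_bigr => -[c [ps os]] /(allP s2v) /= ev.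
by rewrite bidet_cons1 xA mul1r bidetD1 // cats0; apply: fills2_notin ev.
Qed.

(** The 3 x 3 minor on the positions p, q, r, expanded along the row of the
    letter 3, which sits at j. *)
Definition minor3 p q r j A : int :=
  (j == r)%:R * ((p \in A)%:R - (q \in A)%:R)
  + (j == p)%:R * ((q \in A)%:R - (r \in A)%:R)
  + (j == q)%:R * ((r \in A)%:R - (p \in A)%:R).

(** The positions of a column of length three, and the other columns. *)
Definition filling3 : Type := (I * I * I) * filling2.

Definition bidet3 (d : filling3) os2 j A : int :=
  minor3 d.1.1.1 d.1.1.2 d.1.2 j A * bidet d.2.1 d.2.2 os2 A.

Definition entries3 (d : filling3) : seq I :=
  [:: d.1.1.1; d.1.1.2; d.1.2] ++ entries d.2.1 ++ d.2.2.

Definition fills3 D k (d : filling3) : bool :=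
  ((size d.2.1).+1 == k) && perm_eq (entries3 d) (enum D).

Definition bidet_comb3 (s : seq (int * filling3)) j A : int :=
  \sum_(e <- s) e.1 * bidet3 e.2 [::] j A.

Lemma fills3_size D k d : fills3 D k d -> (#|D| = k.*2.+1 + size d.2.2)%N.
Proof.
move=> /andP[/eqP <- /perm_size].
by rewrite /entries3 /entries !size_cat !size_map -cardE => <-; rewrite /= doubleS; lia.
Qed.

Lemma sum_delta (Q : pred I) x (F : I -> int) :
  \sum_(j | Q j) (j == x)%:R * F j = (Q x)%:R * F x.
Proof.
rewrite big_mkcond (bigD1 x) //= eqxx mul1r big1 ?addr0 => [|j /negbTE ->].
  by case: (Q x); rewrite ?mul1r ?mul0r.
by rewrite mul0r if_same.
Qed.

Lemma sum_minor3_pred p q r A (P : pred I) : \sum_(j | P j) minor3 p q r j A =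
  (P r)%:R * ((p \in A)%:R - (q \in A)%:R) + (P p)%:R * ((q \in A)%:R - (r \in A)%:R)
  + (P q)%:R * ((r \in A)%:R - (p \in A)%:R).
Proof.
by rewrite /minor3 !big_split /= !(sum_delta P _ (fun=> _)).
Qed.

(** Turning the letter 3 into a letter 2 makes two rows of the determinant equal. *)
Lemma sum_minor3 p q r A : \sum_(j | j \notin A) minor3 p q r j A = 0.
Proof.
by rewrite sum_minor3_pred; case: (p \in A); case: (q \in A); case: (r \in A).
Qed.

(** Turning the letter 3 into a letter 1 makes two rows of the determinant equal. *)
Lemma sum_minor3_in p q r A : \sum_(j in A) minor3 p q r j A = 0.
Proof.
by rewrite sum_minor3_pred; case: (p \in A); case: (q \in A); case: (r \in A).
Qed.

Lemma minor3_eq0 p q r j A : j \notin [:: p; q; r] -> minor3 p q r j A = 0.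
Proof.
by rewrite !inE !negb_or /minor3 => /and3P[/negbTE -> /negbTE -> /negbTE ->]; rewrite !mul0r !addr0.
Qed.

Lemma minor3_at p q r A : uniq [:: p; q; r] ->
  [/\ minor3 p q r r A = (p \in A)%:R - (q \in A)%:R,
      minor3 p q r p A = (q \in A)%:R - (r \in A)%:R &
      minor3 p q r q A = (r \in A)%:R - (p \in A)%:R].
Proof.
rewrite /= !inE negb_or andbT => /andP[/andP[pq pr] qr]; rewrite /minor3 !eqxx.
rewrite (eq_sym r p) (eq_sym r q) (eq_sym q p) (negbTE pq) (negbTE pr) (negbTE qr).
by rewrite !mul1r !mul0r ?add0r ?addr0.
Qed.

Lemma sum_minor3_cycle p q r ps os1 os2 (J : {set I}) :
    uniq ([:: p; q; r] ++ entries ps ++ os1 ++ os2) ->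
  \sum_(j in J) minor3 p q r j (J :\ j) * bidet ps os1 os2 (J :\ j) = 0.
Proof.
rewrite cat_uniq => /and3P[u /hasPn/= sep _].
have mJ j : j \in [:: p; q; r] -> bidet ps os1 os2 (J :\ j) = bidet ps os1 os2 J.
  by move=> jpqr; apply: bidetD1; apply: contraL jpqr => /sep.
transitivity (\sum_(j in J) minor3 p q r j J * bidet ps os1 os2 J); last first.
  by rewrite -big_distrl /= sum_minor3_in mul0r.
apply: eq_bigr => j jJ; have [jpqr|jpqr] := boolP (j \in [:: p; q; r]); last first.
  by rewrite !minor3_eq0 // !mul0r.
rewrite mJ //; congr (_ * _).
have [tr tp tq] := minor3_at (J :\ j) u; have [tr' tp' tq'] := minor3_at J u.
move: u; rewrite /= !inE negb_or andbT => /andP[/andP[pq pr] qr].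
move: jpqr; rewrite !inE => /or3P[] /eqP e; subst j;
  rewrite ?tr ?tp ?tq ?tr' ?tp' ?tq' !inE ?pq ?pr ?qr //.
- by rewrite (eq_sym q) pq (eq_sym r) pr.
- by rewrite (eq_sym r) qr.
Qed.

Lemma perm_enum_rem D x s : x \in D -> perm_eq (x :: s) (enum D) ->
  perm_eq s (enum (D :\ x)).
Proof.
move=> xD e; have := perm_trans e _; rewrite -(perm_cons x); apply.
by rewrite perm_sym; apply: perm_enumD1.
Qed.

(** Once the letter 3 is placed, a 3 x 3 minor is a 2 x 2 minor or zero. *)
Lemma minor3_cases D p q r ps os j :
    perm_eq ([:: p; q; r] ++ entries ps ++ os) (enum D) -> j \in D ->
  (forall A, minor3 p q r j A = 0) \/
  exists a b, (forall A, minor3 p q r j A = (a \in A)%:R - (b \in A)%:R)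
    /\ perm_eq (entries ((a, b) :: ps) ++ os) (enum (D :\ j)).
Proof.
move=> e jD; have : uniq ([:: p; q; r] ++ entries ps ++ os) by rewrite (perm_uniq e) enum_uniq.
rewrite cat_uniq => /and3P[u _ _].
have [jpqr|jpqr] := boolP (j \in [:: p; q; r]); last by left=> A; apply: minor3_eq0.
right; move: jpqr; rewrite !inE => /or3P[] /eqP ej; subst j.
- exists q, r; split=> [A|]; first by case: (minor3_at A u).
  rewrite (perm_trans (perm_entries_cons _ _ _ _)) //; apply: perm_enum_rem => //.
- exists r, p; split=> [A|]; first by case: (minor3_at A u).
  rewrite (perm_trans (perm_entries_cons _ _ _ _)) //; apply: perm_enum_rem => //.
  rewrite (perm_trans _ e) //; apply/seq.permP => a /=; lia.
- exists p, q; split=> [A|]; first by case: (minor3_at A u).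
  rewrite (perm_trans (perm_entries_cons _ _ _ _)) //; apply: perm_enum_rem => //.
  rewrite (perm_trans _ e) //; apply/seq.permP => a /=; lia.
Qed.

Lemma subset_sum_bidet3_gt D p q r ps os1 os2 j B l :
    perm_eq ([:: p; q; r] ++ entries ps ++ os1 ++ os2) (enum D) ->
    j \in D -> B \subset D :\ j -> l = ((size ps).+1 + size os1)%N ->
    ((size ps).+1 + size os1 + size os2 < #|B|)%N ->
  subset_sum l (bidet3 ((p, q, r), (ps, os1)) os2 j) B = 0.
Proof.
move=> e jD BD lE gt; rewrite /bidet3 /=; have [t0|[a [b [tE e']]]] := minor3_cases e jD.
  by apply: subset_sum_eq0 => A _ _; rewrite t0 mul0r.
rewrite -(subset_sum_bidet_gt e' BD lE gt); apply: eq_subset_sum => A _ _.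
by rewrite bidet_cons tE.
Qed.

Lemma subset_sum_bidet3_eq D p q r ps os1 os2 j B l :
    perm_eq ([:: p; q; r] ++ entries ps ++ os1 ++ os2) (enum D) ->
    j \in D -> B \subset D :\ j -> l = ((size ps).+1 + size os1)%N ->
    #|B| = ((size ps).+1 + size os1 + size os2)%N ->
  subset_sum l (bidet3 ((p, q, r), (ps, os1)) os2 j) B
    = bidet3 ((p, q, r), (ps, os1 ++ os2)) [::] j B.
Proof.
move=> e jD BD lE Bt; rewrite /bidet3 /=; have [t0|[a [b [tE e']]]] := minor3_cases e jD.
  by rewrite t0 mul0r; apply: subset_sum_eq0 => A _ _; rewrite t0 mul0r.
transitivity (subset_sum l (bidet ((a, b) :: ps) os1 os2) B).
  by apply: eq_subset_sum => A _ _; rewrite bidet_cons tE.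
by rewrite (subset_sum_bidet_eq e' BD lE Bt) tE minors_cons /bidet /= mulr1 mulrA.
Qed.

Lemma fills3_uniq D k d : fills3 D k d -> uniq [:: d.1.1.1; d.1.1.2; d.1.2].
Proof.
move=> /andP[_ e]; have : uniq (entries3 d) by rewrite (perm_uniq e) enum_uniq.
by rewrite cat_uniq => /andP[].
Qed.

Lemma subset_sum_bidet_comb3 s D k l j B : all (fun e => fills3 D k e.2) s ->
  (#|D| = (l + k).+1)%N -> j \in D -> B \subset D :\ j -> #|B| = l.+1 ->
  subset_sum l (bidet_comb3 s j) B = 0.
Proof.
move=> /allP sv Dlk jD BD Bl; rewrite subset_sum_sum big_seq big1 // => -[c [[[p q] r] [ps os]]] /sv /= dv.
rewrite subset_sumZ; have /= := fills3_size dv; case/andP: dv => /= /eqP dk e Ds.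
by rewrite (@subset_sum_bidet3_gt D) ?cats0 ?mulr0 //=; lia.
Qed.

Lemma sum_bidet_comb3 s D k A : all (fun e => fills3 D k e.2) s ->
  \sum_(j in D | j \notin A) bidet_comb3 s j A = 0.
Proof.
move=> /allP sv; rewrite exchange_big /= big_seq big1 // => -[c [[[p q] r] [ps os]]] /sv /= dv.
rewrite -big_distrr /bidet3 /= -big_distrl /=.
have -> : \sum_(j in D | j \notin A) minor3 p q r j A = \sum_(j | j \notin A) minor3 p q r j A.
  rewrite [RHS](bigID (mem D)) /= [X in _ = _ + X]big1 ?addr0 => [|j]; first by apply: eq_bigl => j; rewrite andbC.
  move=> /andP[_ jD]; apply: minor3_eq0; apply: contra jD => jp.
  by case/andP: dv => _ e; rewrite -mem_enum -(perm_mem e) /entries3 mem_cat jp.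
by rewrite sum_minor3 mul0r mulr0.
Qed.

(** Words with exactly one letter 3, and the operators 2 -> 1 and 3 -> 2. As for
    [kernel_two_rows], a point x is removed: the part with the letter 3 at x is
    spanned by bideterminants, and x extends one of their minors to a 3 x 3 minor;
    then the part with the letter 2 at x is spanned by terms that have an isolated
    letter 1 to be paired with x; the rest has the letter 1 at x. *)
Lemma kernel_three_rows D l k (y : I -> {set I} -> int) : (#|D| = (l + k).+1)%N ->
    (forall j B, j \in D -> B \subset D :\ j -> #|B| = l.+1 -> subset_sum l (y j) B = 0) ->
    (forall A, A \subset D -> #|A| = l -> \sum_(j in D | j \notin A) y j A = 0) ->
  exists2 s, all (fun e => fills3 D k e.2) s &
    forall j A, j \in D -> A \subset D :\ j -> #|A| = l -> y j A = bidet_comb3 s j A.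
Proof.
elim: {D}_.+1 {-2}D (ltnSn #|D|) l k y => // d IHd D Dd l k y Dlk y0 ysum.
have cD x : x \in D -> #|D| = #|D :\ x|.+1 by move=> xD; rewrite (cardsD1 x D) xD.
have [lk|kl] := ltnP l k.
  exists [::] => // j A jD AD Al; rewrite /bidet_comb3 big_nil; have := cD j jD.
  move=> cj; apply: (subset_sum_inj (t := l.+1) (D := D :\ j)) AD Al => //; first by clear -Dlk cj lk; lia.
  by move=> B; apply: y0.
case: k Dlk kl => [|k] Dlk kl.
  exists [::] => // j A jD AD Al; rewrite /bidet_comb3 big_nil.
  have AE : A = D :\ j by apply/eqP; rewrite eqEcard AD; have := cD j jD; lia.
  rewrite -[RHS](ysum A) //; last by rewrite AE subD1set.
  rewrite (big_pred1 j) // => i /=; rewrite AE !inE negb_and negbK.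
  by case: eqP => [->|_]; rewrite ?jD //=; case: (i \in D).
have [x xD] : exists x, x \in D by apply/set0Pn; rewrite -card_gt0; lia.
have {}cD := cD x xD.
case: l Dlk kl y0 ysum => // l Dlk kl y0 ysum.
have [s0 s0v s0E] : exists2 s, all (fun e => fills2 (D :\ x) k.+1 e.2) s &
    forall A, A \subset D :\ x -> #|A| = l.+1 -> y x A = bidet_comb2 s A.
  by apply: kernel_two_rows => [|B BD Bl]; [lia|exact: y0].
(* A filling has k.+1 columns of length two: the empty case does not occur. *)
pose lift0 (e : int * filling2) : int * filling3 :=
  if e.2.1 is pq :: ps then (e.1, ((pq, x), (ps, e.2.2))) else (e.1, ((x, x, x), e.2)).
pose t0 := map lift0 s0.
have t0v : all (fun e => fills3 D k.+1 e.2) t0.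
  rewrite all_map; apply/allP => -[c [[|[p q] ps] os]] /(allP s0v) /=.
    by rewrite /fills2.
  case/andP => /= /eqP [sz] e; rewrite /fills3 /= sz eqxx /=.
  rewrite (perm_trans _ (perm_enumD1 xD e)) //.
  by apply/seq.permP => a; rewrite /entries /= ?count_cat /= ?count_cat /=; lia.
have t0E A : A \subset D :\ x -> bidet_comb3 t0 x A = bidet_comb2 s0 A.
  rewrite subsetD1 => /andP[_ xA].
  rewrite /bidet_comb3 big_map /bidet_comb2 big_seq [RHS]big_seq; apply: eq_bigr => -[c [[|[p q] ps] os]] es.
    by have := allP s0v _ es; rewrite /= /fills2.
  have := allP t0v _ (map_f lift0 es) => /= /fills3_uniq /= u.
  by rewrite /bidet3 /= bidet_cons; have [-> _ _] := minor3_at A u.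
pose y1 j A := y j A - bidet_comb3 t0 j A.
have y10 j B : j \in D -> B \subset D :\ j -> #|B| = l.+2 -> subset_sum l.+1 (y1 j) B = 0.
  by move=> jD BD Bl; rewrite subset_sumB y0 // (subset_sum_bidet_comb3 t0v) ?subr0 //; lia.
have y1sum A : A \subset D -> #|A| = l.+1 -> \sum_(j in D | j \notin A) y1 j A = 0.
  by move=> AD Al; rewrite sumrB ysum // (sum_bidet_comb3 _ t0v) subr0.
have y1x A : A \subset D :\ x -> #|A| = l.+1 -> y1 x A = 0.
  by move=> AD Al; rewrite /y1 t0E // s0E // subrr.
have [s1 s1v s1E] : exists2 s, all (fun e => fills3 (D :\ x) k e.2) s &
    forall j A, j \in D :\ x -> A \subset D :\ x :\ j -> #|A| = l.+1 -> y1 j A = bidet_comb3 s j A.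
  apply: IHd; [lia|lia| |].
    move=> j B; rewrite !inE => /andP[_ jD] BD; apply: y10 => //.
    by apply: subset_trans BD (setSD _ (subD1set _ _)).
  move=> A AD Al; rewrite -[RHS](y1sum A) //; last exact: subset_trans AD (subD1set _ _).
  rewrite [RHS](bigD1 x) /=; last by rewrite xD; move: AD; rewrite subsetD1 => /andP[].
  rewrite y1x // add0r; apply: eq_bigl => j; rewrite !inE.
  by case: (j == x); rewrite ?andbF ?andbT.
(* A size count excludes fillings without an isolated entry. *)
pose lift1 (e : int * filling3) : int * filling3 :=
  if e.2.2.2 is o :: os then (e.1, (e.2.1, ((o, x) :: e.2.2.1, os))) else e.
pose t1 := map lift1 s1.
have t1v : all (fun e => fills3 D k.+1 e.2) t1.
  rewrite all_map; apply/allP => -[c [[[p q] r] [ps os]]] /(allP s1v) /= ev.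
  have /= := fills3_size ev; rewrite /lift1; case: os ev => [|o os] ev /= sz; first lia.
  case/andP: ev => /= /eqP sps e; apply/andP; split; first by rewrite -sps.
  rewrite (perm_trans _ (perm_enumD1 xD e)) //.
  by apply/seq.permP => a; rewrite /entries3 /entries /= ?count_cat /= ?count_cat /=; lia.
have s1x e : e \in s1 -> x \notin entries3 e.2.
  by move=> /(allP s1v) /andP[_ /perm_mem ->]; rewrite mem_enum !inE eqxx.
have t1x A : bidet_comb3 t1 x A = 0.
  rewrite /bidet_comb3 big_map big_seq big1 // => -[c [[[p q] r] [ps [|o os]]]] /s1x;
    rewrite /entries3 mem_cat negb_or /= => /andP[xpqr _]; by rewrite /bidet3 minor3_eq0 //= mul0r mulr0.
have t1E j A : x \notin A -> bidet_comb3 t1 j A = bidet_comb3 s1 j A.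
  move=> xA; rewrite /bidet_comb3 big_map; apply: eq_bigr => -[c [[[p q] r] [ps [|o os]]]] _ //=.
  by rewrite /bidet3 /= bidet_cons bidet_cons1 (negbTE xA) subr0.
pose y2 j A := y1 j A - bidet_comb3 t1 j A.
have y20 j B : j \in D -> B \subset D :\ j -> #|B| = l.+2 -> subset_sum l.+1 (y2 j) B = 0.
  by move=> jD BD Bl; rewrite subset_sumB y10 // (subset_sum_bidet_comb3 t1v) ?subr0 //; lia.
have y2sum A : A \subset D -> #|A| = l.+1 -> \sum_(j in D | j \notin A) y2 j A = 0.
  by move=> AD Al; rewrite sumrB y1sum // (sum_bidet_comb3 _ t1v) subr0.
have y2x j A : j \in D -> A \subset D :\ j -> x \notin A -> #|A| = l.+1 -> y2 j A = 0.
  move=> jD AD xA Al; have [jx|jx] := eqVneq j x.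
    by rewrite jx in AD *; rewrite /y2 y1x // t1x subrr.
  rewrite /y2 t1E // s1E ?subrr // ?inE ?jx //.
  by move: AD; rewrite !subsetD1 => /andP[-> ->]; rewrite xA.
have [s2 s2v s2E] : exists2 s, all (fun e => fills3 (D :\ x) k.+1 e.2) s &
    forall j A, j \in D :\ x -> A \subset D :\ x :\ j -> #|A| = l -> y2 j (x |: A) = bidet_comb3 s j A.
  apply: (IHd _ _ l k.+1 (fun j A => y2 j (x |: A))); [lia|lia| |].
    move=> j B jD; rewrite !subsetD1 => /andP[/andP[BD xB] jB] Bl.
    have [jx jD'] : j != x /\ j \in D by move: jD; rewrite !inE => /andP[].
    have BDj : B \subset D :\ j by rewrite subsetD1 BD.
    have := y20 j (x |: B); rewrite subset_sum_setU1 // subset_sum_card // y2x // add0r => -> //.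
      by rewrite subUset sub1set !inE eq_sym jx xD.
    by rewrite cardsU1 xB Bl.
  move=> A; rewrite subsetD1 => /andP[AD xA] Al; rewrite -[RHS](y2sum (x |: A)).
  - apply: eq_bigl => j; rewrite !inE; by case: (j == x); rewrite ?andbF.
  - by rewrite subUset sub1set xD.
  - by rewrite cardsU1 xA Al.
pose head (e : int * filling3) : int * filling3 := (e.1, (e.2.1, (e.2.2.1, x :: e.2.2.2))).
exists (t0 ++ t1 ++ map head s2).
  rewrite !all_cat t0v t1v all_map; apply/allP => -[c [[[p q] r] [ps os]]] /(allP s2v) /=.
  case/andP => /= sps e; apply/andP; split=> //=.
  rewrite (perm_trans _ (perm_enumD1 xD e)) //.
  by apply/seq.permP => a; rewrite /entries3 /entries /= ?count_cat /= ?count_cat /=; lia.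
move=> j A jD AD Al; rewrite /bidet_comb3 !big_cat -/(bidet_comb3 t0 j A) -/(bidet_comb3 t1 j A) big_map /=.
apply/eqP; rewrite addrC -subr_eq; apply/eqP; rewrite -/(y1 j A).
apply/eqP; rewrite addrC -subr_eq; apply/eqP; rewrite -/(y2 j A).
have [xA|xA] := boolP (x \in A); last first.
  rewrite y2x // big1 // => e _.
  by rewrite /bidet3 bidet_cons1 (negbTE xA) mul0r !mulr0.
move: AD; rewrite subsetD1 => /andP[AD jA].
have jx : j != x by apply: contraNneq jA => ->.
rewrite -{1}(setD1K xA) s2E; last first.
- by move: Al; rewrite (cardsD1 x) xA => -[].
- by rewrite subsetD1 setSD //= !inE jx.
- by rewrite !inE jx.
rewrite /bidet_comb3 big_seq [RHS]big_seq; apply: eq_bigr => -[c [[[p q] r] [ps os]]] /(allP s2v) /= ev.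
have : x \notin entries3 ((p, q, r), (ps, os)).
  by case/andP: ev => _ /perm_mem ->; rewrite mem_enum !inE eqxx.
rewrite /entries3 mem_cat negb_or => /andP[]; rewrite !inE !negb_or => /and3P[xp xq xr] xs.
rewrite /bidet3 /= bidet_cons1 xA mul1r bidetD1 ?cats0 // /minor3.
by rewrite !in_setD1_neq // eq_sym.
Qed.
End Kernels.

(** * Polytabloids as products over columns *)

Section Polytabloid.
Variables (n : nat) (la : intpart n) (T : tableau la).
Implicit Types (s u : 'S_n) (i j : 'I_n).

Lemma zs_mulE (f g : ZS n) s : (f * g) s = \sum_u f u * g (s * u^-1)%g.
Proof. exact: ffunE. Qed.

Lemma zs_perm_mulE s (f : ZS n) u : (zs_perm s * f) u = f (u * s^-1)%g.
Proof.
rewrite zs_mulE (bigD1 s) //= big1 => [|t ts]; first by rewrite ffunE eqxx mul1r addr0.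
by rewrite ffunE (negbTE ts) mul0r.
Qed.

Lemma row_symE s : row_sym T s = (s \in row_stab T)%:R.
Proof.
rewrite /row_sym sum_ffunE (eq_bigr (fun u => (s == u)%:R)) => [|u _]; last by rewrite ffunE.
have [sR|sR] := boolP (s \in row_stab T).
  by rewrite (bigD1 s) //= eqxx big1 ?addr0 // => u /andP[_ /negbTE]; rewrite eq_sym => ->.
by rewrite big1 // => u uR; case: eqP => // su; rewrite su uR in sR.
Qed.

Lemma col_symE s : col_sym T s = if s \in col_stab T then (-1) ^+ s else 0.
Proof.
have E u : (zs_perm u *~ (-1) ^+ u) s = if s == u then (-1) ^+ u else 0.
  by rewrite ffunMzE ffunE; case: eqP => // _; rewrite ?mul0rz //; rewrite intz.
rewrite /col_sym sum_ffunE (eq_bigr _ (fun u _ => E u)).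
have [sC|sC] := boolP (s \in col_stab T).
  rewrite (bigD1 s) //= eqxx big1 ?addr0 // => u /andP[_ /negbTE].
  by rewrite eq_sym => ->.
by rewrite big1 // => u uC; case: eqP => // su; rewrite su uC in sC.
Qed.

Lemma mem_tableau i : i \in flatten T.
Proof.
case: T => t sh u /=; have /andP[_ /andP[_ /eqP lan]] := valP la.
have sz : size (flatten t) = n by rewrite size_flatten sh.
suff : flatten t =i enum 'I_n by move->; rewrite mem_enum.
have sub : {subset flatten t <= enum 'I_n} by move=> x _; rewrite mem_enum.
have le : (size (enum 'I_n) <= size (flatten t))%N by rewrite size_enum_ord sz.
by have [_] := uniq_min_size u sub le.
Qed.

Lemma has_tableau i : has (fun r => i \in r) T.
Proof.
have /flattenP[r rT ir] := mem_tableau i.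
by apply/hasP; exists r.
Qed.

Lemma mem_row i : i \in nth [::] T (row_of T i).
Proof. exact: (nth_find [::] (has_tableau i)). Qed.

Lemma row_col_inj i j : row_of T i = row_of T j -> col_of T i = col_of T j -> i = j.
Proof.
rewrite /col_of => r; rewrite -r => c; have := mem_row j; rewrite -r => jr.
by rewrite -(nth_index i (mem_row i)) c nth_index.
Qed.

(** The second property moves the entries of a word into their rows by
    transpositions within columns, and the third one covers the words for which no
    such transposition exists. *)
Lemma polytabloid_unique (g : 'S_n -> int) :
    (forall s, s \in row_stab T -> g s = 0) ->
    (forall s i j, i != j -> col_of T i = col_of T j -> g (s * tperm i j)%g = - g s) ->
    (forall s i, (forall j, col_of T j = col_of T i -> row_of T (s^-1%g j) <> row_of T i) ->
       g s = 0) ->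
  forall s, g s = 0.
Proof.
move=> gR gt g0 s; pose wrong s := [set i | row_of T (s^-1%g i) != row_of T i].
elim: {s}_.+1 {-2}s (ltnSn #|wrong s|) => // d IHd s sd.
have [/setP w0|[i]] := set_0Vmem (wrong s).
  apply: gR; rewrite inE; apply/forallP => i; have := w0 (s i).
  by rewrite !inE permK eq_sym => /negbFE.
rewrite inE => iw; have [/existsP[j /andP[/eqP jc /eqP jr]]|/existsPn none] :=
  boolP [exists j, (col_of T j == col_of T i) && (row_of T (s^-1%g j) == row_of T i)].
  (* The transposition puts a correct entry at i and spoils none: j was wrong. *)
  have ij : i != j by apply: contraNneq iw => e; rewrite {1}e jr.
  rewrite -[g s]opprK -(gt _ i j) // IHd ?oppr0 //.
  rewrite -ltnS; apply: leq_trans _ sd; rewrite ltnS; apply: proper_card; apply/properP; split.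
    apply/subsetP => k; rewrite !inE invMg tpermV permM.
    case: tpermP => [->|->|//]; first by rewrite jr eqxx.
    rewrite jr => _; apply: contraNneq ij => e; apply/eqP/row_col_inj => //.
  by exists i; rewrite !inE // invMg tpermV permM tpermL jr eqxx.
apply: (g0 s i) => j jc jr; have := none j; by rewrite jc jr !eqxx.
Qed.

(** The generator of the Specht module, without a factorization of the column
    stabilizer: to recognize a product over the columns, it suffices to look at
    transpositions. *)
Lemma polytabloidE (f : 'S_n -> int) :
    (forall s, s \in row_stab T -> f s = 1) ->
    (forall s i j, i != j -> col_of T i = col_of T j -> f (s * tperm i j)%g = - f s) ->
    (forall s i, (forall j, col_of T j = col_of T i -> row_of T (s^-1%g j) <> row_of T i) ->
       f s = 0) ->
  forall s, (col_sym T * row_sym T) s = f s.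
Proof.
move=> fR ft f0 s; set e := col_sym T * row_sym T.
apply/eqP; rewrite -subr_eq0; apply/eqP; move: s.
apply: polytabloid_unique => [s sR|s i j ij cij|s i none].
- rewrite fR // zs_mulE (bigD1 1%g) //= big1 ?addr0 => [|u u1].
    rewrite invg1 mulg1 row_symE sR col_symE mulr1 ifT ?odd_perm1 ?subrr //.
    by rewrite inE; apply/forallP => i; rewrite perm1.
  rewrite col_symE row_symE; case: ifP => uC; last by rewrite mul0r.
  case: (boolP (_ \in _)) => [suR|]; last by rewrite mulr0.
  case/eqP: u1; apply/permP => i; rewrite perm1.
  apply: row_col_inj; last by move: uC; rewrite inE => /forallP/(_ i)/eqP.
  move: suR sR; rewrite !inE => /forallP/(_ (s^-1%g (u i)))/eqP + /forallP/(_ (s^-1%g (u i)))/eqP.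
  by rewrite permM permKV permK => <- <-.
- rewrite ft //; suff -> : e (s * tperm i j)%g = - e s by rewrite opprB addrC opprK.
  rewrite !zs_mulE (reindex_inj (mulIg (tperm i j))) /= -sumrN; apply: eq_bigr => u _.
  rewrite invMg mulgA mulgK -mulNr !col_symE; congr (_ * _).
  have -> : (u * tperm i j \in col_stab T)%g = (u \in col_stab T).
    rewrite !inE; apply: eq_forallb => k; rewrite permM.
    by case: tpermP => [->|->|//]; rewrite cij.
  case: ifP => _; last by rewrite oppr0.
  by rewrite odd_permM odd_tperm ij addbT signrN.
- rewrite (f0 s i none) subr0 zs_mulE big1 // => u _; rewrite col_symE row_symE.
  case: ifP => uC; last by rewrite mul0r.
  case: (boolP (_ \in _)) => [suR|]; last by rewrite mulr0.
  case: (none (u i)); first by move: uC; rewrite inE => /forallP/(_ i)/eqP.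
  move: suR; rewrite inE => /forallP/(_ (s^-1%g (u i)))/eqP.
  by rewrite permM permKV permK.
Qed.
End Polytabloid.

Section PermAction.
Variable I : finType.
Implicit Types (A : {set I}) (s : {perm I}) (p q r j : I).
Implicit Types (ps : seq (I * I)) (os : seq I).

Definition map_pairs s ps := [seq (s e.1, s e.2) | e <- ps].

Lemma minors_map s ps A : minors (map_pairs s ps) A = minors ps (s @^-1: A).
Proof. by rewrite /minors big_map; apply: eq_bigr => e _; rewrite !inE. Qed.

Lemma bidet_map s ps os1 os2 A :
  bidet (map_pairs s ps) (map s os1) (map s os2) A = bidet ps os1 os2 (s @^-1: A).
Proof.
rewrite /bidet minors_map all_map has_map; congr (_ * (nat_of_bool _)%:R * (nat_of_bool (~~ _))%:R).
  by apply: eq_all => x /=; rewrite !inE.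
by apply: eq_has => x /=; rewrite !inE.
Qed.

Lemma minor3_map s p q r j A :
  minor3 (s p) (s q) (s r) j A = minor3 p q r (s^-1%g j) (s @^-1: A).
Proof. by rewrite /minor3 !inE !(canF_eq (permKV s)). Qed.

Lemma bidet_tperm ps os p q A : uniq (entries ps ++ os) -> (p, q) \in ps ->
  bidet ps os [::] (tperm p q @^-1: A) = - bidet ps os [::] A.
Proof.
move=> u pqs; have e := perm_to_rem pqs; set ps' := rem _ _ in e.
have minorsE B : minors ps B = minors ((p, q) :: ps') B by apply: perm_big.
have {}e : perm_eq (entries ps ++ os) (p :: q :: entries ps' ++ os).
  rewrite (perm_trans _ (perm_entries_cons _ _ _ _)) // perm_cat2r /entries.
  by apply: perm_cat; apply: perm_map.
move: u; rewrite (perm_uniq e) /= inE negb_or => /andP[/andP[pq pn] /andP[qn _]].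
have E x : x \in entries ps' ++ os -> tperm p q x = x.
  by move=> xs; rewrite tpermD //; [apply: contraNneq pn => -> | apply: contraNneq qn => ->].
rewrite /bidet !minorsE !minors_cons /= !inE tpermL tpermR.
rewrite (@eq_minors _ ps' _ A) => [|x xs]; last by rewrite inE E // mem_cat xs.
rewrite (@eq_in_all _ _ (mem A)) => [|x xs]; last by rewrite /= inE E // mem_cat xs orbT.
by ring.
Qed.

Lemma bidet_tpermD ps os p q A : p \notin entries ps ++ os -> q \notin entries ps ++ os ->
  bidet ps os [::] (tperm p q @^-1: A) = bidet ps os [::] A.
Proof.
move=> pn qn; apply: eq_bidet => x; rewrite cats0 => xs.
by rewrite inE tpermD //; [apply: contraNneq pn => -> | apply: contraNneq qn => ->].
Qed.

Lemma minor3_tpermD p q r a b j A : a \notin [:: p; q; r] -> b \notin [:: p; q; r] ->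
  minor3 p q r (tperm a b j) (tperm a b @^-1: A) = minor3 p q r j A.
Proof.
rewrite !inE !negb_or => /and3P[ap aq ar] /and3P[bp bq br].
by rewrite -{1}tpermV -minor3_map !tpermD.
Qed.

Lemma minor3_tperm p q r a b j A : uniq [:: p; q; r] ->
  a \in [:: p; q; r] -> b \in [:: p; q; r] -> a != b ->
  minor3 p q r (tperm a b j) (tperm a b @^-1: A) = - minor3 p q r j A.
Proof.
rewrite -{1}tpermV -minor3_map /= !inE negb_or andbT => /andP[/andP[pq pr] qr].
have E := (eqxx, negbTE pq, negbTE pr, negbTE qr).
move=> /or3P[]/eqP-> /or3P[]/eqP->; rewrite ?eqxx // => _;
  rewrite !permE /= !E ?(eq_sym q p) ?(eq_sym r p) ?(eq_sym r q) ?E /minor3; ring.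
Qed.
End PermAction.

Section TwoThreeRows.
Variables (n : nat) (la : intpart n) (T : tableau la).
Implicit Types (s u : 'S_n) (i j : 'I_n).

Lemma row_ofE k i : i \in nth [::] T k -> row_of T i = k.
Proof.
have key (t : seq (seq 'I_n)) k1 k2 : uniq (flatten t) ->
    i \in nth [::] t k1 -> i \in nth [::] t k2 -> k1 = k2.
  elim: t k1 k2 => [|r t IHt] [|k1] [|k2] //=; rewrite cat_uniq => /and3P[_ /hasPn sep u] i1 i2.
  - have : i \in flatten t by apply/flattenP; exists (nth [::] t k2) => //; apply: mem_nth;
      rewrite ltnNge; apply/negP => le; rewrite nth_default in i2.
    by move/sep; rewrite /= i1.
  - have : i \in flatten t by apply/flattenP; exists (nth [::] t k1) => //; apply: mem_nth;
      rewrite ltnNge; apply/negP => le; rewrite nth_default in i1.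
    by move/sep; rewrite /= i2.
  - by congr _.+1; apply: IHt.
by move=> ik; apply: (key T) => //; [case: (T) | exact: mem_row].
Qed.

Lemma uniq_row k : uniq (nth [::] T k).
Proof.
case: T => t _ /=; elim: t k => [|r t IHt] [|k] //=; rewrite cat_uniq => /and3P[ur _ ut] //.
exact: IHt.
Qed.

Lemma col_ofE x0 k c : (c < size (nth [::] T k))%N -> col_of T (nth x0 (nth [::] T k) c) = c.
Proof.
move=> ck; rewrite /col_of (row_ofE (k := k)) ?mem_nth // index_uniq // uniq_row //.
Qed.

(** The element s of the symmetric group determines a word: the row numbers in the
    tableau s T. This is the set of positions of its first letter. *)
Definition first_row s : {set 'I_n} := [set x | row_of T (s^-1%g x) == 0%N].

Lemma first_rowM s u : first_row (s * u)%g = u^-1%g @^-1: first_row s.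
Proof. by apply/setP => x; rewrite !inE invMg permM. Qed.

Lemma mem_zipP x0 (s1 s2 : seq 'I_n) p q : (p, q) \in zip s1 s2 ->
  exists c, [/\ (c < size s1)%N, (c < size s2)%N, p = nth x0 s1 c & q = nth x0 s2 c].
Proof.
case/(nthP (x0, x0)) => c; rewrite nth_zip_cond => cs; rewrite cs => -[<- <-].
by exists c; move: cs; rewrite size_zip leq_min => /andP[].
Qed.

Lemma nth_mem_zip x0 (s1 s2 : seq 'I_n) c : (c < size s1)%N -> (c < size s2)%N ->
  (nth x0 s1 c, nth x0 s2 c) \in zip s1 s2.
Proof.
move=> c1 c2; have cz : (c < size (zip s1 s2))%N by rewrite size_zip leq_min c1.
by have := mem_nth (x0, x0) cz; rewrite nth_zip_cond cz.
Qed.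
End TwoThreeRows.

Section Columns.
Variables (n : nat) (la : intpart n) (T : tableau la).
Implicit Types (s u : 'S_n) (i j : 'I_n) (ps : seq ('I_n * 'I_n)) (os : seq 'I_n).

Lemma uniq_tableau : uniq (flatten T).
Proof. by case: T. Qed.

Lemma shape_tableau : shape T = la.
Proof. by case: T. Qed.

Lemma row_of_lt i : (row_of T i < size la)%N.
Proof. by rewrite -shape_tableau size_map -has_find has_tableau. Qed.

Definition col_pair (e : 'I_n * 'I_n) : bool :=
  [&& row_of T e.1 == 0%N, row_of T e.2 == 1%N & col_of T e.1 == col_of T e.2].

Lemma minors_eq0 ps (A : {set 'I_n}) p q : (p, q) \in ps -> (p \in A) = (q \in A) -> minors ps A = 0.
Proof.
move=> pqs e; apply/eqP; rewrite prodf_seq_eq0; apply/hasP; exists (p, q) => //=.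
by rewrite e subrr.
Qed.

Lemma bidet_row ps os s : all col_pair ps -> all (fun o => row_of T o == 0%N) os ->
  s \in row_stab T -> bidet ps os [::] (first_row T s) = 1.
Proof.
move=> /allP ps2 /allP os1; rewrite inE => /forallP sR.
have E x : (x \in first_row T s) = (row_of T x == 0%N).
  by rewrite inE -[in RHS](permKV s x) (eqP (sR _)).
rewrite /bidet mulr1 (_ : all _ _) ?mulr1; last by apply/allP => o /os1 /=; rewrite E.
rewrite /minors big1_seq // => -[p q] /= /ps2 /and3P[/= p0 /eqP q1 _].
by rewrite !E p0 q1.
Qed.

Lemma bidet_vanish ps os s i :
    all col_pair ps -> all (fun o => row_of T o == 0%N) os ->
    (forall j, j \in entries ps -> (row_of T (s^-1%g j) < 2)%N) ->
    (forall j, col_of T j = col_of T i -> row_of T (s^-1%g j) <> row_of T i) ->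
  i \in entries ps ++ os -> bidet ps os [::] (first_row T s) = 0.
Proof.
move=> /allP ps2 /allP os1 lt2 none; rewrite mem_cat => /orP[ie|io]; last first.
  rewrite /bidet (_ : all _ _ = false) ?mulr0 ?mul0r //; apply/negbTE/allPn; exists i => //=.
  rewrite inE; apply/eqP => r0; case: (none i) => //.
  by rewrite r0; apply/esym/eqP/os1.
have [[p q] pqs ipq] : exists2 e, e \in ps & (i == e.1) || (i == e.2).
  by move: ie; rewrite mem_cat => /orP[] /mapP[e es ->]; exists e; rewrite ?eqxx ?orbT.
have /and3P[/= /eqP p0 /eqP q1 /eqP pq] := ps2 _ pqs.
rewrite /bidet (@minors_eq0 _ _ p q) ?mul0r // !inE.
case/orP: ipq => /eqP /= e; subst i; rewrite ?p0 ?q1 in none.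
  have /eqP/negbTE -> := none p erefl; have /eqP/negbTE -> // := none q (esym pq).
have := lt2 p; have := lt2 q; have := none p pq; have := none q erefl.
rewrite /entries !mem_cat (map_f fst pqs) (map_f snd pqs) orbT.
by move: (row_of T _) (row_of T _) => [|[|a]] [|[|b]] //= ? ? /(_ isT) ? /(_ isT).
Qed.

Lemma first_row_tperm s i j : first_row T (s * tperm i j)%g = tperm i j @^-1: first_row T s.
Proof. by rewrite first_rowM tpermV. Qed.

Lemma take_zip_mem k (r1 r2 : seq 'I_n) p q :
  (forall x0 c, (c < size r1)%N -> col_of T (nth x0 r1 c) = (c + k)%N) ->
  (forall x0 c, (c < size r2)%N -> col_of T (nth x0 r2 c) = (c + k)%N) ->
  (size r2 <= size r1)%N ->
  ((p, q) \in zip (take (size r2) r1) r2)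
    = [&& p \in r1, q \in r2 & col_of T p == col_of T q].
Proof.
move=> c1 c2 le; have szt : size (take (size r2) r1) = size r2 by rewrite size_takel.
apply/idP/and3P => [/(mem_zipP p)[c [_ cr pE qE]]|[pr qr /eqP pq]].
  rewrite nth_take // in pE; rewrite pE qE !mem_nth ?(leq_trans cr) //.
  by split=> //; rewrite c1 ?c2 ?(leq_trans cr).
case/(nthP p): pr pq => c cr <-; case/(nthP p): qr => d dr <-; rewrite c1 // c2 // => /eqP.
rewrite eqn_add2r => /eqP e; subst d; rewrite -(@nth_take (size r2) _ p c dr r1).
by apply: nth_mem_zip; rewrite ?szt.
Qed.
End Columns.

Section TwoRows.
Variables (n : nat) (la : intpart n) (T : tableau la) (a b : nat).
Hypothesis laE : la = [:: a; b] :> seq nat.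

(** The minors are the columns of T of length two. *)
Lemma polytabloid2 : exists ps os, fills2 [set: 'I_n] b (ps, os) /\
  forall s, (col_sym T * row_sym T) s = bidet ps os [::] (first_row T s).
Proof.
have [r1 [r2 [TE s1 s2]]] : exists r1 r2, [/\ rows T = [:: r1; r2], size r1 = a & size r2 = b].
  have := shape_tableau T; rewrite laE; case: (rows T) => [|r1 [|r2 [|r3 t]]] //= [<- <-].
  by exists r1, r2.
have ba : (b <= a)%N.
  by have : sorted geq la by [case/and3P: (valP la)]; rewrite laE /= andbT.
have R1 i : (i \in r1) = (row_of T i == 0%N).
  apply/idP/eqP => [ir|r0]; first by apply: row_ofE; rewrite TE.
  by have := mem_row T i; rewrite r0 TE.
have R2 i : (i \in r2) = (row_of T i == 1%N).
  apply/idP/eqP => [ir|r0]; first by apply: row_ofE; rewrite TE.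
  by have := mem_row T i; rewrite r0 TE.
have c1 x0 c : (c < size r1)%N -> col_of T (nth x0 r1 c) = (c + 0)%N.
  by have := @col_ofE _ _ T x0 0 c; rewrite TE addn0.
have c2 x0 c : (c < size r2)%N -> col_of T (nth x0 r2 c) = (c + 0)%N.
  by have := @col_ofE _ _ T x0 1 c; rewrite TE addn0.
pose ps := zip (take b r1) r2; pose os := drop b r1.
have psE p q : ((p, q) \in ps) = col_pair T (p, q).
  by rewrite /ps -s2 (take_zip_mem _ _ c1 c2) ?s1 ?s2 // /col_pair /= R1 R2.
have sz : size (take b r1) = size r2 by rewrite size_takel ?s1 ?s2.
have e : perm_eq (entries ps ++ os) (enum [set: 'I_n]).
  apply: (@perm_trans _ (flatten T)).
    rewrite /entries /ps /os unzip1_zip ?sz // unzip2_zip ?sz // TE /= cats0 -[X in perm_eq _ (X ++ _)](cat_take_drop b r1).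
    by apply/seq.permP => x; rewrite !count_cat; lia.
  apply: uniq_perm; rewrite ?enum_uniq ?uniq_tableau // => x.
  by rewrite mem_enum inE mem_tableau.
have u : uniq (entries ps ++ os) by rewrite (perm_uniq e) enum_uniq.
have psC : all (col_pair T) ps by apply/allP => -[p q]; rewrite psE.
have osR : all (fun o => row_of T o == 0%N) os.
  by apply/allP => o; rewrite -R1; apply: mem_drop.
exists ps, os; split; first by rewrite /fills2 /= e size_zip sz s2 minnn eqxx.
apply: polytabloidE => [s|s i j ij cij|s i none].
- exact: bidet_row.
- rewrite first_row_tperm; have : ((i, j) \in ps) || ((j, i) \in ps).
    rewrite !psE /col_pair /= cij eqxx !andbT.
    have := row_of_lt T i; have := row_of_lt T j; rewrite laE /=.
    have : row_of T i != row_of T j by apply: contraNneq ij => r; apply/eqP/(row_col_inj r cij).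
    by case: (row_of T i) (row_of T j) => [|[|]] [|[|]].
  by case/orP => [|/bidet_tperm] ijs; [apply: bidet_tperm | rewrite tpermC ijs].
- apply: (bidet_vanish psC osR _ none).
    by move=> j _; have := row_of_lt T (s^-1%g j); rewrite laE.
  by rewrite (perm_mem e) mem_enum inE.
Qed.
End TwoRows.

Section ThreeRows.
Variables (n : nat) (la : intpart n) (T : tableau la) (a b : nat).
Hypothesis laE : la = [:: a; b; 1%N] :> seq nat.

(** The minor of size 3 is the column of T of length three, and x3 the only entry
    of its third row. *)
Lemma polytabloid3 : exists x3 d, [/\ row_of T x3 = 2%N, fills3 [set: 'I_n] b d &
  forall s, (col_sym T * row_sym T) s = bidet3 d [::] (s x3) (first_row T s)].
Proof.
have /and3P[ba b1 _] : [&& (b <= a)%N, (0 < b)%N & true].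
  by have : sorted geq la by [case/and3P: (valP la)]; rewrite laE.
have [x1 [r1 [x2 [r2 [x3 [TE s1 s2]]]]]] : exists x1 r1 x2 r2 x3,
   [/\ rows T = [:: x1 :: r1; x2 :: r2; [:: x3]], (size r1).+1 = a & (size r2).+1 = b].
  have := shape_tableau T; rewrite laE.
  case: (rows T) => [|t1 [|t2 [|t3 [|? ?]]]] //= [sa sb]; case: t3 => [|x3 [|? ?]] // _.
  case: t1 sa => [|x1 r1] sa; first by move: ba b1; rewrite -sa leqn0 => /eqP->.
  case: t2 sb => [|x2 r2] sb; first by move: b1; rewrite -sb.
  by exists x1, r1, x2, r2, x3.
have le : (size r2 <= size r1)%N by lia.
have R k i : (i \in nth [::] T k) = (row_of T i == k).
  apply/idP/eqP => [|<-]; [exact: row_ofE | exact: mem_row].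
have R1 i : (i \in x1 :: r1) = (row_of T i == 0%N) by rewrite -R TE.
have R2 i : (i \in x2 :: r2) = (row_of T i == 1%N) by rewrite -R TE.
have R3 i : (i == x3) = (row_of T i == 2%N) by rewrite -R TE inE.
have C k x0 c : (c < size (nth [::] T k))%N -> col_of T (nth x0 (nth [::] T k) c) = c.
  exact: col_ofE.
have c1 x0 c : (c < size r1)%N -> col_of T (nth x0 r1 c) = (c + 1)%N.
  by have := C 0%N x0 c.+1; rewrite TE addn1; apply.
have c2 x0 c : (c < size r2)%N -> col_of T (nth x0 r2 c) = (c + 1)%N.
  by have := C 1%N x0 c.+1; rewrite TE addn1; apply.
have colx1 : col_of T x1 = 0%N by have := C 0%N x1 0%N; rewrite TE; apply.
have colx2 : col_of T x2 = 0%N by have := C 1%N x1 0%N; rewrite TE; apply.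
have colx3 : col_of T x3 = 0%N by have := C 2%N x1 0%N; rewrite TE; apply.
have rowx1 : row_of T x1 = 0%N by apply/eqP; rewrite -R1 mem_head.
have rowx2 : row_of T x2 = 1%N by apply/eqP; rewrite -R2 mem_head.
have rowx3 : row_of T x3 = 2%N by apply/eqP; rewrite -R3.
have cgt i : i \in r1 ++ r2 -> (0 < col_of T i)%N.
  by rewrite mem_cat => /orP[] /(nthP x1)[c cs <-]; rewrite ?c1 ?c2 // addn1.
pose ps := zip (take (size r2) r1) r2; pose os := drop (size r2) r1.
have sz : size (take (size r2) r1) = size r2 by rewrite size_takel.
have e : perm_eq ([:: x1; x2; x3] ++ entries ps ++ os) (enum [set: 'I_n]).
  apply: (@perm_trans _ (flatten T)).
    rewrite /entries /ps /os unzip1_zip ?sz // unzip2_zip ?sz // TE /=.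
    rewrite -[X in perm_eq _ (_ :: X ++ _)](cat_take_drop (size r2) r1).
    by apply/seq.permP => x /=; rewrite !count_cat /= ?count_cat /= ; lia.
  apply: uniq_perm; rewrite ?enum_uniq ?uniq_tableau // => x.
  by rewrite mem_enum inE mem_tableau.
have u : uniq ([:: x1; x2; x3] ++ entries ps ++ os) by rewrite (perm_uniq e) enum_uniq.
have := u; rewrite cat_uniq => /and3P[ux /hasPn sep ue].
have psE p q : ((p, q) \in ps) = [&& p \in r1, q \in r2 & col_of T p == col_of T q].
  by rewrite /ps (take_zip_mem _ _ c1 c2).
have psC : all (col_pair T) ps.
  apply/allP => -[p q]; rewrite psE => /and3P[pr qr pq].
  by rewrite /col_pair /= pq -R1 -R2 !inE pr qr !orbT.
have osR : all (fun o => row_of T o == 0%N) os.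
  by apply/allP => o /mem_drop or1; rewrite -R1 inE or1 orbT.
have notx i : i \in entries ps ++ os -> i \notin [:: x1; x2; x3] by move/sep.
have in_entries p q : (p, q) \in ps -> (p \in entries ps ++ os) * (q \in entries ps ++ os).
  by move=> pqs; rewrite /entries !mem_cat (map_f fst pqs) (map_f snd pqs) !orbT.
have all_in i : (i \in [:: x1; x2; x3]) || (i \in entries ps ++ os).
  by rewrite -mem_cat (perm_mem e) mem_enum in_setT.
have colx i : (i \in [:: x1; x2; x3]) = (col_of T i == 0%N).
  apply/idP/eqP => [|c0].
    by rewrite !inE => /or3P[] /eqP->.
  case/orP: (all_in i) => //; rewrite mem_cat /entries /ps unzip1_zip ?sz // unzip2_zip ?sz // mem_cat.
  have c0' : i \notin r1 ++ r2 by apply/negP => /cgt; rewrite c0.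
  move: c0'; rewrite mem_cat negb_or => /andP[n1 n2] /orP[/orP[/mem_take|]|/mem_drop];
    by rewrite ?(negbTE n1) ?(negbTE n2).
exists x3, ((x1, x2, x3), (ps, os)); split=> //.
  by rewrite /fills3 /entries3 /= e size_zip sz minnn s2 eqxx.
have [tr tp tq] := (fun A => let: And3 tr _ _ := minor3_at A ux in tr,
                    fun A => let: And3 _ tp _ := minor3_at A ux in tp,
                    fun A => let: And3 _ _ tq := minor3_at A ux in tq).
apply: (polytabloidE (f := fun s => bidet3 ((x1, x2, x3), (ps, os)) [::] (s x3) (first_row T s)))
  => [s sR|s i j ij cij|s i none]; rewrite /bidet3 /=.
- rewrite bidet_row // mulr1; have sE i : row_of T (s i) = row_of T i.
    by move: sR; rewrite inE => /forallP/(_ i)/eqP.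
  have -> : s x3 = x3 by apply/eqP; rewrite R3 sE rowx3.
  have E x : (x \in first_row T s) = (row_of T x == 0%N) by rewrite inE -{2}(permKV s x) sE.
  by rewrite tr !E rowx1 rowx2.
- rewrite first_row_tperm permM; have [ix|ix] := boolP (i \in [:: x1; x2; x3]).
    have jx : j \in [:: x1; x2; x3] by move: ix; rewrite !colx cij.
    rewrite minor3_tperm // bidet_tpermD ?mulNr //.
      by apply: contraL ix => /notx.
    by apply: contraL jx => /notx.
  have jx : j \notin [:: x1; x2; x3] by move: ix; rewrite !colx cij.
  have : ((i, j) \in ps) || ((j, i) \in ps).
    rewrite !psE cij eqxx !andbT.
    have mem k : k \notin [:: x1; x2; x3] -> (k \in r1) || (k \in r2).
      move=> kx; have := row_of_lt T k; rewrite laE /= => k3.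
      have := R1 k; have := R2 k; have := R3 k; move: kx; rewrite !inE !negb_or => /and3P[/negbTE -> /negbTE -> /negbTE ->] /=.
      by case: (row_of T k) k3 => [|[|[|]]] //= _ _ -> ->.
    have r0 k : k \in r1 -> row_of T k = 0%N by move=> kr; apply/eqP; rewrite -R1 inE kr orbT.
    have r1' k : k \in r2 -> row_of T k = 1%N by move=> kr; apply/eqP; rewrite -R2 inE kr orbT.
    have : row_of T i != row_of T j by apply: contraNneq ij => r; apply/eqP/(row_col_inj r cij).
    case/orP: (mem i ix) => /[dup] irr ->; case/orP: (mem j jx) => /[dup] jrr -> //=.
    - by rewrite (r0 _ irr) (r0 _ jrr).
    - by rewrite orbT.
    - by rewrite (r1' _ irr) (r1' _ jrr).
  case/orP => ijs; have [iE jE] := in_entries _ _ ijs.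
    by rewrite minor3_tpermD // bidet_tperm // mulrN.
  by rewrite tpermC minor3_tpermD // bidet_tperm // mulrN.
- have [sx|sx] := boolP (s x3 \in [:: x1; x2; x3]); last by rewrite minor3_eq0 // mul0r.
  have lt2 j : j != s x3 -> (row_of T (s^-1%g j) < 2)%N.
    move=> jx; have := row_of_lt T (s^-1%g j); rewrite laE /= ltnS leq_eqVlt => /orP[|//].
    by rewrite -R3 => /eqP e3; rewrite -e3 permKV eqxx in jx.
  have [ix|ix] := boolP (i \in [:: x1; x2; x3]); last first.
    rewrite (@bidet_vanish _ _ _ _ _ _ i) ?mulr0 // => [j js|].
      apply: lt2; apply: contraL sx => /eqP <-; apply: notx; by rewrite mem_cat js.
    by have := all_in i; rewrite (negbTE ix).
  rewrite (_ : minor3 _ _ _ _ _ = 0) ?mul0r //.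
  have ci0 : col_of T i = 0%N by apply/eqP; rewrite -colx.
  have nx j : j \in [:: x1; x2; x3] -> row_of T (s^-1%g j) <> row_of T i.
    by rewrite colx => /eqP j0; apply: none; rewrite ci0.
  have n1 := nx x1 _; have n2 := nx x2 _; have n3 := nx x3 _.
  rewrite !inE !eqxx ?orbT in n1 n2 n3; have {}n1 := n1 isT; have {}n2 := n2 isT; have {}n3 := n3 isT.
  move: (ix); rewrite !inE => /or3P[] /eqP ei; rewrite ei ?rowx1 ?rowx2 ?rowx3 in n1 n2 n3.
  + by rewrite /minor3 !inE; move/eqP/negbTE: n1 => ->; move/eqP/negbTE: n2 => ->;
      move/eqP/negbTE: n3 => ->; rewrite subrr !mulr0.
  + have E x : row_of T (s^-1%g x) <> 1%N -> x != s x3 -> x \in first_row T s.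
      by move=> x1' /lt2; rewrite inE; case: (row_of T _) x1' => [|[|]].
    move: ux; rewrite /= !inE negb_or andbT => /andP[/andP[x12 x13] x23].
    move: sx; rewrite !inE => /or3P[] /eqP es; rewrite es ?tr ?tp ?tq !E ?subrr ?es //.
    * by rewrite eq_sym.
    * by rewrite eq_sym.
    * by rewrite eq_sym.
  + by case: (nx (s x3) sx); rewrite permK ei rowx3.
Qed.
End ThreeRows.

Section Transport.
Variable n : nat.
Implicit Types (s t : 'S_n) (ps : seq ('I_n * 'I_n)) (os : seq 'I_n).

Lemma perm_of_enums (r r' : seq 'I_n) :
    perm_eq r (enum [set: 'I_n]) -> perm_eq r' (enum [set: 'I_n]) ->
  exists t : 'S_n, map t r = r'.
Proof.
move=> e e'; have sz : size r = size r' by rewrite (perm_size e) (perm_size e').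
have u : uniq r by rewrite (perm_uniq e) enum_uniq.
have u' : uniq r' by rewrite (perm_uniq e') enum_uniq.
have mem x : x \in r by rewrite (perm_mem e) mem_enum inE.
have ix x : (index x r < size r')%N by rewrite -sz index_mem.
pose f x := nth x r' (index x r).
have fI : injective f.
  move=> x y; rewrite /f (set_nth_default x) // => /eqP.
  by rewrite nth_uniq // => /eqP /(congr1 (nth x r)); rewrite !nth_index.
exists (perm fI); case: r sz u mem ix @f fI {e} => [|x0 r]; first by case: r' {e' u'}.
set r0 := x0 :: r => sz u mem ix f fI.
apply: (@eq_from_nth _ x0); rewrite size_map // => i ir.
by rewrite (nth_map x0) // permE /f index_uniq //; apply: set_nth_default; rewrite -sz.
Qed.

Lemma zip_pairs (ps : seq ('I_n * 'I_n)) t ps' :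
  unzip1 ps' = map t (unzip1 ps) -> unzip2 ps' = map t (unzip2 ps) -> ps' = map_pairs t ps.
Proof.
move=> e1 e2; rewrite -[LHS]zip_unzip e1 e2 {e1 e2}.
by elim: ps => //= -[p q] ps ->.
Qed.

Lemma cat_inj (X : eqType) (r1 r2 r1' r2' : seq X) :
  size r1 = size r2 -> r1 ++ r1' = r2 ++ r2' -> r1 = r2 /\ r1' = r2'.
Proof. by move=> sz /eqP; rewrite eqseq_cat // => /andP[/eqP -> /eqP ->]. Qed.

Lemma map_entries t ps os ps' os' : size ps = size ps' ->
  map t (entries ps ++ os) = entries ps' ++ os' -> ps' = map_pairs t ps /\ os' = map t os.
Proof.
move=> sz; rewrite /entries !map_cat => /cat_inj[|e12 e3].
  by rewrite !size_cat !size_map sz.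
by have [|e1 e2] := cat_inj _ e12; [rewrite !size_map | split; first exact: zip_pairs].
Qed.
End Transport.

Section Generation.
Variables (n : nat) (la : intpart n) (T : tableau la).
Local Notation gen := (col_sym T * row_sym T).

(** All bideterminants of the same shape are translates of the one of T. *)
Lemma bidet_comb2_ideal b ps0 os0 s : fills2 [set: 'I_n] b (ps0, os0) ->
    (forall u, gen u = bidet ps0 os0 [::] (first_row T u)) ->
    all (fun e => fills2 [set: 'I_n] b e.2) s ->
  exists c : ZS n, forall u, (c * gen) u = bidet_comb2 s (first_row T u).
Proof.
move=> v0 genE.
elim: s => [_|[k [ps os]] s IHs /= /andP[v /IHs[c cE]]].
  by exists 0 => u; rewrite mul0r /bidet_comb2 big_nil ffunE.
have [/andP[/= /eqP sz0 e0] /andP[/= /eqP sz e]] := (v0, v).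
have [t tE] := perm_of_enums e0 e.
have [-> ->] := map_entries (etrans sz0 (esym sz)) tE.
exists (zs_perm t *~ k + c) => u; rewrite mulrDl ffunE cE /bidet_comb2 big_cons /=.
congr (_ + _); rewrite mulrzAl ffunMzE zs_perm_mulE genE first_rowM invgK.
by rewrite -(@bidet_map _ _ _ _ [::]) -mulrzr intz mulrC.
Qed.

Lemma bidet_comb3_ideal b x3 d0 s : fills3 [set: 'I_n] b d0 ->
    (forall u, gen u = bidet3 d0 [::] (u x3) (first_row T u)) ->
    all (fun e => fills3 [set: 'I_n] b e.2) s ->
  exists c : ZS n, forall u, (c * gen) u = bidet_comb3 s (u x3) (first_row T u).
Proof.
case: d0 => [[[p0 q0] r0] [ps0 os0]] v0 genE.
elim: s => [_|[k [[[p q] r] [ps os]]] s IHs /= /andP[v /IHs[c cE]]].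
  by exists 0 => u; rewrite mul0r /bidet_comb3 big_nil ffunE.
have [/andP[/= /eqP sz0 e0] /andP[/= /eqP sz e]] := (v0, v).
have [t] := perm_of_enums e0 e; rewrite /entries3 /= => -[tp tq tr tE].
have [|-> ->] := map_entries _ tE; first by apply: succn_inj; rewrite sz0.
exists (zs_perm t *~ k + c) => u; rewrite mulrDl ffunE cE /bidet_comb3 big_cons /=.
congr (_ + _); rewrite mulrzAl ffunMzE zs_perm_mulE genE first_rowM invgK.
by rewrite /bidet3 /= -tp -tq -tr minor3_map permM -(@bidet_map _ _ _ _ [::]) -mulrzr intz mulrC.
Qed.

Lemma mem_first_row1 x : (x \in first_row T 1) = (row_of T x == 0%N).
Proof. by rewrite inE invg1 perm1. Qed.

Lemma first_rowE s x : (x \in first_row T s) = (s^-1%g x \in first_row T 1).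
Proof. by rewrite mem_first_row1 inE. Qed.

Lemma card_first_row s : #|first_row T s| = row_len la 0.
Proof.
have -> : first_row T s = s^-1%g @^-1: first_row T 1.
  by apply/setP => x; rewrite [RHS]inE first_rowE.
rewrite card_preimset; last exact: perm_inj.
have -> : row_len la 0 = size (nth [::] T 0) by rewrite /row_len -(shape_tableau T) nth_shape.
rewrite -(card_uniqP (uniq_row T 0)); apply: eq_card => x.
rewrite mem_first_row1; apply/eqP/idP => [<-|]; [exact: mem_row | exact: row_ofE].
Qed.

Lemma first_row_surj (B : {set 'I_n}) : #|B| = row_len la 0 ->
  exists s : 'S_n, first_row T s = B.
Proof.
rewrite -(card_first_row 1) => BR.
have enumC (D : {set 'I_n}) : perm_eq (enum D ++ enum (~: D)) (enum [set: 'I_n]).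
  apply: uniq_perm => [||x]; [|by rewrite enum_uniq|].
    rewrite cat_uniq !enum_uniq andbT; apply/hasPn => x.
    by rewrite !mem_enum inE.
  by rewrite mem_cat !mem_enum !inE orbN.
have [s] := perm_of_enums (enumC (first_row T 1)) (enumC B).
rewrite map_cat => /cat_inj[|e _]; first by rewrite size_map -!cardE.
exists s; apply/setP => x; rewrite first_rowE -[x \in B]mem_enum -e.
by rewrite -{2}(permKV s x) (mem_map (@perm_inj _ s)) mem_enum.
Qed.

Lemma first_row_surj2 x (B : {set 'I_n}) j : x \notin first_row T 1 -> j \notin B ->
  #|B| = row_len la 0 -> exists s : 'S_n, first_row T s = B /\ s x = j.
Proof.
move=> xR jB /first_row_surj[s sB].
exists (s * tperm (s x) j)%g; rewrite permM tpermL; split=> //.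
rewrite first_rowM sB tpermV; apply/setP => y; rewrite inE.
have sxB : s x \notin B by rewrite -sB first_rowE permK.
by case: tpermP => [->|->|//]; rewrite (negbTE sxB) (negbTE jB).
Qed.
End Generation.

(** * The variable that comes first *)

Section Starts.
Variable n : nat.
Implicit Types (s t : 'S_n) (c d : ZS n) (j x : 'I_n) (A J : {set 'I_n}).

Definition starts s j A : bool := [forall a in A, (s^-1%g j < s^-1%g a)%N].

Definition aug c : int := \sum_s c s.

(** The coefficient sum of the words in which x_j precedes the variables of A. In
    the value of a combination of words at generic triangular matrices, write the
    second diagonal entries as first ones minus differences: up to a sign that
    depends on #|A| only, this is the coefficient of the product of the corner entry
    of x_j, the differences for A, and the first diagonal entries elsewhere. With
    the letters 3, 1 and 2 for these three kinds of factors, [starting c] becomes a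
    function on words with one letter 3. *)
Definition starting c j A : int := \sum_s c s * (starts s j A)%:R.

Lemma augD c d : aug (c + d) = aug c + aug d.
Proof. by rewrite /aug -big_split; apply: eq_bigr => s _; rewrite ffunE. Qed.

Lemma augMz c (k : int) : aug (c *~ k) = aug c * k.
Proof.
by rewrite /aug big_distrl; apply: eq_bigr => s _; rewrite ffunMzE -mulrzr intz.
Qed.

Lemma aug_perm t : aug (zs_perm t) = 1.
Proof.
rewrite /aug (bigD1 t) //= ffunE eqxx big1 ?addr0 // => s /negbTE st.
by rewrite ffunE st.
Qed.

Lemma aug_act t c : aug (zs_perm t * c) = aug c.
Proof.
rewrite /aug [RHS](reindex_inj (mulIg t^-1%g)) /=.
by apply: eq_bigr => s _; rewrite zs_perm_mulE.
Qed.

Lemma startingD c d j A : starting (c + d) j A = starting c j A + starting d j A.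
Proof. by rewrite /starting -big_split; apply: eq_bigr => s _; rewrite ffunE mulrDl. Qed.

Lemma startingMz c (k : int) j A : starting (c *~ k) j A = starting c j A * k.
Proof.
rewrite /starting big_distrl; apply: eq_bigr => s _ /=.
by rewrite ffunMzE -mulrzr intz mulrAC.
Qed.

Lemma starting0 j A : starting 0 j A = 0.
Proof. by apply: big1 => s _; rewrite ffunE mul0r. Qed.

Lemma starting_perm t j A : starting (zs_perm t) j A = (starts t j A)%:R.
Proof.
rewrite /starting (bigD1 t) //= ffunE eqxx mul1r big1 ?addr0 // => s /negbTE st.
by rewrite ffunE st mul0r.
Qed.

Lemma starts_mem s j A : j \in A -> starts s j A = false.
Proof. by move=> jA; apply/negbTE/forall_inPn; exists j; rewrite ?ltnn. Qed.

Lemma starting_mem c j A : j \in A -> starting c j A = 0.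
Proof. by move=> jA; apply: big1 => s _; rewrite starts_mem // mulr0. Qed.

Lemma starting_set0 c j : starting c j set0 = aug c.
Proof.
apply: eq_bigr => s _; rewrite (_ : starts _ _ _) ?mulr1 //.
by apply/forall_inP => a; rewrite inE.
Qed.

Lemma startsM s t j A : starts (s * t)%g j A = starts s (t^-1%g j) (t @^-1: A).
Proof.
apply/forall_inP/forall_inP => H a aA.
  by have := H (t a); rewrite invMg !permM permK; apply; rewrite inE in aA.
by rewrite invMg !permM; apply: H; rewrite inE permKV.
Qed.

Lemma starting_act t c j A :
  starting (zs_perm t * c) j A = starting c (t^-1%g j) (t @^-1: A).
Proof.
rewrite /starting (reindex_inj (mulIg t)) /=.
by apply: eq_bigr => s _; rewrite zs_perm_mulE mulgK startsM.
Qed.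

(** In every word exactly one of the variables of J comes first. For [aug c = 0]
    this says that the operator 3 -> 1 kills [starting c]. *)
Lemma starting_cycle c J : J != set0 -> \sum_(j in J) starting c j (J :\ j) = aug c.
Proof.
case/set0Pn => j0 j0J; rewrite exchange_big /=; apply: eq_bigr => s _.
rewrite -big_distrr /=; case: (arg_minnP (fun j => nat_of_ord (s^-1%g j)) j0J) => j jJ jmin.
rewrite (bigD1 j) //= big1 ?addr0 => [|i /andP[iJ ij]].
  rewrite (_ : starts _ _ _) ?mulr1 //; apply/forall_inP => a; rewrite !inE => /andP[aj aJ].
  rewrite ltn_neqAle (jmin a aJ) andbT; apply: contra aj => /eqP/val_inj/perm_inj <-.
  exact: eqxx.
apply/eqP; rewrite pnatr_eq0 eqb0; apply/forall_inPn; exists j; first by rewrite !inE eq_sym ij.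
by rewrite -leqNgt jmin.
Qed.

(** The order r of the variables as a permutation; the default value only serves
    lists r that do not enumerate 'I_n. *)
Definition list_perm (r : seq 'I_n) : 'S_n :=
  odflt 1%g [pick s : 'S_n | [forall x, nat_of_ord (s^-1%g x) == index x r]].

Lemma list_permE r x : perm_eq r (enum [set: 'I_n]) ->
  (list_perm r)^-1%g x = index x r :> nat.
Proof.
move=> e; rewrite /list_perm; case: pickP => [s /forallP/(_ x)/eqP //|none].
have mem y : y \in r by rewrite (perm_mem e) mem_enum inE.
have lt y : (index y r < n)%N.
  have : (index y r < size r)%N by rewrite index_mem.
  by rewrite (perm_size e) -cardE cardsT card_ord.
have fI : injective (fun y => Ordinal (lt y)).
  by move=> y z [] /(congr1 (nth y r)); rewrite !nth_index.
by have /forallP[] := none (perm fI)^-1%g; move=> y; rewrite invgK permE.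
Qed.

(** The variables outside J come first, in an order that does not depend on j. *)
Definition front_order J j := list_perm (enum (~: J) ++ j :: enum (J :\ j)).

Lemma front_orderE J j x : j \in J ->
  (front_order J j)^-1%g x = index x (enum (~: J) ++ j :: enum (J :\ j)) :> nat.
Proof.
move=> jJ; apply: list_permE; apply: uniq_perm => [||y]; [|by rewrite enum_uniq|].
  rewrite cat_uniq !enum_uniq cons_uniq enum_uniq mem_enum [j \in _ :\ _]inE in_set1 eqxx !andbT.
  apply/hasPn => y; rewrite inE !mem_enum !inE negbK => /orP[/eqP ->|/andP[_ ->]] //.
by rewrite mem_cat inE !mem_enum !inE; case: eqP => [->|_]; rewrite ?orbT //; case: (y \in J).
Qed.

Lemma starts_front_out J j j' A x : j \in J -> x \in j' |: A -> x \notin J ->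
  starts (front_order J j) j' A
    = (j' \notin J) && [forall a in A, (a \notin J) ==> (index j' (enum (~: J)) < index a (enum (~: J)))%N].
Proof.
move=> jJ xA xJ.
have memC y : (y \in enum (~: J)) = (y \notin J) by rewrite mem_enum inE.
have [j'J|j'J] /= := boolP (j' \in J).
  have xA' : x \in A by move: xA; rewrite !inE => /orP[/eqP e|//]; rewrite e j'J in xJ.
  apply/negbTE/forall_inPn; exists x => //; rewrite !front_orderE // !index_cat !memC xJ j'J /=.
  by rewrite -leqNgt (leq_trans (index_size _ _)) // leq_addr.
apply/forall_inP/forall_inP => H a aA; have := H a aA; rewrite !front_orderE // !index_cat !memC j'J.
  by case: (boolP (a \in J)).
case: (boolP (a \in J)) => //= aJ _.
by rewrite (@leq_trans (size (enum (~: J)))) ?leq_addr // index_mem memC.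
Qed.

Lemma starts_front_in J j j' : j \in J -> j' \in J ->
  starts (front_order J j) j' (J :\ j') = (j' == j).
Proof.
move=> jJ j'J.
have memC y : (y \in enum (~: J)) = (y \notin J) by rewrite mem_enum inE.
have [->|j'j] := eqVneq j' j.
  apply/forall_inP => a; rewrite !inE => /andP[aj aJ].
  by rewrite !front_orderE // !index_cat !memC aJ jJ /= eqxx eq_sym (negbTE aj) ltn_add2l.
apply/negbTE/forall_inPn; exists j; first by rewrite !inE eq_sym j'j.
by rewrite !front_orderE // !index_cat !memC jJ j'J /= eqxx -leqNgt addn0 leq_addr.
Qed.

Lemma aug_sum (X : Type) (r : seq X) P (F : X -> ZS n) :
  aug (\sum_(i <- r | P i) F i) = \sum_(i <- r | P i) aug (F i).
Proof.
elim/big_rec2: _ => [|i y x _ <-]; last exact: augD.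
by apply: big1 => s _; rewrite ffunE.
Qed.

Lemma starting_sum (X : Type) (r : seq X) P (F : X -> ZS n) j A :
  starting (\sum_(i <- r | P i) F i) j A = \sum_(i <- r | P i) starting (F i) j A.
Proof. by elim/big_rec2: _ => [|i y x _ <-]; [exact: starting0 | exact: startingD]. Qed.

(** By induction on the size of the sets at which v does not vanish. At the top
    size, v is matched by the words [front_order J j] with coefficients
    v j (J :\ j): a set of at least the size of J and different from J meets the
    complement of J, where the first variable does not depend on j, so that the
    terms of J cancel there by the cycle condition. *)
Lemma starting_surj (v : 'I_n -> {set 'I_n} -> int) :
    (forall j A, j \in A -> v j A = 0) ->
    (forall J, \sum_(j in J) v j (J :\ j) = 0) ->
  exists c, aug c = 0 /\ forall j A, starting c j A = v j A.
Proof.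
move=> vmem vcyc; have : forall j A, (n < #|A|)%N -> v j A = 0.
  by move=> j A; have := max_card (mem A); rewrite card_ord leqNgt => /negbTE ->.
move: n.+1 => d; elim: d v vmem vcyc => [|d IHd] v vmem vcyc vd.
  by exists 0; split=> [|j A]; [apply: big1 => s _; rewrite ffunE | rewrite starting0 vd].
pose c0 : ZS n := \sum_(J : {set 'I_n} | #|J| == d.+1)
  \sum_(j in J) zs_perm (front_order J j) *~ v j (J :\ j).
have c0aug : aug c0 = 0.
  rewrite aug_sum big1 // => J _; rewrite aug_sum -[RHS](vcyc J).
  by apply: eq_bigr => j _; rewrite augMz aug_perm mul1r.
have c0E j A : j \notin A -> (d <= #|A|)%N -> starting c0 j A = v j A.
  move=> jA dA; rewrite starting_sum.
  have out J : #|J| == d.+1 -> J != j |: A ->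
      starting (\sum_(i in J) zs_perm (front_order J i) *~ v i (J :\ i)) j A = 0.
    move=> Jd JA; have [x xA xJ] : exists2 x, x \in j |: A & x \notin J.
      apply/subsetPn; apply: contra JA => sub.
      by rewrite eq_sym eqEcard sub cardsU1 jA (eqP Jd) ltnS.
    rewrite starting_sum; set b := (j \notin J) && [forall a in A,
      (a \notin J) ==> (index j (enum (~: J)) < index a (enum (~: J)))%N].
    transitivity (b%:R * \sum_(i in J) v i (J :\ i)); last by rewrite vcyc mulr0.
    rewrite big_distrr; apply: eq_bigr => i iJ /=.
    by rewrite startingMz starting_perm (starts_front_out iJ xA xJ).
  have [Ad|Ad] := eqVneq #|A| d; last first.
    rewrite vd; last by rewrite ltn_neqAle eq_sym Ad.
    apply: big1 => J Jd; apply: out => //; apply: contraNneq Ad => JE.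
    by move: Jd; rewrite JE cardsU1 jA.
  rewrite (bigD1 (j |: A)) /=; last by rewrite cardsU1 jA Ad.
  rewrite [X in _ + X]big1 ?addr0 => [|J /andP[Jd JA]]; last exact: out.
  have AE : (j |: A) :\ j = A by rewrite setU1K.
  have sf i : i \in j |: A -> starts (front_order (j |: A) i) j A = (j == i).
    by move=> iJ; have := starts_front_in iJ (setU11 j A); rewrite AE.
  rewrite starting_sum (bigD1 j) ?setU11 //= startingMz starting_perm.
  rewrite sf ?setU11 // eqxx mul1r AE big1 ?addr0 // => i /andP[iJ ij].
  by rewrite startingMz starting_perm sf // eq_sym (negbTE ij) mul0r.
have [|||c [caug cE]] := IHd (fun j A => v j A - starting c0 j A).
- by move=> j A jA; rewrite vmem // starting_mem // subrr.
- move=> J; rewrite sumrB vcyc; have [->|J0] := eqVneq J set0; first by rewrite big_set0 subr0.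
  by rewrite starting_cycle // c0aug subr0.
- move=> j A dA; have [jA|jA] := boolP (j \in A); first by rewrite vmem // starting_mem // subrr.
  by rewrite c0E // subrr.
exists (c0 + c); split=> [|j A]; first by rewrite augD c0aug caug addr0.
by rewrite startingD cE addrC subrK.
Qed.
End Starts.

(** * Multilinear identities of triangular matrices *)

Section Coefficients.
Variable n : nat.
Implicit Types (s t : 'S_n) (f g : multilin n) (c : ZS n).

Definition word s : seq nat := [seq val (s i) | i <- index_enum 'I_n].

(** This identifies the multilinear polynomials with the regular module. *)
Definition coefs f : ZS n := [ffun s => mcoeff (FMonom (word s)) (val f)].

Lemma word_inj : injective word.
Proof.
move=> s t /eq_in_map e; apply/permP => i; apply: val_inj; apply: e.
exact: mem_index_enum.
Qed.

Lemma prod_ZvarE (s : {perm 'I_n}) : \prod_(i < n) Zvar (s i) = << FMonom (word s) >>.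
Proof. by rewrite -Zvar_prodE /word big_map. Qed.

Lemma coefs_unique f (c : 'S_n -> int) :
  val f = \sum_(s : 'S_n) (\prod_(i < n) Zvar (s i)) *~ c s -> coefs f =1 c.
Proof.
move=> fE s; rewrite ffunE fE raddf_sum /= (bigD1 s) //= [X in _ + X]big1 => [|t ts].
  by rewrite raddfMz /= prod_ZvarE mcoeffUU intz addr0.
rewrite raddfMz /= prod_ZvarE mcoeffU; case: eqP => [[/word_inj e]|_]; last by rewrite mul0rz.
by rewrite e eqxx in ts.
Qed.

Lemma coefsE f : val f = \sum_(s : 'S_n) (\prod_(i < n) Zvar (s i)) *~ coefs f s.
Proof.
case/asboolP: (valP f) => c fE; rewrite {1}fE.
by apply: eq_bigr => s _; rewrite (coefs_unique fE).
Qed.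

Lemma coefs_surj c : exists f, coefs f = c.
Proof.
have fP : \sum_(s : 'S_n) (\prod_(i < n) Zvar (s i)) *~ c s \in @multilin_pred n.
  by apply/asboolP; exists (fun s => c s).
by pose f : multilin n := @exist Zfree1 (fun h => h \in multilin_pred n) _ fP; exists f; apply/ffunP; apply: coefs_unique.
Qed.

Lemma coefsD f g : coefs (f + g) = coefs f + coefs g.
Proof. by apply/ffunP => s; rewrite !ffunE /= raddfD. Qed.

Lemma coefsMz f (k : int) : coefs (f *~ k) = coefs f *~ k.
Proof.
apply/ffunP; apply: coefs_unique; rewrite raddfMz /= [X in X *~ k]coefsE mulrz_suml.
by apply: eq_bigr => s _; rewrite ffunMzE mulrzz mulrzA.
Qed.

Lemma coefs0 : coefs 0 = 0.
Proof. by apply/ffunP => s; rewrite !ffunE /= mcoeff0. Qed.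

Lemma coefs_act s f : coefs (multilin_act s f) = zs_perm s * coefs f.
Proof.
apply/ffunP; apply: coefs_unique; rewrite /= [X in perm_poly s X]coefsE /perm_poly raddf_sum /=.
rewrite [RHS](reindex_inj (mulIg s)) /=; apply: eq_bigr => t _.
by rewrite raddfMz /= -/(perm_poly _ _) perm_poly_monomial zs_perm_mulE mulgK.
Qed.

Lemma zs_sumE c : c = \sum_s zs_perm s *~ c s.
Proof.
apply/ffunP => t; rewrite sum_ffunE (bigD1 t) //= big1 => [|s st].
  by rewrite ffunMzE ffunE eqxx intz addr0.
by rewrite ffunMzE ffunE eq_sym (negbTE st) mul0rz.
Qed.

Lemma coefsZ c f : coefs (c *: f) = c * coefs f.
Proof.
rewrite -[c *: f]/(\sum_s multilin_act s f *~ c s) {2}(zs_sumE c) mulr_suml.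
elim/big_rec2: _ => [|s g d _ <-]; first exact: coefs0.
by rewrite coefsD coefsMz coefs_act mulrzAl.
Qed.

Lemma Zeval_coefs (R : pzRingType) (a : nat -> R) f :
  Zeval a (val f) = \sum_(s : 'S_n) (\prod_(i < n) a (s i)) *~ coefs f s.
Proof.
rewrite coefsE raddf_sum /=; apply: eq_bigr => s _; rewrite raddfMz /=; congr (_ *~ _).
have := @Zeval_monomial R a (word s); rewrite /word !big_map; exact.
Qed.

Lemma multilin_free f : (0 < n)%N -> val f \in Zfree.
Proof.
move=> n0; rewrite inE coefsE raddf_sum big1 //= => s _.
rewrite raddfMz /= prod_ZvarE mcoeffU; case: eqP => [|_]; last by rewrite mul0rz.
move/(congr1 (@fmonom_val _)); rewrite fm1 /= => /(congr1 size).
by rewrite size_map => /size0nil e; have := mem_index_enum (Ordinal n0); rewrite e.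
Qed.
End Coefficients.

Section Exponents.

(** Such a P is an ideal, generated by its least positive element if there is one. *)
Lemma min_or_zeroP (P : nat -> Prop) :
    P 0%N -> (forall a b, P a -> P b -> P (a %% b)%N) -> (forall a b, P a -> P (b * a)%N) ->
  forall k, P k <-> (min_or_zero P %| k)%N.
Proof.
move=> P0 Pmod Pmul k; rewrite /min_or_zero; case: pselect => [exP|none].
  case: ex_minnP => m /andP[m0 /asboolP Pm] mmin; split=> [Pk|/dvdnP[q ->]]; last exact: Pmul.
  rewrite /dvdn; apply: contraT; rewrite -lt0n => km.
  have := mmin (k %% m)%N; rewrite km leqNgt ltn_mod m0 => /(_ _) H.
  by apply: H; apply/asboolP/Pmod.
rewrite dvd0n; split=> [Pk|/eqP -> //]; apply: contraT; rewrite -lt0n => k0.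
by case: none; exists k; rewrite k0; apply/asboolP.
Qed.

Lemma mulrn_modn (V : zmodType) (x : V) a b : x *+ a = 0 -> x *+ b = 0 -> x *+ (a %% b) = 0.
Proof.
move=> xa xb; have := xa; rewrite {1}(divn_eq a b) mulrnDr mulnC mulrnA xb mul0rn add0r.
exact.
Qed.

Lemma mulrz_abs (V : zmodType) (x : V) (k : int) : (x *~ k == 0) = (x *+ `|k|%N == 0).
Proof.
case: k => k; first by rewrite -pmulrn.
by rewrite NegzE mulrNz oppr_eq0 abszN -pmulrn.
Qed.

Variables (R1 R2 : comPzRingType) (M : bimodType R1 R2).

Lemma ring_exponentP (k : int) :
  ((forall a : R1, a *~ k = 0) /\ (forall b : R2, b *~ k = 0))
    <-> ((ring_exponent R1 R2)%:Z %| k)%Z.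
Proof.
rewrite dvdzE /= -min_or_zeroP.
- split=> -[H1 H2]; split=> a; apply/eqP; first [rewrite -mulrz_abs | rewrite mulrz_abs];
    by apply/eqP; (apply: H1 || apply: H2).
- by split=> a; rewrite mulr0n.
- by move=> a b [a1 a2] [b1 b2]; split=> x; apply: mulrn_modn.
- by move=> a b [a1 a2]; split=> x; rewrite mulnC mulrnA (a1, a2) mul0rn.
Qed.

Lemma bimod_exponentP (k : int) :
  (forall x : M, x *~ k = 0) <-> ((bimod_exponent M)%:Z %| k)%Z.
Proof.
rewrite dvdzE /= -min_or_zeroP.
- split=> H a; apply/eqP; first [rewrite -mulrz_abs | rewrite mulrz_abs];
    by apply/eqP; apply: H.
- by move=> x; rewrite mulr0n.
- by move=> a b ? ? x; apply: mulrn_modn.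
- by move=> a b H x; rewrite mulnC mulrnA H mul0rn.
Qed.

(** The number 1 of R1 acts on M as the identity. *)
Lemma bimod_dvd_ring : (bimod_exponent M %| ring_exponent R1 R2)%N.
Proof.
have /bimod_exponentP : forall x : M, x *~ (ring_exponent R1 R2)%:Z = 0.
  move=> x; have [H _] := (ring_exponentP (ring_exponent R1 R2)%:Z).2 (dvdzz _).
  by rewrite -[x]scale1r -pmulrn scalerMnl pmulrn H scale0r.
by rewrite dvdzE.
Qed.
End Exponents.

Section Evaluation.
Variables (R1 R2 : comPzRingType) (M : bimodType R1 R2).
Local Notation U := (utri M).
Implicit Types (e : U).

Lemma utri_sum (X : Type) (r : seq X) (P : pred X) (F : X -> U) :
  \sum_(i <- r | P i) F i = (\sum_(i <- r | P i) (F i).1.1, \sum_(i <- r | P i) (F i).1.2,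
     \sum_(i <- r | P i) (F i).2) :> U.
Proof.
elim: r => [|i r IHr]; first by rewrite !big_nil.
by rewrite !big_cons IHr; case: (P i) => //; case: (F i) => -[].
Qed.

Lemma utri_mulz e (k : int) : e *~ k = (e.1.1 *~ k, e.1.2 *~ k, e.2 *~ k) :> U.
Proof.
have N m : e *+ m = (e.1.1 *+ m, e.1.2 *+ m, e.2 *+ m) :> U.
  by elim: m => [//|m IHm]; rewrite !mulrS IHm; case: e {IHm} => -[].
by case: k => k; rewrite ?NegzE ?mulrNz -?pmulrn N.
Qed.

Lemma utri_prodE n (a : 'I_n -> R1) (x : 'I_n -> M) (b : 'I_n -> R2) :
  \prod_(i < n) ((a i, x i, b i) : U) =
   (\prod_(i < n) a i,
    \sum_(k < n) (\prod_(i < n | (i < k)%N) a i) *: rscale (x k) (\prod_(i < n | (k < i)%N) b i),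
    \prod_(i < n) b i).
Proof.
elim: n a x b => [|n IHn] a x b; first by rewrite !big_ord0.
rewrite !big_ord_recl IHn [LHS]/GRing.mul /= addrC; congr (_, _, _); congr (_ + _).
  rewrite [X in X *: _]big_pred0 // scale1r; congr (rscale _ _).
  by rewrite [RHS]big_mkcond big_ord_recl /= mul1r.
rewrite scaler_sumr; apply: eq_bigr => k _; rewrite scalerA.
congr (_ *: rscale _ _); first by rewrite [in RHS]big_mkcond big_ord_recl /= -big_mkcond.
by rewrite [RHS]big_mkcond big_ord_recl /= mul1r -big_mkcond.
Qed.

Definition after n (s : 'S_n) (j : 'I_n) : {set 'I_n} :=
  [set y | (s^-1%g j < s^-1%g y)%N].

Lemma startsE n (s : 'S_n) j A : starts s j A = (A \subset after s j).
Proof. by apply/forall_inP/subsetP => H a /H; rewrite inE. Qed.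

Lemma utri_prod_perm n (a : 'I_n -> R1) (x : 'I_n -> M) (b : 'I_n -> R2) (s : 'S_n) :
  \prod_(i < n) ((a (s i), x (s i), b (s i)) : U) =
   (\prod_i a i,
    \sum_j (\prod_(i | i \notin j |: after s j) a i)
       *: rscale (x j) (\prod_(i in after s j) b i),
    \prod_i b i).
Proof.
rewrite utri_prodE; congr (_, _, _).
- by rewrite [RHS](reindex_inj (@perm_inj _ s)).
- rewrite [RHS](reindex_inj (@perm_inj _ s)) /=; apply: eq_bigr => k _.
  congr (_ *: rscale _ _); rewrite [RHS](reindex_inj (@perm_inj _ s)) /=; apply: eq_bigl => i.
    by rewrite !inE !permK negb_or (inj_eq perm_inj) -leqNgt ltn_neqAle.
  by rewrite inE !permK.
- by rewrite [RHS](reindex_inj (@perm_inj _ s)).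
Qed.

Variable n : nat.
Hypothesis n_gt0 : (0 < n)%N.

Definition extend (e : 'I_n -> U) (i : nat) : U := if insub i is Some j then e j else 0.

Lemma Zeval_ord (e : 'I_n -> U) (f : multilin n) :
  Zeval (extend e) (val f) = \sum_(s : 'S_n) (\prod_(i < n) e (s i)) *~ coefs f s.
Proof.
rewrite Zeval_coefs; apply: eq_bigr => s _; congr (_ *~ _).
by apply: eq_bigr => i _; rewrite /extend valK.
Qed.

Lemma IdP (f : multilin n) : reflect (forall e : 'I_n -> U,
    \sum_(s : 'S_n) (\prod_(i < n) e (s i)) *~ coefs f s = 0) (f \in @multilin_Id n U).
Proof.
have -> : (f \in @multilin_Id n U)
    = (val f \in Zfree) && `[< forall a : nat -> U, Zeval a (val f) = 0 >] by [].
rewrite multilin_free //=.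
apply: (iffP (asboolP _)) => H e; first by rewrite -Zeval_ord.
by rewrite Zeval_coefs; apply: (H (fun i => e i)).
Qed.

Implicit Types (A C : {set 'I_n}) (j : 'I_n) (c : ZS n).

Definition exact_after c j C : int := \sum_s c s * (after s j == C)%:R.

Lemma starting_exact c j A :
  starting c j A = \sum_(C : {set 'I_n} | A \subset C) exact_after c j C.
Proof.
rewrite exchange_big; apply: eq_bigr => s _ /=; rewrite -big_distrr startsE; congr (_ * _).
rewrite big_mkcond (bigD1 (after s j)) //= eqxx big1 ?addr0 => [|C /negbTE].
  by case: (_ \subset _).
by rewrite eq_sym => ->; rewrite if_same.
Qed.

(** Moebius inversion, by descending induction on C. *)
Lemma exact_after_dvd (m : int) c j :
    (forall A, j \notin A -> (m %| starting c j A)%Z) ->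
  forall C, (m %| exact_after c j C)%Z.
Proof.
move=> H C; elim: {C}_.+1 {-2}C (ltnSn (n - #|C|)) => // d IHd C Cd.
have [jC|jC] := boolP (j \in C).
  rewrite /exact_after big1 ?dvdz0 // => s _; case: eqP => [e|]; last by rewrite mulr0.
  by move: jC; rewrite -e inE ltnn.
have := starting_exact c j C; rewrite (bigD1 C) //= => /eqP; rewrite -subr_eq => /eqP <-.
rewrite rpredB ?H // rpred_sum // => X /andP[CX XC]; apply: IHd.
have : (#|C| < #|X|)%N by rewrite proper_card // properEneq eq_sym XC.
by have := subset_leq_card (subsetT X); rewrite cardsT card_ord; lia.
Qed.

(** To isolate [starting c j A], put a corner matrix for x_j, the idempotent of the
    second diagonal entry for the variables of A, and 1 for the others: a word
    survives if and only if x_j precedes A. In the other direction, the corner entry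
    of any value is a combination of the numbers [exact_after c j C]. *)
Lemma multilin_IdP (f : multilin n) : f \in @multilin_Id n U <->
  ((ring_exponent R1 R2)%:Z %| aug (coefs f))%Z /\
  forall j A, ((bimod_exponent M)%:Z %| starting (coefs f) j A)%Z.
Proof.
set c := coefs f.
split=> [/IdP H|[Hl Hm]].
  split.
    have := H (fun=> 1); under eq_bigr do rewrite big1 //.
    rewrite -mulrz_sumr -/(aug c) utri_mulz => -[c1 _ c2].
    have {}c1 : (1 : R1) *~ aug c = 0 := c1; have {}c2 : (1 : R2) *~ aug c = 0 := c2.
    apply/ring_exponentP; split=> a; first by rewrite -[a]mulr1 -mulrzAr c1 mulr0.
    by rewrite -[a]mulr1 -mulrzAr c2 mulr0.
  move=> j A; have [jA|jA] := boolP (j \in A); first by rewrite starting_mem // dvdz0.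
  apply/bimod_exponentP => x.
  (* x_j -> x e_12, the variables of A -> e_22, the others -> 1. *)
  pose a i : R1 := if i \in j |: A then 0 else 1.
  pose b i : R2 := if i == j then 0 else 1.
  pose y i : M := if i == j then x else 0.
  have := H (fun i => (a i, y i, b i)); under eq_bigr do rewrite utri_prod_perm utri_mulz.
  rewrite utri_sum => -[_ + _] /=.
  suff E s : \sum_i (\prod_(k | k \notin i |: after s i) a k)
       *: rscale (y i) (\prod_(k in after s i) b k) = x *+ starts s j A.
    move=> <-; rewrite /starting mulrz_sumr; apply: eq_bigr => s _.
    by rewrite E mulrC mulrzA natz -pmulrn.
  rewrite (bigD1 j) //= [X in _ + X]big1 ?addr0 => [|i /negbTE ij]; last by rewrite /y ij rscale0l scaler0.
  rewrite [\prod_(k in _) _]big1 => [|k]; last first.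
    by rewrite inE /b; case: eqP => // ->; rewrite ltnn.
  rewrite rscale1 /y eqxx startsE; have [sub|/subsetPn[z zA zs]] := boolP (A \subset after s j).
    rewrite big1 ?scale1r // => k; rewrite !inE negb_or => /andP[kj ks].
    rewrite /a !inE (negbTE kj) /=; case: ifP => // /(subsetP sub); by rewrite inE (negbTE ks).
  rewrite (bigD1 z) /=; first by rewrite /a !inE zA orbT mul0r scale0r.
  by rewrite in_setU1 negb_or zs andbT; apply: contraNneq jA => <-.
apply/IdP => e; pose a i := (e i).1.1; pose x i := (e i).1.2; pose b i := (e i).2.
have eE i : e i = (a i, x i, b i) by rewrite /a /x /b; case: (e i) => -[].
under eq_bigr => s _.
  under eq_bigr => i _ do rewrite eE.
  rewrite utri_prod_perm utri_mulz; over.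
rewrite utri_sum /= -!mulrz_sumr -/(aug c).
have [/(_ _)Hl1 Hl2] := (ring_exponentP _ _ _).2 Hl.
rewrite Hl1 Hl2; congr (_, _, _).
pose F j (C : {set 'I_n}) := (\prod_(i | i \notin j |: C) a i) *: rscale (x j) (\prod_(i in C) b i).
transitivity (\sum_j \sum_(C : {set 'I_n}) F j C *~ exact_after c j C).
  under eq_bigr do rewrite mulrz_suml.
  rewrite exchange_big; apply: eq_bigr => j _ /=.
  under [RHS]eq_bigr do rewrite mulrz_sumr.
  rewrite [RHS]exchange_big; apply: eq_bigr => s _ /=.
  rewrite (bigD1 (after s j)) //= eqxx mulr1 [X in _ + X]big1 ?addr0 // => C /negbTE.
  by rewrite eq_sym => ->; rewrite mulr0.
apply: big1 => j _; apply: big1 => C _.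
by apply: (bimod_exponentP _ _).2; apply: exact_after_dvd => A _; apply: Hm.
Qed.
End Evaluation.

(** * Chains of submodules and their factors *)

Section Factors.
Local Open Scope quotient_scope.
Variables (R : pzRingType) (V : lmodType R).

Definition submod (L : V -> Prop) : Prop :=
  L 0 /\ forall a u v, L u -> L v -> L (a *: u + v).

Lemma submodClosed_of (L : V -> Prop) : submod L ->
  exists N : submodClosed V, forall v, v \in N <-> L v.
Proof.
move=> [L0 Ll]; pose P : {pred V} := [pred v | `[< L v >]].
have PP : submod_closed P.
  split=> [|a u v /asboolP Lu /asboolP Lv]; first exact/asboolP.
  exact/asboolP/Ll.
pose N : submodClosed V := HB.pack P (GRing.isSubmodClosed.Build R V P PP).
by exists N => v; split=> [/asboolP|] // Lv; apply/asboolP.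
Qed.

Implicit Types (L : V -> Prop) (K : submodClosed V).

Lemma submodB L : submod L -> forall u v, L u -> L v -> L (u - v).
Proof. by move=> [_ Ll] u v Lu Lv; rewrite addrC -scaleN1r; apply: Ll. Qed.

Lemma submodZ L : submod L -> forall c u, L u -> L (c *: u).
Proof. by move=> [L0 Ll] c u Lu; rewrite -[c *: u]addr0; apply: Ll. Qed.

Definition pi_quot (K : submodClosed V) (v : V) : quotmod K :=
  \pi_(Quotient.quot (submod_pred K)) v.

Lemma pi_quot_linear (K : submodClosed V) : linear (pi_quot K).
Proof. by move=> a u v; rewrite /pi_quot quotpiD -quotpiZ. Qed.

Lemma pi_quotE (K : submodClosed V) u v : pi_quot K u = pi_quot K v <-> u - v \in K.
Proof.
rewrite (_ : (u - v \in K) = (u - v \in submod_pred K)) // Quotient.idealrBE.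
by split=> [/eqP|/eqP].
Qed.

Lemma pi_quot_eq0 (K : submodClosed V) v : pi_quot K v = 0 <-> v \in K.
Proof.
have p0 : pi_quot K 0 = 0.
  have := pi_quot_linear K 0 0 0; rewrite scale0r addr0 scale0r add0r => e.
  by have := pi_quot_linear K (-1) 0 0; rewrite scaler0 addr0 scaleN1r addNr.
by rewrite -p0 pi_quotE subr0.
Qed.

Lemma pi_quot_surj (K : submodClosed V) q : exists v, q = pi_quot K v.
Proof. by have [v ->] := quotpi_surj q; exists v. Qed.

End Factors.

Lemma isomorphic_of (R : pzRingType) (U V : lmodType R) (f : U -> V) :
  linear f -> injective f -> (forall y, exists x, f x = y) -> isomorphic U V.
Proof.
move=> fL fI fS; pose F : {linear U -> V} := HB.pack f (GRing.isLinear.Build R U V _ f fL).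
exists F; pose g y := projT1 (cid (fS y)).
have fg : cancel g F by move=> y; apply: (projT2 (cid (fS y))).
by exists g => // x; apply: fI; apply: fg.
Qed.

Section Iso.
Variables (R : pzRingType) (V : lmodType R).

(** A linear relation G takes the place of a map from N1 to S, as the maps in use
    are defined on representatives and not on elements of V. The last condition
    makes G a well-defined map whose kernel is N0. *)
Lemma factor_isomorphic (N1 N0 : submodClosed V) (S : lmodType R) (G : V -> S -> Prop) :
    (forall a u s v t, G u s -> G v t -> G (a *: u + v) (a *: s + t)) ->
    (forall v, v \in N1 -> exists s, G v s) ->
    (forall s, exists2 v, v \in N1 & G v s) ->
    (forall v s, v \in N1 -> G v s -> s = 0 <-> v \in N0) ->
  isomorphic (factor N1 N0) S.
Proof.
move=> Glin Gtot Gsurj G0.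
have Gfun v s t : v \in N1 -> G v s -> G v t -> s = t.
  move=> vN Gs Gt; have := Glin (-1) _ _ _ _ Gs Gt; rewrite !scaleN1r !addNr => G0'.
  have /(G0 _ _ (rpred0 _) G0') : (0 : V) \in N0 by exact: rpred0.
  by rewrite addrC => /subr0_eq.
pose g (x : submod_type N1) : S := projT1 (cid (Gtot (val x) (valP x))).
have gP x : G (val x) (g x) by exact: (projT2 (cid (Gtot (val x) (valP x)))).
have gE x s : G (val x) s -> g x = s by move=> Gs; apply: Gfun (gP x) Gs; apply: valP.
have gL : linear g.
  move=> a x y; apply: gE; rewrite [val _](_ : _ = a *: val x + val y); first exact: Glin.
  by [].
have g0 x : g x = 0 <-> val x \in N0 by apply: G0 (gP x); apply: valP.
have gB x y : g (x - y) = g x - g y.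
  by rewrite addrC -[- y]scaleN1r gL scaleN1r addrC.
pose K : submodClosed (submod_type N1) := @trace_pred _ _ N1 N0.
have gpi x y : pi_quot K x = pi_quot K y <-> g x = g y.
  rewrite pi_quotE; split=> [xy|/eqP]; last first.
    by rewrite -subr_eq0 -gB => /eqP/g0.
  by apply/eqP; rewrite -subr_eq0 -gB; apply/eqP/g0.
pose h (q : factor N1 N0) : S := g (projT1 (cid (pi_quot_surj q))).
have hE x : h (pi_quot K x) = g x.
  by apply/gpi; rewrite -(projT2 (cid (pi_quot_surj (pi_quot K x)))).
apply: (@isomorphic_of _ _ _ h).
- move=> a q q'; have [x ->] := pi_quot_surj q; have [y ->] := pi_quot_surj q'.
  by rewrite -pi_quot_linear !hE gL.
- move=> q q'; have [x ->] := pi_quot_surj q; have [y ->] := pi_quot_surj q'.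
  by rewrite !hE => /gpi.
- move=> s; have [v vN Gs] := Gsurj s.
  by exists (pi_quot K (exist _ v vN)); rewrite hE; apply: gE.
Qed.

Definition chain_upto (N : V -> Prop) (fs : seq (lmodType R)) : Prop :=
  exists Ns : nat -> submodClosed V,
    [/\ Ns 0%N =i pred1 0,
        forall v, v \in Ns (size fs) <-> N v &
        forall i, (i < size fs)%N ->
          {subset Ns i <= Ns i.+1}
          /\ isomorphic (factor (Ns i.+1) (Ns i)) (nth V fs i)].

Lemma chain_upto0 : chain_upto (fun v => v = 0) [::].
Proof.
have [|N NE] := @submodClosed_of _ V (fun v => v = 0).
  by split=> // a u v -> ->; rewrite scaler0 addr0.
exists (fun=> N); split=> // v; rewrite !inE.
by apply/idP/eqP => /NE.
Qed.

Lemma chain_upto_ext N N' fs : (forall v, N v <-> N' v) -> chain_upto N fs -> chain_upto N' fs.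
Proof. by move=> NN' [Ns [N0 NE st]]; exists Ns; split=> // v; rewrite NE. Qed.

Lemma chain_upto_rcons N N' fs (S : lmodType R) (G : V -> S -> Prop) :
    chain_upto N fs -> submod N' -> (forall v, N v -> N' v) ->
    (forall a u s v t, G u s -> G v t -> G (a *: u + v) (a *: s + t)) ->
    (forall v, N' v -> exists s, G v s) ->
    (forall s, exists2 v, N' v & G v s) ->
    (forall v s, N' v -> G v s -> s = 0 <-> N v) ->
  chain_upto N' (rcons fs S).
Proof.
move=> [Ns [Ns0 NE st]] /submodClosed_of[M ME] NN' Glin Gtot Gsurj G0.
pose Ms i := if (i <= size fs)%N then Ns i else M.
exists Ms; rewrite size_rcons /Ms ltnn; split=> //.
move=> i; rewrite ltnS leq_eqVlt => /orP[/eqP ->|ilt]; last first.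
  rewrite ilt orbT nth_rcons ilt; exact: st.
rewrite eqxx ltnn nth_rcons ltnn eqxx; split.
  by move=> v /NE/NN' Nv; apply/ME.
apply: (factor_isomorphic Glin) => [v /ME|s|v s /ME Nv Gs]; first exact: Gtot.
  by have [v Nv Gs] := Gsurj s; exists v => //; apply/ME.
by rewrite (G0 v s) // NE.
Qed.

Lemma has_chain_of fs : chain_upto (fun=> True) fs -> has_chain V fs.
Proof.
move=> [Ns [N0 NE st]]; exists Ns; split=> // v; rewrite !inE.
by apply/NE.
Qed.

End Iso.

Section Quotient.
Variables (R : pzRingType) (P : lmodType R) (K : submodClosed P).
Implicit Types (L : P -> Prop).

Definition im (L : P -> Prop) : quotmod K -> Prop := fun q => exists2 p, L p & q = pi_quot K p.

Lemma im_submod L : submod L -> submod (im L).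
Proof.
move=> [L0 Ll]; split; first by exists 0 => //; apply/esym/pi_quot_eq0/rpred0.
move=> a _ _ [u Lu ->] [v Lv ->]; exists (a *: u + v); first exact: Ll.
by rewrite pi_quot_linear.
Qed.

(** The map phi identifies L1 / L0 with the left ideal of x. By the last two
    hypotheses, K meets L1 in the multiples of m up to elements of L0, so that the
    images of L0 and L1 modulo K have the ideal modulo m as their factor. *)
Lemma chain_upto_im_rcons L0 L1 fs (x : R) (m : nat) (phi : P -> R) :
    chain_upto (im L0) fs -> submod L0 -> submod L1 -> (forall p, L0 p -> L1 p) ->
    (forall a p q, phi (a *: p + q) = a * phi p + phi q) ->
    (forall p, L1 p -> exists c, phi p = c * x) ->
    (exists2 p, L1 p & phi p = x) ->
    (forall p, L1 p -> phi p = 0 <-> L0 p) ->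
    (forall p, L1 p -> p *+ m \in K) ->
    (forall p, L1 p -> p \in K -> exists w u, [/\ L1 w, L0 u & p = w *+ m + u]) ->
  chain_upto (im L1) (rcons fs (mod_multiples (left_ideal x) m)).
Proof.
move=> ch L0s L1s L01 phiL phiI [px Lpx phix] phi0 mK KL.
have phi_0 : phi 0 = 0 by apply/(phi0 _ L1s.1); apply: L0s.1.
have phiD p1 p2 : phi (p1 + p2) = phi p1 + phi p2.
  by have := phiL 1 p1 p2; rewrite scale1r mul1r.
have phiZ c p : phi (c *: p) = c * phi p by rewrite -[c *: p]addr0 phiL phi_0 addr0.
have phiM p : phi (p *+ m) = phi p *+ m.
  by elim: m {mK KL} => [|k IHk]; rewrite ?mulr0n // !mulrS phiD IHk.
have lift (y : left_ideal x) : exists2 p, L1 p & phi p = val y.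
  have /asboolP[c ->] := valP y.
  by exists (c *: px); [apply: submodZ | rewrite phiZ phix].
have elt c : exists y : left_ideal x, val y = c * x.
  have yP : c * x \in left_ideal_pred x by apply/asboolP; exists c.
  by exists (@exist R^o (fun v => v \in (left_ideal_pred x : submodClosed R^o)) (c * x) yP).
pose S := left_ideal x.
pose N : submodClosed S := @multiples_pred R S m.
pose G (v : quotmod K) (s : mod_multiples S m) :=
  exists p (y : S), [/\ L1 p, v = pi_quot K p, phi p = val y & s = pi_quot N y].
apply: (@chain_upto_rcons _ _ _ _ _ _ G ch) => //.
- exact: im_submod.
- by move=> _ [p Lp ->]; exists p => //; apply: L01.
- move=> a _ _ _ _ [p [y [Lp -> py ->]]] [q [z [Lq -> qz ->]]].
  exists (a *: p + q), (a *: y + z); rewrite !pi_quot_linear phiL py qz; split=> //.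
  exact: L1s.2.
- move=> _ [p Lp ->]; have [c pc] := phiI p Lp; have [y yc] := elt c.
  by exists (pi_quot N y), p, y; split; rewrite ?yc.
- move=> s; have [y ->] := pi_quot_surj s; have [p Lp py] := lift y.
  by exists (pi_quot K p); [exists p | exists p, y].
- move=> v s _ [p [y [Lp -> py ->]]]; split.
    move/pi_quot_eq0/asboolP => [z yz]; have [q Lq qz] := lift z.
    have Lqm : L1 (q *+ m) by rewrite -scaler_nat; apply: submodZ.
    exists (p - q *+ m); last by apply/pi_quotE; rewrite opprB addrC subrK; apply: mK.
    apply/phi0; first by apply: submodB.
    rewrite phiD -scaleN1r phiZ mulN1r phiM qz py yz raddfMn subrr //.
  move=> [p0 Lp0 /pi_quotE pp0]; have Lp0' := L01 _ Lp0.
  have [|w [u [Lw Lu pE]]] := KL _ _ pp0; first by apply: submodB.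
  apply/pi_quot_eq0/asboolP.
  have [c wc] := phiI w Lw.
  have [z zc] := elt c.
  exists z; apply: val_inj; rewrite raddfMn /= zc -wc -phiM -py.
  rewrite -[p](subrK p0) pE !phiD (phi0 _ Lp0').2 // (phi0 _ (L01 _ Lu)).2 // !addr0.
  by [].
Qed.
End Quotient.

(** * A filtration of the multilinear polynomials *)

Section Levels.
Variable n : nat.
Implicit Types (s : 'S_n) (c d : ZS n) (j x : 'I_n) (A B J : {set 'I_n}).

(** The image of [starting c] under the operator 3 -> 2. *)
Definition starting_out c A : int := \sum_(j | j \notin A) starting c j A.

Lemma starting_outD c d A : starting_out (c + d) A = starting_out c A + starting_out d A.
Proof. by rewrite /starting_out -big_split; apply: eq_bigr => j _; rewrite startingD. Qed.

Lemma starting_outMz c (k : int) A : starting_out (c *~ k) A = starting_out c A * k.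
Proof. by rewrite /starting_out big_distrl; apply: eq_bigr => j _; rewrite startingMz. Qed.

Lemma starting_out_act s c A :
  starting_out (zs_perm s * c) A = starting_out c (s @^-1: A).
Proof.
rewrite /starting_out (reindex_inj (@perm_inj _ s)) /=; apply: eq_big => [j|j _].
  by rewrite inE.
by rewrite starting_act permK.
Qed.

Lemma subset_sum_preim l (v : {set 'I_n} -> int) s B :
  subset_sum l (fun A => v (s @^-1: A)) B = subset_sum l v (s @^-1: B).
Proof.
have preimK (t : 'S_n) A : t @^-1: (t^-1%g @^-1: A) = A by apply/setP => x; rewrite !inE permK.
rewrite /subset_sum (reindex_onto (fun A => s^-1%g @^-1: A) (fun A => s @^-1: A)) /=; last first.
  by move=> A _; apply/setP => x; rewrite !inE permKV.
apply: eq_big => [A|A _]; last by rewrite preimK.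
rewrite preimK eqxx andbT card_preimset; last exact: perm_inj.
congr (_ && _); apply/subsetP/subsetP => H x.
  by move=> xA; rewrite inE; apply: H; rewrite inE permK.
by rewrite inE => /H; rewrite inE permKV.
Qed.

(** The operators 3 -> 2 and 2 -> 1 commute up to the operator 3 -> 1, which kills
    [starting c] by [starting_cycle]. *)
Lemma subset_sum_starting_out l c B : aug c = 0 ->
  subset_sum l (starting_out c) B = \sum_(j | j \notin B) subset_sum l (starting c j) B.
Proof.
move=> c0.
have E A j : j \in A -> starting c j A = 0 by apply: starting_mem.
transitivity (\sum_j subset_sum l (starting c j) B).
  rewrite /subset_sum exchange_big; apply: eq_bigr => A _ /=.
  rewrite /starting_out [RHS](bigID (fun j => j \notin A)) /=.
  by rewrite [X in _ = _ + X]big1 ?addr0 // => j; rewrite negbK => /E.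
rewrite (bigID (fun j => j \notin B)) /= [X in _ + X](_ : _ = 0) ?addr0 //.
rewrite (eq_bigl (mem B)) => [|j]; last by rewrite negbK.
transitivity (\sum_(J : {set 'I_n} | (J \subset B) && (#|J| == l.+1))
    \sum_(j in J) starting c j (J :\ j)); last first.
  apply: big1 => J /andP[_ /eqP Jl]; rewrite starting_cycle //.
  by rewrite -card_gt0 Jl.
rewrite (exchange_big_dep (mem B)) /= => [|J j /andP[/subsetP JB _] /JB //].
apply: eq_bigr => j jB.
rewrite /subset_sum (bigID (fun A => j \in A)) /= big1 ?add0r => [|A /andP[_ /E] //].
rewrite (reindex_onto (fun J => J :\ j) (fun A => j |: A)) /=; last first.
  by move=> A /andP[_ jA]; rewrite setU1K.
apply: eq_bigl => J; rewrite !inE eqxx /= andbT.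
have [jJ|jJ] := boolP (j \in J).
  rewrite setD1K // eqxx !andbT (cardsD1 j J) jJ add1n eqSS.
  congr (_ && _); rewrite -{2}(setD1K jJ) subUset sub1set jB //.
rewrite andbF; apply/negbTE; rewrite negb_and orbC; apply/orP; left.
by apply: contra jJ => /eqP <-; rewrite setU11.
Qed.

(** The words in [starting c] have at most l letters 1, and the operator 2 -> 1 to
    the power t - l kills its part with l letters 1. *)
Definition level l t c : Prop :=
  [/\ aug c = 0, forall j A, (l < #|A|)%N -> starting c j A = 0 &
      forall j B, j \notin B -> #|B| = t -> subset_sum l (starting c j) B = 0].

(** The power t.+1 - l of the operator 2 -> 1 kills the part with l letters 1, and
    so does its power t - l followed by the operator 3 -> 2. *)
Definition sublevel l t c : Prop :=
  level l t.+1 c /\ forall B, #|B| = t -> subset_sum l (starting_out c) B = 0.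

(** Pure submodules of the regular module that contain the kernel of
    [aug] and [starting]; purity makes the reduction modulo m of a chain of such
    submodules exact. *)
Definition lattice (L : ZS n -> Prop) : Prop :=
  [/\ forall c, aug c = 0 -> (forall j A, starting c j A = 0) -> L c,
      forall c d, L c -> L d -> L (c + d),
      forall c k, L c -> L (c *~ k),
      forall s c, L c -> L (zs_perm s * c) &
      forall c (k : int), k != 0 -> L (c *~ k) -> L c].

Lemma level_lattice l t : lattice (level l t).
Proof.
split.
- by move=> c c0 cs; split=> // j B _ _; apply: subset_sum_eq0.
- move=> c d [c0 c1 c2] [d0 d1 d2]; split=> [|j A lA|j B jB Bt].
  + by rewrite augD c0 d0.
  + by rewrite startingD c1 // d1.
  + rewrite -[RHS](addr0 0) -{1}(c2 j B) // -(d2 j B) // -subset_sumD.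
    by apply: eq_subset_sum => A _ _; apply: startingD.
- move=> c k [c0 c1 c2]; split=> [|j A lA|j B jB Bt].
  + by rewrite augMz c0 mul0r.
  + by rewrite startingMz c1 // mul0r.
  + rewrite -[RHS](mulr0 k) -(c2 j B) // -subset_sumZ.
    by apply: eq_subset_sum => A _ _; rewrite startingMz mulrC.
- move=> s c [c0 c1 c2]; split=> [|j A lA|j B jB Bt].
  + by rewrite aug_act.
  + by rewrite starting_act c1 // card_preimset //; apply: perm_inj.
  + transitivity (subset_sum l (starting c (s^-1%g j)) (s @^-1: B)).
      by rewrite -subset_sum_preim; apply: eq_subset_sum => A _ _; apply: starting_act.
    by apply: c2; rewrite ?inE ?permKV ?card_preimset //; apply: perm_inj.
- move=> c k k0 [c0 c1 c2]; split=> [|j A lA|j B jB Bt].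
  + by apply/eqP; move/eqP: c0; rewrite augMz mulf_eq0 (negbTE k0) orbF.
  + by apply/eqP; move/eqP: (c1 j A lA); rewrite startingMz mulf_eq0 (negbTE k0) orbF.
  + apply: (mulfI k0); rewrite mulr0 -(c2 j B) // -subset_sumZ.
    by apply: eq_subset_sum => A _ _; rewrite startingMz mulrC.
Qed.

Lemma sublevel_lattice l t : lattice (sublevel l t).
Proof.
have [L0 LD LM La Lt] := level_lattice l t.+1; split.
- move=> c c0 cs; split; first exact: L0.
  by move=> B _; apply: subset_sum_eq0 => A _ _; apply: big1.
- move=> c d [c1 c2] [d1 d2]; split=> [|B Bt]; first exact: LD.
  rewrite -[RHS](addr0 0) -{1}(c2 B) // -(d2 B) // -subset_sumD.
  by apply: eq_subset_sum => A _ _; apply: starting_outD.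
- move=> c k [c1 c2]; split=> [|B Bt]; first exact: LM.
  rewrite -[RHS](mulr0 k) -(c2 B) // -subset_sumZ.
  by apply: eq_subset_sum => A _ _; rewrite starting_outMz mulrC.
- move=> s c [c1 c2]; split=> [|B Bt]; first exact: La.
  transitivity (subset_sum l (starting_out c) (s @^-1: B)).
    by rewrite -subset_sum_preim; apply: eq_subset_sum => A _ _; apply: starting_out_act.
  by apply: c2; rewrite card_preimset //; apply: perm_inj.
- move=> c k k0 [c1 c2]; split=> [|B Bt]; first exact: Lt c1.
  apply: (mulfI k0); rewrite mulr0 -(c2 B) // -subset_sumZ.
  by apply: eq_subset_sum => A _ _; rewrite starting_outMz mulrC.
Qed.

Lemma lattice_submod L : lattice L -> submod (fun p : multilin n => L (coefs p)).
Proof.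
move=> [L0 LD LM La _].
have L00 : L 0 by apply: L0 => [|j A]; [apply: big1 => s _; rewrite ffunE | apply: starting0].
split=> [|a u v Lu Lv]; first by rewrite coefs0.
rewrite coefsD coefsZ; apply: (LD) => //; rewrite (zs_sumE a) mulr_suml.
apply: (big_ind L) => [//|x y|s _]; first exact: LD.
by rewrite mulrzAl; apply/LM/La.
Qed.

Lemma zs_linear (phi : ZS n -> ZS n) :
    (forall c d, phi (c + d) = phi c + phi d) ->
    (forall c (k : int), phi (c *~ k) = phi c *~ k) ->
    (forall s c, phi (zs_perm s * c) = zs_perm s * phi c) ->
  forall a (p q : multilin n), phi (coefs (a *: p + q)) = a * phi (coefs p) + phi (coefs q).
Proof.
move=> phiD phiM phia a p q; rewrite coefsD phiD coefsZ; congr (_ + _).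
rewrite (zs_sumE a) !mulr_suml.
have phi0 : phi 0 = 0 by apply: (addrI (phi 0)); rewrite -phiD !addr0.
elim/big_rec2: _ => // s x y _ <-.
by rewrite phiD !mulrzAl phiM phia.
Qed.

Lemma level_up l t c j B : (l <= t)%N ->
    (forall B', B' \subset B -> #|B'| = t -> subset_sum l (starting c j) B' = 0) ->
  #|B| = t.+1 -> subset_sum l (starting c j) B = 0.
Proof.
move=> lt H Bt; have := subset_sum_subset_sum (starting c j) B lt.
rewrite subset_sum_eq0 // Bt subSn // => /esym/eqP; rewrite mulrn_eq0 -leqn0 leqNgt bin_gt0 leqnSn /=.
by move/eqP.
Qed.

Lemma level_sublevel l t c : (l <= t)%N -> level l t c -> sublevel l t c.
Proof.
move=> lt [c0 c1 c2].
have c3 j B : j \notin B -> #|B| = t.+1 -> subset_sum l (starting c j) B = 0.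
  move=> jB; apply: level_up => // B' B'B; apply: c2.
  by apply: contra jB => /(subsetP B'B).
split=> // B Bt; rewrite subset_sum_starting_out //; apply: big1 => j jB; exact: c2.
Qed.
End Levels.

Section Purity.
Variables (R1 R2 : comPzRingType) (M : bimodType R1 R2) (n : nat).
Hypothesis n_gt0 : (0 < n)%N.
Local Notation m := (bimod_exponent M).
Local Notation K := (@multilin_Id n (utri M)).
Implicit Types (p w u : multilin n).

Lemma mulrn_Id p : aug (coefs p) = 0 -> p *+ m \in K.
Proof.
move=> p0; apply/(multilin_IdP _ n_gt0); rewrite pmulrn coefsMz augMz p0 mul0r.
by split=> [|j A]; rewrite ?dvdz0 // startingMz dvdz_mull.
Qed.

(** Dividing [starting (coefs p)] by m gives a cycle, which comes from an element
    w by [starting_surj]; purity puts w into L. *)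
Lemma Id_aug0_lattice L p : lattice L -> aug (coefs p) = 0 -> L (coefs p) -> p \in K ->
  exists w u, [/\ L (coefs w), aug (coefs u) = 0 /\ (forall j A, starting (coefs u) j A = 0)
    & p = w *+ m + u].
Proof.
move=> Ll p0 Lp /(multilin_IdP _ n_gt0)[_ pm].
have [m0|m0] := eqVneq m 0%N.
  exists 0, p; rewrite m0 mulr0n add0r; split=> //.
    by case: Ll => L0 _ _ _ _; apply: L0 => [|j A]; rewrite coefs0; [apply: big1 => s _; rewrite ffunE | apply: starting0].
  by split=> // j A; apply/eqP; have := pm j A; rewrite m0 dvd0z.
have mz : m%:Z != 0 by [].
pose v j A := (starting (coefs p) j A %/ m%:Z)%Z.
have vE j A : v j A * m = starting (coefs p) j A by apply: divzK.
have [||c [c0 cE]] := @starting_surj n v.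
- by move=> j A jA; apply: (mulIf mz); rewrite vE starting_mem // mul0r.
- move=> J; have [->|J0] := eqVneq J set0; first by rewrite big_set0.
  apply: (mulIf mz); rewrite mul0r -[RHS]p0 -(starting_cycle _ J0) mulr_suml.
  by apply: eq_bigr => j _; apply: vE.
have [w wE] := coefs_surj c.
have sE : coefs p = c *~ m + coefs (p - w *+ m).
  by rewrite -wE -coefsMz -coefsD -pmulrn addrC subrK.
have u0 : aug (coefs (p - w *+ m)) = 0.
  by move: p0; rewrite sE augD augMz c0 mul0r add0r.
have us j A : starting (coefs (p - w *+ m)) j A = 0.
  have := startingD (c *~ m) (coefs (p - w *+ m)) j A.
  rewrite -sE startingMz cE vE -[LHS]addr0 => /addrI/esym; exact.
exists w, (p - w *+ m); split=> //; last by rewrite addrC subrK.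
case: Ll => L0 LD LM _ Lt; apply: (Lt _ m%:Z mz).
have -> : coefs w *~ m = coefs p + coefs (p - w *+ m) *~ (-1).
  by rewrite sE wE mulrN1z addrK.
by apply: (LD) => //; apply: (LM); apply: L0.
Qed.
End Purity.

(** * Factors of the filtration *)

Section Steps.
Variables (R1 R2 : comPzRingType) (M : bimodType R1 R2) (n : nat).
Hypothesis n_gt0 : (0 < n)%N.
Variable T : forall la : intpart n, tableau la.
Local Notation K := (@multilin_Id n (utri M)).
Local Notation imK L := (@im _ _ K (fun p => L (coefs p))).
Implicit Types (s : 'S_n) (c d : ZS n) (j x : 'I_n) (A B J : {set 'I_n}).

Lemma chain_step l t L0 L1 fs (la : intpart n) (phi : ZS n -> ZS n) :
    chain_upto (imK L0) fs -> lattice L0 -> lattice L1 ->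
    (forall c, L0 c -> L1 c) -> (forall c, L1 c -> level l t c) ->
    (forall c d, phi (c + d) = phi c + phi d) ->
    (forall c (k : int), phi (c *~ k) = phi c *~ k) ->
    (forall s c, phi (zs_perm s * c) = zs_perm s * phi c) ->
    (forall c, L1 c -> exists a, phi c = a * (col_sym (T la) * row_sym (T la))) ->
    (exists2 c, L1 c & phi c = col_sym (T la) * row_sym (T la)) ->
    (forall c, L1 c -> phi c = 0 <-> L0 c) ->
  chain_upto (imK L1) (rcons fs (chain_factor M T (Some la))).
Proof.
move=> ch L0l L1l L01 L1Y phiD phiM phia phiI [c0 Lc0 phic0] phi0.
have aug0 c : L1 c -> aug c = 0 by move/L1Y => [].
apply: (@chain_upto_im_rcons _ _ _ (fun p => L0 (coefs p)) (fun p => L1 (coefs p))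
  fs _ _ (fun p => phi (coefs p))) => //.
- exact: lattice_submod.
- exact: lattice_submod.
- by move=> p; apply: L01.
- exact: zs_linear.
- by move=> p; apply: phiI.
- by have [p pc] := coefs_surj c0; exists p; rewrite pc.
- by move=> p; apply: phi0.
- by move=> p /aug0; apply: mulrn_Id.
- move=> p Lp pK; have [w [u [Lw [u0 us] pE]]] := Id_aug0_lattice n_gt0 L1l (aug0 _ Lp) Lp pK.
  by exists w, u; split=> //; case: L0l => L00 _ _ _ _; apply: L00.
Qed.

(** The map is the divided power t - l of the operator 2 -> 1 on the part with l letters 1.
    On [sublevel l t] its values are killed by 2 -> 1 and by 3 -> 2, so that
    [kernel_three_rows] gives polytabloids. A polytabloid is reached from the same
    product with t - l of its isolated letters 1 turned into letters 2; the bound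
    n - t.+1 <= l says that there are as many isolated letters. *)
Lemma chain_sublevel l t fs (la : intpart n) : (l <= t)%N -> (t < n)%N -> (n - t.+1 <= l)%N ->
    la = [:: t; (n - t.+1)%N; 1%N] :> seq nat ->
    chain_upto (imK (level l t)) fs ->
  chain_upto (imK (sublevel l t)) (rcons fs (chain_factor M T (Some la))).
Proof.
move=> lt tn kl laE ch; set k := (n - t.+1)%N in kl laE.
have [x3 [[[[p q] r] [ps os]] [x3r dv genE]]] := polytabloid3 (T la) laE.
have cR s : #|first_row (T la) s| = t by rewrite card_first_row /row_len laE.
have x3R s : s x3 \notin first_row (T la) s.
  by rewrite first_rowE permK mem_first_row1 x3r.
pose phi c : ZS n := [ffun s : 'S_n => subset_sum l (starting c (s x3)) (first_row (T la) s)].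
apply: (@chain_step l t.+1 _ _ _ _ phi ch (level_lattice _ _ _) (sublevel_lattice _ _ _)).
- by move=> c; apply: level_sublevel.
- by move=> c [].
- move=> c d; apply/ffunP => s; rewrite !ffunE -subset_sumD.
  by apply: eq_subset_sum => A _ _; apply: startingD.
- move=> c a; apply/ffunP => s; rewrite ffunMzE !ffunE mulrzz mulrC -subset_sumZ.
  by apply: eq_subset_sum => A _ _; rewrite startingMz mulrC.
- move=> s c; apply/ffunP => u; rewrite zs_perm_mulE !ffunE permM first_rowM invgK -subset_sum_preim.
  by apply: eq_subset_sum => A _ _; apply: starting_act.
- move=> c [[c0 c1 c2] c3].
  have [|||s sv sE] := @kernel_three_rows _ [set: 'I_n] t k (fun j => subset_sum l (starting c j)).
  + by rewrite cardsT card_ord /k; lia.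
  + move=> j B _; rewrite subsetD1 => /andP[_ jB] Bt.
    by rewrite subset_sum_subset_sum // c2 // mul0rn.
  + move=> A _ At; rewrite -[RHS](c3 A At) subset_sum_starting_out //.
    by apply: eq_bigl => j; rewrite inE.
  have [a aE] := bidet_comb3_ideal dv genE sv; exists a; apply/ffunP => u.
  by rewrite aE ffunE sE ?inE ?cR // subsetD1 subsetT x3R.
- have nE : n = ((n - t.+1).*2.+1 + size os)%N.
    by have := fills3_size dv; rewrite cardsT card_ord.
  have := dv; rewrite /fills3 /= => /andP[/eqP psE e]; rewrite /entries3 /= in e.
  (* The t - l entries of os2 get the letter 2, so that l letters 1 are left. *)
  pose os1 := take (t + l + 1 - n) os; pose os2 := drop (t + l + 1 - n) os.
  have osE : os = os1 ++ os2 by rewrite cat_take_drop.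
  have os1E : size os1 = (t + l + 1 - n)%N by rewrite size_takel //; lia.
  have os2E : size os2 = (t - l)%N by rewrite size_drop; rewrite /k in nE kl; lia.
  rewrite osE in e; have {}e : perm_eq ([:: p; q; r] ++ entries ps ++ os1 ++ os2) (enum [set: 'I_n]) by [].
  have lE : l = ((size ps).+1 + size os1)%N by rewrite psE os1E /k; lia.
  have u : uniq ([:: p; q; r] ++ entries ps ++ os1 ++ os2) by rewrite (perm_uniq e) enum_uniq.
  pose d : filling3 (ordinal n) := ((p, q, r), (ps, os1)).
  pose v j A := (j \notin A)%:R * bidet3 d os2 j A.
  have vE j B A : j \notin B -> A \subset B -> v j A = bidet3 d os2 j A.
    by move=> jB AB; rewrite /v (contra (subsetP AB j) jB) mul1r.
  have [||c [c0 cE]] := @starting_surj n v.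
  + by move=> j A jA; rewrite /v jA mul0r.
  + move=> J; rewrite -[RHS](sum_minor3_cycle J u); apply: eq_bigr => j _.
    by rewrite /v !inE eqxx mul1r.
  have subset_sumE j B : j \notin B -> subset_sum l (starting c j) B = subset_sum l (bidet3 d os2 j) B.
    by move=> jB; apply: eq_subset_sum => A AB _; rewrite cE (vE j B).
  exists c.
    split; last first.
      move=> B Bt; apply: subset_sum_eq0 => A _ _; rewrite /starting_out.
      transitivity (\sum_(j | j \notin A) minor3 p q r j A * bidet ps os1 os2 A).
        by apply: eq_bigr => j jA; rewrite cE /v jA mul1r.
      by rewrite -big_distrl /= sum_minor3 mul0r.
    split=> // [j A lA|j B jB Bt].
      rewrite cE /v; have [jA|jA] := boolP (j \in A); first by rewrite mul0r.
      rewrite mul1r /bidet3 /=; have [t0|[a [b [tE e']]]] := minor3_cases e (in_setT j).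
        by rewrite t0 mul0r.
      rewrite tE -bidet_cons; apply/eqP; apply: contraTT lA => nz.
      rewrite -leqNgt lE (card_bidet e' _ nz) // subsetD1 subsetT //.
    rewrite subset_sumE // (subset_sum_bidet3_gt e) ?subsetD1 ?subsetT ?inE // -lE Bt os2E; lia.
  apply/ffunP => s; rewrite ffunE genE subset_sumE ?x3R // (subset_sum_bidet3_eq e) ?in_setT ?subsetD1
    ?subsetT ?x3R //; first by rewrite osE.
  by rewrite cR -lE os2E; lia.
- move=> c [[c0 c1 c2] c3]; split=> [cphi|[_ _ c4]].
    split=> // j B jB Bt.
    have x3R1 : x3 \notin first_row (T la) 1 by have := x3R 1%g; rewrite perm1.
    have [|s [sB sj]] := first_row_surj2 x3R1 jB; first by rewrite Bt /row_len laE.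
    by have := congr1 (fun f : ZS n => f s) cphi; rewrite !ffunE sB sj.
  by apply/ffunP => s; rewrite !ffunE c4.
Qed.

(** The map is the operator 3 -> 2, followed by the divided power t - l of the
    operator 2 -> 1, on the part with l letters 1. It leaves words in the letters 1 and 2, to
    which [kernel_two_rows] applies. A polytabloid is reached from the product in
    which t - l isolated letters 1 are turned into letters 2 and one minor
    1_p 2_q - 2_p 1_q is replaced by 1_p 3_q - 3_p 1_q. *)
Lemma chain_level_succ l t fs (la : intpart n) : (l <= t)%N -> (t < n)%N -> (n - t <= l)%N ->
    la = [:: t; (n - t)%N] :> seq nat ->
    chain_upto (imK (sublevel l t)) fs ->
  chain_upto (imK (level l t.+1)) (rcons fs (chain_factor M T (Some la))).
Proof.
move=> lt tn kl laE ch; set k := (n - t)%N in kl laE.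
have [ps0 [os [dv genE]]] := polytabloid2 (T la) laE.
have cR s : #|first_row (T la) s| = t by rewrite card_first_row /row_len laE.
pose phi c : ZS n := [ffun s : 'S_n => subset_sum l (starting_out c) (first_row (T la) s)].
apply: (@chain_step l t.+1 _ _ _ _ phi ch (sublevel_lattice _ _ _) (level_lattice _ _ _)).
- by move=> c [].
- by [].
- move=> c d; apply/ffunP => s; rewrite !ffunE -subset_sumD.
  by apply: eq_subset_sum => A _ _; apply: starting_outD.
- move=> c a; apply/ffunP => s; rewrite ffunMzE !ffunE mulrzz mulrC -subset_sumZ.
  by apply: eq_subset_sum => A _ _; rewrite starting_outMz mulrC.
- move=> s c; apply/ffunP => u; rewrite zs_perm_mulE !ffunE first_rowM invgK -subset_sum_preim.
  by apply: eq_subset_sum => A _ _; apply: starting_out_act.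
- move=> c [c0 c1 c2].
  have [||s sv sE] := @kernel_two_rows _ [set: 'I_n] t k (subset_sum l (starting_out c)).
  + by rewrite cardsT card_ord /k; lia.
  + move=> B _ Bt; rewrite subset_sum_subset_sum // subset_sum_starting_out // big1 ?mul0rn // => j jB.
    exact: c2.
  have [a aE] := bidet_comb2_ideal dv genE sv; exists a; apply/ffunP => u.
  by rewrite aE ffunE sE ?subsetT.
- have nE : n = ((n - t).*2 + size os)%N.
    by have := fills2_size dv; rewrite cardsT card_ord.
  have /andP[/= /eqP ps0E e0] := dv.
  case: ps0 ps0E e0 {dv} genE => [|[p q] ps] /= psE e0 genE; first by rewrite /k in psE; lia.
  (* The t - l entries of os2 get the letter 2, so that l letters 1 are left. *)
  pose os1 := take (t + l - n) os; pose os2 := drop (t + l - n) os.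
  have osE : os = os1 ++ os2 by rewrite cat_take_drop.
  have os1E : size os1 = (t + l - n)%N by rewrite size_takel //; lia.
  have os2E : size os2 = (t - l)%N by rewrite size_drop; rewrite /k in kl; lia.
  have {}psE : size ps = (n - t).-1 by rewrite -/k -psE.
  have {}e0 : perm_eq (entries ((p, q) :: ps) ++ os1 ++ os2) (enum [set: 'I_n]).
    by rewrite -osE.
  have e : perm_eq (p :: q :: entries ps ++ os1 ++ os2) (enum [set: 'I_n]).
    by rewrite (perm_trans _ e0) // perm_sym perm_entries_cons.
  have u : uniq (p :: q :: entries ps ++ os1 ++ os2) by rewrite (perm_uniq e) enum_uniq.
  move: u; rewrite /= inE negb_or => /andP[/andP[pq pn] /andP[qn _]].
  have lE : l = (size ps + (size os1).+1)%N by rewrite psE os1E; rewrite /k in kl; lia.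
  pose f A := ((p \in A)%:R - (q \in A)%:R) * bidet ps os1 os2 A.
  (* For j outside A, this is 1_p 3_q - 3_p 1_q times the other factors. *)
  pose v j A := (j \notin A)%:R * ((j == p)%:R + (j == q)%:R) * f A.
  have vcases j : (forall A, j \notin A -> v j A = 0) \/
      exists x (a : int), perm_eq (entries ps ++ (x :: os1) ++ os2) (enum ([set: 'I_n] :\ j))
        /\ forall A, j \notin A -> v j A = a * bidet ps (x :: os1) os2 A.
    have [->|jp] := eqVneq j p.
      right; exists q, (-1); split=> [|A pA].
        apply: perm_enum_rem => //; rewrite (perm_trans _ e) //.
        by apply/seq.permP => x /=; rewrite !count_cat /= ?count_cat; lia.
      by rewrite /v /f pA eqxx (negbTE pq) (negbTE pA) bidet_cons1 /= ?mulr1n ?mulr0n; ring.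
    have [->|jq] := eqVneq j q; last first.
      by left=> A _; rewrite /v (negbTE jp) (negbTE jq) addr0 mulr0 mul0r.
    right; exists p, 1; split=> [|A qA].
      apply: perm_enum_rem => //; rewrite (perm_trans _ e) //.
      by apply/seq.permP => x /=; rewrite !count_cat /= ?count_cat; lia.
    by rewrite /v /f qA eqxx eq_sym (negbTE pq) (negbTE qA) bidet_cons1 /= ?mulr1n ?mulr0n; ring.
  have [||c [c0 cE]] := @starting_surj n v.
  + by move=> j A jA; rewrite /v jA !mul0r.
  + move=> J; transitivity (\sum_(j in J) ((j == p)%:R * f (J :\ j) + (j == q)%:R * f (J :\ j))).
      by apply: eq_bigr => j jJ; rewrite /v !inE eqxx mul1r mulrDl.
    rewrite big_split /= !(sum_delta (mem J) _ (fun j => f (J :\ j))) /f !bidetD1 //.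
    rewrite !inE !eqxx pq (eq_sym q) pq /=.
    by case: (p \in J); case: (q \in J); rewrite /=; ring.
  have outE A : starting_out c A = bidet ((p, q) :: ps) os1 os2 A.
    rewrite /starting_out; under eq_bigr do rewrite cE.
    transitivity (\sum_(j | j \notin A) ((j == p)%:R * f A + (j == q)%:R * f A)).
      by apply: eq_bigr => j jA; rewrite /v jA mul1r mulrDl.
    rewrite big_split /= !(sum_delta (fun j => j \notin A) _ (fun=> f A)) bidet_cons /f.
    by case: (p \in A); case: (q \in A); rewrite /=; ring.
  exists c.
    split=> // [j A lA|j B jB Bt].
      have [jA|jA] := boolP (j \in A); first by rewrite starting_mem.
      rewrite cE; have [v0|[x [a [ej vE]]]] := vcases j; first exact: v0.
      rewrite vE //; apply/eqP; rewrite mulf_eq0; apply/orP; right; apply: contraTT lA => nz.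
      by rewrite -leqNgt lE (card_bidet ej _ nz) // subsetD1 subsetT.
    have AB A : A \subset B -> j \notin A by move=> AB; apply: contra jB => /(subsetP AB).
    have [v0|[x [a [ej vE]]]] := vcases j.
      by apply: subset_sum_eq0 => A /AB jA _; rewrite cE v0.
    transitivity (subset_sum l (fun A => a * bidet ps (x :: os1) os2 A) B).
      by apply: eq_subset_sum => A /AB jA _; rewrite cE vE.
    rewrite subset_sumZ (subset_sum_bidet_gt ej) ?mulr0 // ?subsetD1 ?subsetT //=.
    by rewrite -lE Bt os2E; lia.
  apply/ffunP => s; rewrite ffunE genE.
  transitivity (subset_sum l (bidet ((p, q) :: ps) os1 os2) (first_row (T la) s)).
    by apply: eq_subset_sum => A _ _; apply: outE.
  rewrite (subset_sum_bidet_eq e0) ?subsetT //=.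
  - by rewrite /bidet osE mulr1.
  - by rewrite {1}lE addnS.
  - by rewrite cR os2E addSnnS -lE; lia.
- move=> c [c0 c1 c2]; split=> [cphi|[_ c4]].
    split=> // B Bt; have [|s sB] := @first_row_surj _ _ (T la) B; first by rewrite Bt /row_len laE.
    by have := congr1 (fun g : ZS n => g s) cphi; rewrite !ffunE sB.
  by apply/ffunP => s; rewrite !ffunE c4.
Qed.

(** If there are too many letters 2, then [subset_sum_inj] applies at each position
    of the letter 3. If n = t.+1, then raising to t letters 1 leaves no letter 2, and
    the operator 3 -> 2 is injective on such words. *)
Lemma level_eq_sublevel l t c : (l <= t)%N -> (t < n)%N -> ~~ (0 < n - t.+1 <= l)%N ->
  level l t c <-> sublevel l t c.
Proof.
move=> lt tn no; split; first exact: level_sublevel.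
move=> [[c0 c1 c2] c3]; split=> // j B jB Bt.
have cD i : #|[set: 'I_n] :\ i| = n.-1.
  by have := cardsD1 i [set: 'I_n]; rewrite inE cardsT card_ord; lia.
have [nl|/eqP nt] : (l < n - t.+1)%N \/ (n == t.+1)%N.
  by lia.
  apply: subset_sum_eq0 => A AB Al; apply: (subset_sum_inj (t := t.+1) (D := [set: 'I_n] :\ j)) Al.
  - lia.
  - by rewrite cD; lia.
  - by move=> C; rewrite subsetD1 => /andP[_ jC]; apply: c2.
  - by rewrite (subset_trans AB) // subsetD1 subsetT.
have BE : B = [set: 'I_n] :\ j.
  by apply/eqP; rewrite eqEcard subsetD1 subsetT jB cD Bt; lia.
have := c3 B Bt; rewrite subset_sum_starting_out // (big_pred1 j) // => i /=.
by rewrite BE !inE andbT negbK.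
Qed.

(** After the operator 3 -> 2, there are too many letters 2 for the power of 2 -> 1
    not to be injective. *)
Lemma sublevel_eq_level l t c : (l <= t)%N -> (t < n)%N -> (l < n - t)%N ->
  sublevel l t c <-> level l t.+1 c.
Proof.
move=> lt tn no; split=> [[]//|[c0 c1 c2]]; split=> // B _.
apply: subset_sum_eq0 => A _ Al; apply: (subset_sum_inj (t := t.+1) (D := [set: 'I_n])) Al => //.
- lia.
- by rewrite cardsT card_ord; lia.
- move=> C _ Ct; rewrite subset_sum_starting_out // big1 // => j jC; exact: c2.
Qed.

Lemma card_notin j A : j \notin A -> (#|A| < n)%N.
Proof.
move=> jA; rewrite -[X in (_ < X)%N](card_ord n) -cardsT; apply: proper_card.
by rewrite properT; apply: contraNneq jA => ->; rewrite inE.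
Qed.

Lemma level_next l c : level l n c <-> level l.+1 l.+1 c.
Proof.
split=> -[c0 c1 c2]; split=> //.
- by move=> j A /ltnW; apply: c1.
- by move=> j B jB Bl; rewrite subset_sum_card //; apply: c1; rewrite Bl.
- move=> j A; rewrite leq_eqVlt => /orP[/eqP lA|]; last exact: c1.
  have [jA|jA] := boolP (j \in A); first exact: starting_mem.
  by rewrite -(c2 j A jA (esym lA)) subset_sum_card.
- by move=> j B /card_notin lt Bn; rewrite Bn ltnn in lt.
Qed.
End Steps.

(** * Multiplicities *)

Section Labels.
Variable n : nat.
Local Notation label := (option (intpart n)).

(** The shapes for the steps from [level l t] to [sublevel l t] and from there to
    [level l t.+1]; under the conditions they are partitions of n, so that no label
    [None] arises. *)
Definition cell_labels l t : seq label :=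
  (if (0 < n - t.+1 <= l)%N then [:: insub [:: t; (n - t.+1)%N; 1%N]] else [::])
  ++ (if (n - t <= l)%N then [:: insub [:: t; (n - t)%N]] else [::]).

Definition row_labels l : seq label := flatten [seq cell_labels l t | t <- index_iota l n].

Definition all_labels : seq label := rcons (flatten [seq row_labels l | l <- index_iota 1 n]) None.

Lemma insub3 l t : (l <= t)%N -> (t < n)%N -> (0 < n - t.+1 <= l)%N ->
  exists2 la : intpart n, insub [:: t; (n - t.+1)%N; 1%N] = Some la
    & la = [:: t; (n - t.+1)%N; 1%N] :> seq nat.
Proof.
move=> lt tn kl; have P : [&& sorted geq [:: t; (n - t.+1)%N; 1%N],
    all (ltn 0) [:: t; (n - t.+1)%N; 1%N] & sumn [:: t; (n - t.+1)%N; 1%N] == n].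
  by rewrite /=; lia.
by exists (IntPart P); rewrite ?insubT.
Qed.

Lemma insub2 l t : (0 < l)%N -> (l <= t)%N -> (t < n)%N -> (n - t <= l)%N ->
  exists2 la : intpart n, insub [:: t; (n - t)%N] = Some la & la = [:: t; (n - t)%N] :> seq nat.
Proof.
move=> l0 lt tn kl; have P : [&& sorted geq [:: t; (n - t)%N],
    all (ltn 0) [:: t; (n - t)%N] & sumn [:: t; (n - t)%N] == n].
  by rewrite /=; lia.
by exists (IntPart P); rewrite ?insubT.
Qed.

Lemma count_cell_None l t : (0 < l)%N -> (l <= t)%N -> (t < n)%N ->
  count_mem None (cell_labels l t) = 0%N.
Proof.
move=> l0 lt tn; rewrite /cell_labels count_cat.
case: ifP => [k3|_]; last case: ifP => [k2|_] //.
  have [la -> _] := insub3 lt tn k3; case: ifP => [k2|_] //=.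
  by have [mu -> _] := insub2 l0 lt tn k2.
by have [mu -> _] := insub2 l0 lt tn k2.
Qed.

Lemma count_cell_Some l t (la : intpart n) : (0 < l)%N -> (l <= t)%N -> (t < n)%N ->
  count_mem (Some la) (cell_labels l t) =
    ((((0 < n - t.+1 <= l) && (la == [:: t; n - t.+1; 1] :> seq nat)) : nat)
    + ((n - t <= l) && (la == [:: t; n - t] :> seq nat)))%N.
Proof.
move=> l0 lt tn; rewrite /cell_labels count_cat; congr (_ + _)%N.
  case: ifP => [k3|_] //=; have [mu -> muE] := insub3 lt tn k3.
  by rewrite addn0 (inj_eq Some_inj) -val_eqE /= muE eq_sym.
case: ifP => [k2|_] //=; have [mu -> muE] := insub2 l0 lt tn k2.
by rewrite addn0 (inj_eq Some_inj) -val_eqE /= muE eq_sym.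
Qed.

Lemma count_all lab : count_mem lab all_labels =
  (\sum_(1 <= l < n) \sum_(l <= t < n) count_mem lab (cell_labels l t) + (lab == None))%N.
Proof.
rewrite /all_labels -cats1 count_cat /= addn0 eq_sym; congr (_ + _)%N.
rewrite count_flatten sumnE !big_map; apply: eq_bigr => l _.
by rewrite /row_labels count_flatten sumnE !big_map.
Qed.

Lemma sum_mem r (Q : pred nat) : (\sum_(i <- r) Q i)%N = count Q r.
Proof. by rewrite -sum1_count [RHS]big_mkcond; apply: eq_bigr => i _; case: (Q i). Qed.

(** The partitions (a, b) and (a, b, 1) occur for t = a and b <= l <= a. *)
Lemma sum_cells a b : (0 < b)%N -> (b <= a)%N -> (a < n)%N ->
  (\sum_(1 <= l < n) \sum_(l <= t < n) ((b <= l) && (t == a)) = a - b + 1)%N.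
Proof.
move=> b0 ba an; transitivity (\sum_(1 <= l < n) ((b <= l <= a) : nat))%N.
  apply: eq_big_nat => l /andP[l0 ln]; case: (b <= l)%N => /=; last by rewrite big1.
  by rewrite (sum_mem _ (pred1 a)) count_uniq_mem ?iota_uniq // mem_index_iota an andbT.
rewrite (big_cat_nat (n := b)) //=; last by rewrite ltnW // (leq_ltn_trans ba).
rewrite (big_cat_nat (n := a.+1) (m := b)) //=; last by rewrite leqW.
rewrite big_nat big1 => [|l /andP[_ lb]]; last by rewrite leqNgt lb.
rewrite [X in (0 + (_ + X))%N]big_nat [X in (0 + (_ + X))%N]big1 => [|l /andP[al _]]; last first.
  by rewrite [(l <= a)%N]leqNgt al andbF.
rewrite big_nat (eq_bigr (fun=> 1%N)) => [|l /andP[bl la]]; last by rewrite bl -ltnS la.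
by rewrite -big_nat sum_nat_const_nat; lia.
Qed.

Lemma count_labels lab : (0 < n)%N -> count_mem lab all_labels = multiplicity lab.
Proof.
move=> n0; rewrite count_all; case: lab => [la|] /=; last first.
  rewrite big_nat big1 // => l /andP[l0 ln]; rewrite big_nat big1 // => t /andP[lt tn].
  exact: count_cell_None.
rewrite addn0.
rewrite (eq_big_nat _ _ (F2 := fun l => (\sum_(l <= t < n)
   ((((0 < n - t.+1 <= l) && (la == [:: t; n - t.+1; 1] :> seq nat)) : nat)
    + ((n - t <= l) && (la == [:: t; n - t] :> seq nat))))%N)); last first.
  move=> l /andP[l0 ln]; apply: eq_big_nat => t /andP[lt tn].
  exact: count_cell_Some.
have /and3P[so po /eqP su] : [&& sorted geq la, all (ltn 0) la & sumn la == n] by exact: valP la.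
rewrite /row_len; move: so po su.
case: (parts la) => [|a [|b [|c [|d r]]]] /= so po su.
- by rewrite -su in n0.
- by rewrite big_nat big1 // => l _; rewrite big1 // => t _; rewrite !eqseq_cons /= !andbF.
- have [b0 ba] : (0 < b)%N /\ (b <= a)%N by lia.
  rewrite b0 /= -sum_cells //; last by lia.
  apply: eq_big_nat => l /andP[l0 ln]; apply: eq_big_nat => t /andP[lt tn].
  rewrite !eqseq_cons /= ?andbF ?andbT ?add0n.
  congr nat_of_bool; apply/idP/idP; lia.
- have [b0 [ba c0]] : (0 < b)%N /\ (b <= a)%N /\ (0 < c)%N by lia.
  rewrite b0 /=; have [c1|c1] := ltnP 1 c.
    rewrite big_nat big1 // => l _; rewrite big1 // => t _.
    by rewrite !eqseq_cons; lia.
  rewrite /= -sum_cells //; last by lia.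
  apply: eq_big_nat => l /andP[l0 ln]; apply: eq_big_nat => t /andP[lt tn].
  rewrite !eqseq_cons /= ?andbF ?andbT ?addn0.
  by congr nat_of_bool; apply/idP/idP; lia.
- rewrite (_ : (_ == 0)%N = false) ?andbF; last by lia.
  rewrite big_nat big1 // => l _; rewrite big1 // => t _.
  by rewrite !eqseq_cons /= !andbF.
Qed.
End Labels.

Section Assembly.
Variables (R1 R2 : comPzRingType) (M : bimodType R1 R2) (n : nat).
Hypothesis n_gt0 : (0 < n)%N.
Variable T : forall la : intpart n, tableau la.
Local Notation K := (@multilin_Id n (utri M)).
Local Notation imK L := (@im _ _ K (fun p => L (coefs p))).
Implicit Types (s : 'S_n) (c d : ZS n) (j x : 'I_n) (A B J : {set 'I_n}).

Local Notation F := (chain_factor M T).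

Lemma chain_upto_im_ext L L' (fs : seq (lmodType (ZS n))) : (forall c, L c <-> L' c) ->
  chain_upto (imK L) fs -> chain_upto (imK L') fs.
Proof.
move=> LL; apply: chain_upto_ext => v; split=> -[p Lp ->]; exists p => //; exact/LL.
Qed.

Lemma chain_cell l t (labels : seq (option (intpart n))) :
    (0 < l)%N -> (l <= t)%N -> (t < n)%N ->
    chain_upto (imK (level l t)) (map F labels) ->
  chain_upto (imK (level l t.+1)) (map F (labels ++ cell_labels n l t)).
Proof.
move=> l0 lt tn ch; rewrite /cell_labels catA.
set labels3 := labels ++ _.
have {}ch : chain_upto (imK (sublevel l t)) (map F labels3).
  rewrite /labels3; case: ifP => [k3|/negbT k3]; last first.
    by rewrite cats0; apply: chain_upto_im_ext ch => c; apply: level_eq_sublevel.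
  have [la -> laE] := insub3 lt tn k3; rewrite cats1 map_rcons.
  by apply: chain_sublevel => //; case/andP: k3.
case: ifP => [k2|/negbT k2]; last first.
  by rewrite cats0; apply: chain_upto_im_ext ch => c; apply: sublevel_eq_level; rewrite // ltnNge.
have [la -> laE] := insub2 l0 lt tn k2; rewrite cats1 map_rcons.
exact: chain_level_succ.
Qed.

Lemma chain_row l (labels : seq (option (intpart n))) : (0 < l)%N -> (l < n)%N ->
    chain_upto (imK (level l l)) (map F labels) ->
  chain_upto (imK (level l.+1 l.+1)) (map F (labels ++ row_labels n l)).
Proof.
move=> l0 ln ch; apply: (chain_upto_im_ext (level_next l)).
suff row (d : nat) : (l + d <= n)%N ->
    chain_upto (imK (level l (l + d)))
      (map F (labels ++ flatten [seq cell_labels n l t | t <- index_iota l (l + d)])).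
  by have := row (n - l)%N; rewrite subnKC ?(ltnW ln) //; apply.
elim: d => [|d IHd] ld; first by rewrite addn0 /index_iota subnn /= cats0.
rewrite addnS in ld *.
have -> : index_iota l (l + d).+1 = index_iota l (l + d) ++ [:: (l + d)%N].
  by rewrite /index_iota subSn ?leq_addr // addKn -[d.+1]addn1 iotaD.
rewrite [X in flatten X]map_cat flatten_cat /= cats0 catA.
apply: chain_cell => //; first exact: leq_addr.
exact: IHd (ltnW ld).
Qed.

Lemma level_one c : level 1 1 c <-> aug c = 0 /\ forall j A, starting c j A = 0.
Proof.
split=> [[c0 c1 c2]|[c0 cs]]; last by case: (level_lattice n 1 1) => L0 _ _ _ _; apply: L0.
split=> // j A; have [jA|jA] := boolP (j \in A); first exact: starting_mem.
have [A0|A1|/eqP] := ltngtP #|A| 1%N; last 2 first.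
- exact: c1.
- by move=> /eqP A1; rewrite -(c2 j A jA A1) subset_sum_card.
by rewrite (cards0_eq (_ : #|A| = 0%N)) ?starting_set0 //; lia.
Qed.

Lemma level_last c : level n n c <-> aug c = 0.
Proof.
split=> [[]//|c0]; split=> // [j A|j B /card_notin lt Bn].
  by rewrite ltnNge -[X in (_ <= X)%N](card_ord n) max_card.
by rewrite Bn ltnn in lt.
Qed.

Lemma chain_rows (d : nat) : (d < n)%N ->
  chain_upto (imK (level d.+1 d.+1))
    (map F (flatten [seq row_labels n l | l <- index_iota 1 d.+1])).
Proof.
elim: d => [|d IHd] dn.
  apply: chain_upto_ext (@chain_upto0 _ _) => v; split=> [->|[p /level_one[p0 ps] ->]].
    have [L0 _] := lattice_submod (level_lattice n 1 1).
    by exists 0 => //; apply/esym/pi_quot_eq0/rpred0.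
  apply/pi_quot_eq0/(multilin_IdP _ n_gt0); rewrite p0 dvdz0; split=> // j A.
  by rewrite ps dvdz0.
have -> : index_iota 1 d.+2 = index_iota 1 d.+1 ++ [:: d.+1].
  by rewrite /index_iota !subSS !subn0 -[X in iota 1 X = _]addn1 iotaD add1n.
rewrite map_cat flatten_cat /= cats0; apply: chain_row => //; exact: IHd (ltnW dn).
Qed.

Lemma aug_linear c (p q : multilin n) :
  aug (coefs (c *: p + q)) = (c *: (aug (coefs p) : triv_int n) + aug (coefs q) : triv_int n).
Proof.
rewrite coefsD augD coefsZ; congr (_ + _).
rewrite {1}(zs_sumE c) mulr_suml aug_sum; apply: eq_bigr => s _.
by rewrite mulrzAl augMz aug_act mulrzz.
Qed.

(** Above all levels there is the quotient by the elements with [aug c = 0], on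
    which [aug] takes values modulo the exponent of the two rings. *)
Lemma chain_full : chain_upto (fun _ : Pn_mod_Id n (utri M) => True) (map F (all_labels n)).
Proof.
rewrite /all_labels map_rcons.
have n1 : (n.-1 < n)%N by rewrite prednK.
have := chain_rows n1; rewrite prednK // => ch.
pose r := ring_exponent R1 R2.
pose Zmul : submodClosed (triv_int n) := @multiples_pred _ (triv_int n) r.
pose G (v : quotmod K) (s : Zl n r) :=
  exists p, v = pi_quot K p /\ s = pi_quot Zmul (aug (coefs p) : triv_int n).
have augK p : p \in K -> (r%:Z %| aug (coefs p))%Z by move/(multilin_IdP _ n_gt0) => [].
have [p1 p1E] := coefs_surj (zs_perm (1%g : 'S_n)).
have Kp1 (k : int) : p1 *~ (r%:Z * k) \in K.
  apply/(multilin_IdP _ n_gt0); rewrite coefsMz augMz p1E aug_perm mul1r dvdz_mulr //.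
  split=> // j A; rewrite startingMz dvdz_mull // dvdz_mulr // dvdzE /=.
  exact: bimod_dvd_ring.
apply: (@chain_upto_rcons _ _ _ _ _ _ G ch) => //.
- move=> a _ _ _ _ [p [-> ->]] [q [-> ->]]; exists (a *: p + q).
  by rewrite !pi_quot_linear aug_linear pi_quot_linear.
- by move=> v _; have [p ->] := pi_quot_surj v; exists (pi_quot Zmul (aug (coefs p))), p.
- move=> s; have [k ->] := pi_quot_surj s; exists (pi_quot K (p1 *~ k)) => //.
  by exists (p1 *~ k); split=> //; rewrite coefsMz augMz p1E aug_perm mul1r.
- move=> v _ _ [p [-> ->]]; split.
    move/pi_quot_eq0/asboolP => [k pk]; exists (p - p1 *~ (r%:Z * k)).
      apply/level_last; rewrite coefsD -mulrNz coefsMz augD augMz p1E aug_perm mul1r pk.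
      by rewrite pmulrn -mulrzr intz mulrC subrr.
    by apply/pi_quotE; rewrite opprB addrC subrK; apply: Kp1.
  move=> [q /level_last q0 /pi_quotE pq]; apply/pi_quot_eq0/asboolP.
  have /dvdzP[k kE] := augK _ pq; exists k.
  rewrite -{1}(subrK q p) coefsD augD q0 addr0 kE.
  by rewrite pmulrn mulrzz.
Qed.
End Assembly.

Theorem theorem7 (R1 R2 : comPzRingType) (M : bimodType R1 R2) (n : nat)
    (n_gt0 : (0 < n)%N) (T : forall la : intpart n, tableau la) :
  exists labels : seq (option (intpart n)),
    (forall lab, count_mem lab labels = multiplicity lab)
    /\ has_chain (Pn_mod_Id n (utri M)) (map (chain_factor M T) labels).
Proof.
exists (all_labels n); split=> [lab|]; first exact: count_labels.
by apply: has_chain_of; apply: chain_full.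
Qed.
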